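(* Let $(W,S)$ be an irreducible Coxeter system and $q=(q_s)_{s\in S}\in\mathbb{R}_{>0}^{(W,S)}$ a multi-parameter. (1) If $(W,S)$ is of spherical or affine type, then $C_{r,q}^\ast(W)$ is not simple and does not have a unique tracial state, for any choice of the parameter $q$. (2) Suppose $|S|<\infty$. If $(W,S)$ is of non-affine type and the multi-parameter $(q_s^{\epsilon_s})_{s\in S}$, with $\epsilon_s=+1$ if $q_s\leq 1$ and $\epsilon_s=-1$ if $q_s>1$, lies in the closure of the region of convergence of the multivariate growth series of $W$, then $C_{r,q}^\ast(W)$ is not simple and does not have a unique tracial state. (3) If $(W,S)$ is right-angled with $3\leq|S|<\infty$, then there exists an open neighbourhood $\mathcal U$ of the multi-parameter $1=(1)_{s\in S}\in\mathbb R_{>0}^{S}$ such that $C_{r,q}^\ast(W)$ is simple for all $q\in\mathcal U$.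
   Context: A Coxeter system $(W,S)$ is a group $W$ generated by $S$ with relations $(st)^{m_{s,t}}=1$, $m_{s,s}=1$, $m_{s,t}=m_{t,s}\in\{2,3,\dots,\infty\}$ for $s\neq t$ ($\infty$ meaning no relation). Its Coxeter diagram has vertex set $S$ and edges $(s,t)$ with $m_{s,t}\geq 3$; $(W,S)$ is irreducible if the diagram is connected. It is right-angled if $m_{s,t}\in\{1,2,\infty\}$ for all $s,t$. An irreducible system is of spherical type if $W$ is locally finite (every finitely generated subgroup is finite), of affine type if $W$ is finitely generated, infinite and virtually abelian, and of non-affine type otherwise. $|\cdot|$ is the word length with respect to $S$. $\mathbb{R}_{>0}^{(W,S)}$ (resp. $\mathbb C^{(W,S)}$) is the set of tuples $(q_s)_{s\in S}$ of positive reals (resp. complex numbers) with $q_s=q_t$ whenever $s,t$ are conjugate in $W$; in the right-angled case $\mathbb{R}_{>0}^{(W,S)}=\mathbb{R}_{>0}^{S}$. For $z\in\mathbb C^{(W,S)}$ and a reduced expression $\mathbf w=s_1\cdots s_n$ put $z_{\mathbf w}=z_{s_1}\cdots z_{s_n}$. For $|S|<\infty$ the growth series is $W(z)=\sum_{\mathbf w\in W}z_{\mathbf w}$ and its region of convergence is $\mathcal R=\{z\in\mathbb C^{(W,S)}: W(z)\text{ converges}\}$. Put $p_s(q)=q_s^{-1/2}(q_s-1)$. On $\ell^2(W)$ with orthonormal basis $(\delta_{\mathbf w})_{\mathbf w\in W}$ let $T_s^{(q)}\delta_{\mathbf w}=\delta_{s\mathbf w}$ if $|s\mathbf w|>|\mathbf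 w|$ and $T_s^{(q)}\delta_{\mathbf w}=\delta_{s\mathbf w}+p_s(q)\delta_{\mathbf w}$ if $|s\mathbf w|<|\mathbf w|$. The reduced Hecke C$^\ast$-algebra $C_{r,q}^\ast(W)$ is the unital C$^\ast$-subalgebra of $\mathcal B(\ell^2(W))$ generated by $T_s^{(q)}$, $s\in S$. A C$^\ast$-algebra is simple if it has no non-trivial closed two-sided ideal. *)

(* Defs.v *)
From HB Require Import structures.
From mathcomp Require Import all_boot all_order all_algebra finmap ring lra.
From mathcomp Require Import complex.
From mathcomp Require Import all_classical all_reals all_analysis.
From mathcomp.analysis.showcase Require summability.

Set Implicit Arguments.
Unset Strict Implicit.
Unset Printing Implicit Defensive.
Import Order.TTheory GRing.Theory Num.Theory.
Import numFieldNormedType.Exports.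

Local Open Scope classical_set_scope.
Local Open Scope ring_scope.
Local Open Scope complex_scope.

Section Groups.
Variable W : groupType.
Implicit Types (X H : set W).
Local Open Scope group_scope.

Definition is_subgroup H :=
  H 1 /\ forall x y, H x -> H y -> H (x / y).

Definition generated_subgroup X : set W := smallest is_subgroup X.

Definition locally_finite :=
  forall X, finite_set X -> finite_set (generated_subgroup X).

Definition finitely_generated :=
  exists2 X, finite_set X & generated_subgroup X = [set: W].

Definition left_cosets H : set (set W) :=
  range (fun w => [set w * h | h in H]).

Definition virtually_abelian :=
  exists H, [/\ is_subgroup H, forall x y, H x -> H y -> commute x y
              & finite_set (left_cosets H)].

Definition spherical_type := locally_finite.
Definition affine_type :=
  [/\ finitely_generated, infinite_set [set: W] & virtually_abelian].
Definition nonaffine_type := ~ spherical_type /\ ~ affine_type.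

End Groups.

(* [cox_m s t = None] encodes m_{s,t} = oo. The last three fields say that W is
   the group presented by the generators S and the relations
   (s t)^{m_{s,t}} = 1; words without inverses suffice for generation because
   the generators are involutions (m_{s,s} = 1). *)
Record coxeterSystem (W : groupType) (S : choiceType) := CoxeterSystem {
  cox_gen : S -> W ;
  cox_m : S -> S -> option nat ;
  cox_gen_inj : injective cox_gen ;
  cox_m_diag : forall s, cox_m s s = Some 1%N ;
  cox_m_sym : forall s t, cox_m s t = cox_m t s ;
  cox_m_ge2 : forall s t k, s != t -> cox_m s t = Some k -> (2 <= k)%N ;
  cox_generates : forall w, exists l : seq S, (\prod_(s <- l) cox_gen s)%g = w ;
  cox_relations : forall s t k,
    cox_m s t = Some k -> ((cox_gen s * cox_gen t) ^+ k = 1)%g ;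
  cox_universal : forall (G : groupType) (f : S -> G),
    (forall s t k, cox_m s t = Some k -> ((f s * f t) ^+ k = 1)%g) ->
    exists2 phi : W -> G, {morph phi : x y / (x * y)%g}
      & forall s, phi (cox_gen s) = f s
}.

Section Coxeter.
Variables (W : groupType) (S : choiceType) (X : coxeterSystem W S).

Definition word_prod (l : seq S) : W := (\prod_(s <- l) cox_gen X s)%g.

Definition cox_edge : rel S := fun s t =>
  if cox_m X s t is Some k then (3 <= k)%N else true.

(* A connected graph is nonempty. *)
Definition irreducible :=
  [set: S] !=set0 /\
  forall s t, exists2 p : seq S, path cox_edge s p & last s p = t.

Definition right_angled :=
  forall s t, cox_m X s t \in [:: Some 1%N; Some 2%N; None].

Lemma word_length_subproof (w : W) :
  exists n, `[< exists2 l : seq S, word_prod l = w & size l = n >].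
Proof.
have [l lw] := cox_generates X w.
by exists (size l); apply/asboolP; exists l.
Qed.

Definition word_length (w : W) : nat := ex_minn (word_length_subproof w).

Definition reduced_expression (w : W) (l : seq S) :=
  word_prod l = w /\ size l = word_length w.

Definition conj_invariant (T : Type) (z : S -> T) :=
  forall s t (w : W), (cox_gen X s ^ w)%g = cox_gen X t -> z s = z t.

Definition multi_parameter (R : realType) (q : S -> R) :=
  (forall s, 0 < q s) /\ conj_invariant q.

(* z_w is computed along a chosen reduced expression; for conjugation-invariant
   z the value does not depend on that choice. *)
Definition weight (R : realType) (z : S -> R[i]) (w : W) : R[i] :=
  \prod_(s <- xget [::] [set l | reduced_expression w l]) z s.

(* Convergence of a family indexed by W: the net of the sums over the finite
   subsets of W converges. *)
Definition convergence_region (R : realType) : set {ptws S -> R[i]^o} :=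
  [set z | conj_invariant z /\
     cvg (summability.partial_sum (weight z : W -> R[i]^o)
            @ summability.totally)].

Definition flip_parameter (R : realType) (q : S -> R) : S -> R[i] :=
  fun s => (q s ^ (if q s <= 1 then 1 else -1 : int))%:C.

End Coxeter.
Arguments convergence_region {W S} X R.

Section L2.
Variables (R : realType) (W : choiceType).
Local Notation C := R[i].
Local Notation normc := ComplexField.Normc.normc.
Implicit Types f g : W -> C.

Definition sqr_sum f : \bar R :=
  (\esum_(w in [set: W]) (normc (f w) ^+ 2)%:E)%E.

Definition square_summable : {pred W -> C} :=
  mem [set f | (sqr_sum f < +oo)%E].

Lemma square_summableP f : (f \in square_summable) <-> (sqr_sum f < +oo)%E.
Proof. by split; rewrite inE. Qed.

Lemma sqr_sum_ge0 f : (0 <= sqr_sum f)%E.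
Proof. by apply: esum_ge0 => w _; rewrite lee_fin sqr_ge0. Qed.

Lemma sqr_sumZ (c : C) f :
  (sqr_sum (c *: f)%R <= (normc c ^+ 2)%:E * sqr_sum f)%E.
Proof.
apply: ge_ereal_sup => _ [A [finA _] <-].
have -> : (\sum_(w \in A) (normc ((c *: f)%R w) ^+ 2)%:E =
           (normc c ^+ 2)%:E * \sum_(w \in A) (normc (f w) ^+ 2)%:E)%E.
  rewrite ge0_mule_fsumr; last by move=> w; rewrite lee_fin sqr_ge0.
  apply: eq_fsbigr => w _.
  rewrite -EFinM; congr (_%:E).
  by rewrite -[(c *: f)%R w]/(c * f w) ComplexField.Normc.normcM exprMn.
rewrite lee_wpmul2l ?lee_fin ?sqr_ge0//.
by apply: ereal_sup_ubound; exists A.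
Qed.

Lemma sqr_sumD f g :
  (sqr_sum (f + g)%R <= 2%:E * (sqr_sum f + sqr_sum g))%E.
Proof.
have pos (h : W -> C) w : (0 <= (normc (h w) ^+ 2)%:E :> \bar R)%E.
  by rewrite lee_fin sqr_ge0.
rewrite /sqr_sum -esumD//.
apply: ge_ereal_sup => _ [A [finA _] <-].
apply: (@le_trans _ _ (2%:E * \sum_(w \in A)
   ((normc (f w) ^+ 2)%:E + (normc (g w) ^+ 2)%:E))%E).
  rewrite ge0_mule_fsumr; last by move=> w; rewrite adde_ge0.
  apply: lee_fsum => // w _; rewrite -EFinD -EFinM lee_fin.
  rewrite -[(f + g) w]/(f w + g w).
  have fg := le_normcD (f w : Rcomplex R) (g w).
  have n0 (x : C) : 0 <= normc x by case: x => a b; exact: sqrtr_ge0.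
  have := sqr_ge0 (normc (f w) - normc (g w)).
  have : normc (f w + g w) ^+ 2 <= (normc (f w) + normc (g w)) ^+ 2.
    by rewrite lerXn2r// nnegrE ?addr_ge0.
  set a := normc (f w); set b := normc (g w); set c := normc (_ + _).
  rewrite sqrrB sqrrD; move: (a ^+ 2) (b ^+ 2) (a * b) (c ^+ 2) => x y z t.
  by lra.
rewrite lee_wpmul2l ?lee_fin//.
by apply: ereal_sup_ubound; exists A.
Qed.

Lemma square_summable_submod : submod_closed square_summable.
Proof.
split; first by rewrite inE/= /sqr_sum esum1// => w _;
  rewrite -[0 w]/(0 : C) ComplexField.Normc.normc0 expr0n.
move=> c f g; rewrite !inE/= => foo goo.
apply: le_lt_trans (sqr_sumD _ _) _; apply: lte_mul_pinfty => //.
apply: lte_add_pinfty => //; apply: le_lt_trans (sqr_sumZ _ _) _.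
by apply: lte_mul_pinfty; rewrite ?lee_fin ?sqr_ge0// sqr_sum_ge0.
Qed.

HB.instance Definition _ :=
  GRing.isSubmodClosed.Build C (W -> C) square_summable square_summable_submod.

Record l2 := L2 { l2_fun :> W -> C ; _ : l2_fun \in square_summable }.
HB.instance Definition _ := [isSub for l2_fun].
HB.instance Definition _ := [Choice of l2 by <:].
HB.instance Definition _ := [SubChoice_isSubLmodule of l2 by <:].

Definition l2_norm (f : l2) : R := Num.sqrt (fine (sqr_sum f)).

Definition l2_dot (f g : l2) : C :=
  summability.sum (fun w => f w * (g w)^* : C^o).

Lemma l2_delta_subproof (w : W) :
  (fun v => (v == w)%:R : C) \in square_summable.
Proof.
rewrite inE/= /sqr_sum (esumID [set w])//; last first.
  by move=> v _; rewrite lee_fin sqr_ge0.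
rewrite [X in (_ + X)%E]esum1 => [|v [_ /= /eqP/negPf ->]]; last first.
  by rewrite ComplexField.Normc.normc0 expr0n.
by rewrite adde0 setTI esum_set1 ?ltry// lee_fin sqr_ge0.
Qed.

Definition l2_delta (w : W) : l2 := L2 (l2_delta_subproof w).

End L2.

Section Operators.
Variables (R : realType) (W : choiceType).
Local Notation C := R[i].
Local Notation H := (l2 R W).
Local Notation op := (H -> H).

Definition bounded_op : set op :=
  [set a | linear a /\
           exists M : R, forall f, l2_norm (a f) <= M * l2_norm f].

Definition op_norm (a : op) : R :=
  sup [set l2_norm (a f) | f in [set f | l2_norm f <= 1]].

Definition op_adjoint (a b : op) :=
  forall f g, l2_dot (a f) g = l2_dot f (b g).

Definition norm_closed (A : set op) :=
  forall a, bounded_op a ->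
    (forall e : R, 0 < e -> exists2 b, A b & op_norm (a - b) < e) -> A a.

Definition unital_cstar_subalgebra (A : set op) :=
  [/\ A `<=` bounded_op,
      A id,
      forall (c : C) a b, A a -> A b -> A (c *: a + b),
      forall a b, A a -> A b -> A (a \o b) &
      forall a b, A a -> bounded_op b -> op_adjoint a b -> A b]
  /\ norm_closed A.

Definition generated_cstar_algebra (G : set op) : set op :=
  smallest unital_cstar_subalgebra G.

Definition closed_ideal (A I : set op) :=
  [/\ I `<=` A,
      I 0,
      forall (c : C) a b, I a -> I b -> I (c *: a + b),
      forall a b, A a -> I b -> I (a \o b) /\ I (b \o a) &
      norm_closed I].

Definition cstar_simple (A : set op) :=
  forall I, closed_ideal A I -> I = [set 0] \/ I = A.

(* Only the values of tau on A matter. The order of R[i] makes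
   [0 <= z] mean that z is real and nonnegative. *)
Definition tracial_state (A : set op) (tau : op -> C) :=
  [/\ forall (c : C) a b, A a -> A b -> tau (c *: a + b) = c * tau a + tau b,
      forall a b, A a -> A b -> op_adjoint a b -> 0 <= tau (b \o a),
      tau id = 1 &
      forall a b, A a -> A b -> tau (a \o b) = tau (b \o a)].

Definition unique_tracial_state (A : set op) :=
  exists2 tau, tracial_state A tau &
    forall tau', tracial_state A tau' -> forall a, A a -> tau' a = tau a.

End Operators.

Section Hecke.
Variables (R : realType) (W : groupType) (S : choiceType).
Variables (X : coxeterSystem W S) (q : S -> R).
Local Notation C := R[i].
Local Notation H := (l2 R W).
Local Notation normc := ComplexField.Normc.normc.

Definition hecke_p (s : S) : R := (Num.sqrt (q s))^-1 * (q s - 1).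

Definition left_descent (s : S) (w : W) : bool :=
  (word_length X (cox_gen X s * w)%g < word_length X w)%N.

Definition shift_fun (s : S) (f : W -> C) : W -> C :=
  fun v => f (cox_gen X s * v)%g.

Definition descent_fun (s : S) (f : W -> C) : W -> C :=
  fun v => if left_descent s v then f v else 0.

Lemma cox_gen_invol s (w : W) : (cox_gen X s * (cox_gen X s * w) = w)%g.
Proof.
have := cox_relations (cox_m_diag X s); rewrite expg1 => ss.
by rewrite mulgA ss mul1g.
Qed.

Lemma sqr_sum_shift s f : sqr_sum (shift_fun s f) = sqr_sum f.
Proof.
rewrite /sqr_sum [RHS](reindex_esum [set: W] _ (fun v => cox_gen X s * v)%g)//.
split=> //.
- by move=> x y _ _ /(congr1 (fun v => cox_gen X s * v)%g); rewrite !cox_gen_invol.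
- by move=> x _; exists (cox_gen X s * x)%g => //; rewrite cox_gen_invol.
Qed.

Lemma sqr_sum_descent s f : (sqr_sum (descent_fun s f) <= sqr_sum f)%E.
Proof.
apply: le_esum => w _; rewrite /descent_fun; case: ifP => // _.
by rewrite ComplexField.Normc.normc0 expr0n/= lee_fin sqr_ge0.
Qed.

Lemma hecke_op_subproof s (f : H) :
  shift_fun s f + (hecke_p s)%:C *: descent_fun s f
    \in @square_summable R W.
Proof.
have fP : (sqr_sum f < +oo)%E by apply/square_summableP; case: f.
apply: rpredD; first by apply/square_summableP; rewrite sqr_sum_shift.
apply: rpredZ; apply/square_summableP.
exact: le_lt_trans (sqr_sum_descent _ _) fP.
Qed.

(* (T_s f)(v) = f(s v) + [|s v| < |v|] p_s f(v) is the bounded operator given on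
   the basis vectors by [hecke_op_delta]. *)
Definition hecke_op (s : S) (f : H) : H := L2 (hecke_op_subproof s f).

Lemma hecke_op_delta (s : S) (w : W) :
  hecke_op s (l2_delta R w) =
    l2_delta R (cox_gen X s * w)%g +
    (if left_descent s w then (hecke_p s)%:C *: l2_delta R w else 0).
Proof.
apply/val_inj/funext => v /=.
have e : (cox_gen X s * v == w)%g = (v == cox_gen X s * w)%g.
  by apply/eqP/eqP => [<-|->]; rewrite cox_gen_invol.
rewrite -[LHS]/((cox_gen X s * v == w)%g%:R + (hecke_p s)%:C *
  (if left_descent s v then (v == w)%:R else 0)) e.
rewrite -[RHS]/((v == cox_gen X s * w)%g%:R +
  l2_fun (if left_descent s w then (hecke_p s)%:C *: l2_delta R w else 0) v).
congr (_ + _).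
have [->|vw] := eqVneq v w; first by
  case: ifP => _; [rewrite -[RHS]/(_ * (w == w)%:R) eqxx | rewrite mulr0].
case: ifP => _; rewrite mulr0; case: ifP => _ //;
  by rewrite -[RHS]/(_ * (v == w)%:R) (negPf vw) mulr0.
Qed.

Lemma hecke_op_bounded (s : S) : bounded_op (hecke_op s).
Proof.
split=> [c f g|].
  apply/val_inj/funext => v /=.
  rewrite -[LHS]/(c * f (cox_gen X s * v)%g + g (cox_gen X s * v)%g +
    (hecke_p s)%:C * (if left_descent s v then c * f v + g v else 0)).
  rewrite -[RHS]/(c * (f (cox_gen X s * v)%g +
    (hecke_p s)%:C * (if left_descent s v then f v else 0)) +
    (g (cox_gen X s * v)%g +
    (hecke_p s)%:C * (if left_descent s v then g v else 0))).
  by case: ifP => _; ring.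
set p := normc (hecke_p s)%:C ^+ 2.
exists (Num.sqrt (2 * (1 + p))) => f.
have fin (h : H) : sqr_sum h \is a fin_num.
  by rewrite ge0_fin_numE ?sqr_sum_ge0//; apply/square_summableP; case: h.
have p0 : 0 <= p by rewrite sqr_ge0.
rewrite /l2_norm -sqrtrM ?mulr_ge0 ?addr_ge0// ler_wsqrtr//.
rewrite -lee_fin EFinM !fineK//.
apply: le_trans (sqr_sumD _ _) _; rewrite EFinM -muleA lee_wpmul2l ?lee_fin//.
rewrite sqr_sum_shift EFinD ge0_muleDl ?lee_fin// mul1e leeD2l//.
apply: le_trans (sqr_sumZ _ _) _; rewrite lee_wpmul2l ?lee_fin//.
exact: sqr_sum_descent.
Qed.

Definition hecke_cstar_algebra : set (H -> H) :=
  generated_cstar_algebra (range hecke_op).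

End Hecke.

(* Main.v *)
Require Import Defs.
From HB Require Import structures.
From mathcomp Require Import all_boot all_order all_algebra finmap ring lra zify.
From mathcomp Require Import complex.
From mathcomp Require Import all_classical all_reals all_analysis.

Set Implicit Arguments.
Unset Strict Implicit.
Unset Printing Implicit Defensive.
Import Order.TTheory GRing.Theory Num.Theory.
Import numFieldNormedType.Exports.

(** Parts (1) and (2) hold because of a character. Let [root_s] be [q_s^(1/2)] if
    [q_s <= 1] and [- q_s^(-1/2)] otherwise. Then [root_s^2 = 1 + p_s root_s], so
    [T_s |-> root_s] is a one-dimensional representation of the Hecke algebra; a
    formal eigenvector for it is [root_w : w |-> root_(s_1) ... root_(s_n)], for
    [s_1 ... s_n] a reduced word of [w]. If the sums of [root_w^2] over the balls
    of [W] grow subexponentially, then some ball carries almost the same mass as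
    the next one, and the truncations of [root_w] are approximate eigenvectors in
    [l^2(W)] ([exists_eigvec]). The representation is then bounded by the
    operator norm and extends to the C*-algebra ([eigval_A]). It is a tracial
    state that differs from the canonical trace, and its kernel is a non-trivial
    closed ideal ([character_not_simple]). Since [|root_w| <= 1], the growth
    condition holds if the balls themselves grow polynomially, as they do in
    locally finite and in virtually abelian groups. It also holds if
    [(root_s^2)_s], which is the flipped parameter, is a limit of points of the
    region of convergence: a nearby point of convergence [z] bounds the growth by
    any given exponential ([closure_subexponential]).

    For (3), averages of conjugates by unitaries of the algebra are shown to
    converge to the trace. [T_s] is a linear combination of 1 and a symmetry
    [unit_op s] of the algebra, which is close to the left translation by [s]
    if [q_s] is close to 1. The conjugation action of [W] on
    [l^2(W \ {1})] has a spectral gap for three suitable words: almost invariant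
    vectors would contradict a paradoxical decomposition of [W \ {1}]
    ([conj_spectral_gap]). The gap survives the passage to the unitaries, so that
    the average [avg_op] contracts the vectors [x delta_1] with zero coefficient
    at 1 by a fixed factor [rho < 1]. An inequality of Haagerup's type ([haagerup])
    turns this into a statement on operator norms: on the span of the [T_v] with
    [|v| <= k], the operator norm of [x] is at most [|x delta_1|] times a
    polynomial in [k]. The reason is that an element of a right-angled group has
    only polynomially many reduced factorizations with a first factor of length
    at most [k] ([card_prefixes]). The supports of the iterated averages grow
    linearly, so the geometric decay wins ([avg_iter_small]). Finally, a nonzero
    closed ideal contains an element of trace 1; its averages stay in the ideal
    and come close to 1, hence the ideal contains 1 ([averaging_simple]).

    The combinatorics of Coxeter groups that this uses comes from the
    universal property alone: a homomorphism to the semidirect product of the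
    subsets of [W] by [W] defines the inversions of an element and identifies them
    with the reflections that shorten it ([descE]). *)

Local Open Scope classical_set_scope.

(** * Two groups that receive homomorphisms from a Coxeter group *)

Section ReflectionGroup.
Variable W : groupType.
Local Open Scope group_scope.

(** The semidirect product of the subsets of [W], with symmetric difference as
    addition, by [W] acting by conjugation. The map [s |-> ({s}, s)] respects the
    Coxeter relations, and the first component of the image of [w] is the set of
    inversions of [w]. *)
Definition refl_group : Type := ((W -> bool) * W)%type.
HB.instance Definition _ := Choice.on refl_group.

Implicit Types x y z : refl_group.

Definition refl_mul x y : refl_group :=
  (fun r => x.1 r (+) y.1 (x.2^-1 * r * x.2), x.2 * y.2).
Definition refl_one : refl_group := (fun=> false, 1).
Definition refl_inv x : refl_group := (fun r => x.1 (x.2 * r * x.2^-1), x.2^-1).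

Lemma refl_mulA : associative refl_mul.
Proof.
move=> x y z; rewrite /refl_mul /=; congr pair; last by rewrite mulgA.
by apply/funext => r; rewrite invgM !mulgA addbA.
Qed.

Lemma refl_mul1 : left_id refl_one refl_mul.
Proof.
move=> [A w]; rewrite /refl_mul /=; congr pair; last by rewrite mul1g.
by apply/funext => r; rewrite invg1 mul1g mulg1.
Qed.

Lemma refl_mulr1 : right_id refl_one refl_mul.
Proof.
move=> [A w]; rewrite /refl_mul /=; congr pair; last by rewrite mulg1.
by apply/funext => r; rewrite addbF.
Qed.

Lemma refl_mulV : left_inverse refl_one refl_inv refl_mul.
Proof.
move=> [A w]; rewrite /refl_mul /=; congr pair; last by rewrite mulVg.
by apply/funext => r; rewrite invgK addbb.
Qed.

Lemma refl_mulrV : right_inverse refl_one refl_inv refl_mul.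
Proof.
move=> [A w]; rewrite /refl_mul /=; congr pair; last by rewrite mulgV.
by apply/funext => r; rewrite !mulgA mulgV mul1g mulgK addbb.
Qed.

HB.instance Definition _ := isGroup.Build refl_group
  refl_mulA refl_mul1 refl_mulr1 refl_mulV refl_mulrV.

End ReflectionGroup.

(** The infinite dihedral group, acting on the integers: [(m, b)] is the map
    [x |-> m + (-1)^b x]. *)
Definition dihedral : Type := (int * bool)%type.
HB.instance Definition _ := Choice.on dihedral.

Section Dihedral.
Local Open Scope ring_scope.
Implicit Types x y z : dihedral.

Definition dih_mul x y : dihedral :=
  (x.1 + (-1) ^+ x.2 * y.1, x.2 (+) y.2).
Definition dih_one : dihedral := (0, false).
Definition dih_inv x : dihedral := (- ((-1) ^+ x.2 * x.1), x.2).

Lemma dih_mulA : associative dih_mul.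
Proof.
move=> [m []] [n []] [p []]; rewrite /dih_mul /= ?expr0 ?expr1; congr pair; ring.
Qed.
Lemma dih_mul1 : left_id dih_one dih_mul.
Proof. by move=> [m b]; rewrite /dih_mul /= expr0 add0r mul1r. Qed.
Lemma dih_mulr1 : right_id dih_one dih_mul.
Proof. by move=> [m b]; rewrite /dih_mul /= mulr0 addr0 addbF. Qed.
Lemma dih_mulV : left_inverse dih_one dih_inv dih_mul.
Proof.
by move=> [m []]; rewrite /dih_mul /dih_inv /dih_one /=; congr pair; ring.
Qed.
Lemma dih_mulrV : right_inverse dih_one dih_inv dih_mul.
Proof.
by move=> [m []]; rewrite /dih_mul /dih_inv /dih_one /=; congr pair; ring.
Qed.

HB.instance Definition _ := isGroup.Build dihedral
  dih_mulA dih_mul1 dih_mulr1 dih_mulV dih_mulrV.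

Lemma dih_mulE x y : (x * y)%g = dih_mul x y. Proof. by []. Qed.
End Dihedral.

(** * Inversion sets, lengths and descents *)

Section Inversions.
Variables (W : groupType) (S : choiceType) (X : coxeterSystem W S).
Local Notation gen := (cox_gen X).
Local Notation len := (word_length X).
Local Notation desc := (left_descent X).
Local Open Scope group_scope.

Lemma gen2 s : gen s * gen s = 1.
Proof. by have := cox_relations (cox_m_diag X s); rewrite expg1. Qed.

Lemma genV s : (gen s)^-1 = gen s.
Proof. exact: mulg1_eq (gen2 s). Qed.

Lemma genK s w : gen s * (gen s * w) = w.
Proof. exact: cox_gen_invol. Qed.

Lemma genKr s w : w * gen s * gen s = w.
Proof. by rewrite -mulgA gen2 mulg1. Qed.

Lemma gen_move s v w : (gen s * v == w) = (v == gen s * w).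
Proof. by apply/eqP/eqP => [<-|->]; rewrite genK. Qed.

Definition refl_gen s : refl_group W := (fun r => r == gen s, gen s).

Lemma refl_gen_pow s t k r :
  ((refl_gen s * refl_gen t) ^+ k).1 r =
  \big[addb/false]_(i < k + k) (((gen s * gen t) ^+ i)%g * gen s == r).
Proof.
elim: k r => [|k IH] r; first by rewrite big_ord0.
rewrite expgS [LHS]/= IH addSn addnS !big_ord_recl /= addbA; congr (_ (+) _ (+) _).
- by rewrite mul1g eq_sym.
- rewrite genV /bump /= addn0 expg1.
  by apply/eqP/eqP => [<-|<-]; rewrite ?mulgA ?gen2 ?mul1g ?genKr ?gen2 ?mul1g.
- apply: eq_bigr => i _; rewrite /bump /= !add1n expgS expgSr invgM !genV.
  set c := _ ^+ i.
  apply/eqP/eqP => [h|<-]; last by rewrite !mulgA !genKr -!mulgA !genK.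
  transitivity (gen s * gen t * (c * gen s) * (gen t * gen s)).
    by rewrite !mulgA.
  by rewrite h !mulgA !genKr -!mulgA !genK.
Qed.

(** The reflections collected by [refl_gen_pow] are [(s t)^i s] for [i < 2 k]. If
    [(s t)^k = 1], then the second half repeats the first and cancels it. *)
Lemma refl_gen_rel s t k : cox_m X s t = Some k ->
  (refl_gen s * refl_gen t) ^+ k = 1.
Proof.
move=> mst; rewrite [LHS]surjective_pairing; congr pair.
  apply/funext => r; rewrite refl_gen_pow big_split_ord /=.
  rewrite [X in _ (+) X](_ : _ =
    \big[addb/false]_(i < k) (((gen s * gen t) ^+ i)%g * gen s == r)) ?addbb//.
  by apply: eq_bigr => i _; rewrite expgnDr (cox_relations mst) mul1g.
rewrite -(cox_relations mst); elim: k {mst} => //= k IH.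
by rewrite !expgS /= IH.
Qed.

Lemma refl_morphism_subproof : exists phi : W -> refl_group W,
  {morph phi : x y / x * y} /\ forall s, phi (gen s) = refl_gen s.
Proof. by have [phi] := cox_universal (f := refl_gen) refl_gen_rel; exists phi. Qed.

Definition refl_morphism : W -> refl_group W := sval (cid refl_morphism_subproof).

Lemma refl_morphismM : {morph refl_morphism : x y / x * y}.
Proof. by case: (svalP (cid refl_morphism_subproof)). Qed.

Lemma refl_morphism_gen s : refl_morphism (gen s) = refl_gen s.
Proof. by case: (svalP (cid refl_morphism_subproof)). Qed.

Lemma morphism1 (G : groupType) (phi : W -> G) :
  {morph phi : x y / x * y} -> phi 1 = 1.
Proof.
by move=> phiM; have := phiM 1 1; rewrite mul1g => /(congr1 (fun x => (phi 1)^-1 * x));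
  rewrite mulKg mulVg.
Qed.

Lemma word_ind (P : W -> Prop) :
  P 1 -> (forall s w, P w -> P (gen s * w)) -> forall w, P w.
Proof.
move=> P1 PM w; have [l <-] := cox_generates X w.
by elim: l => [|s l IH]; rewrite ?big_nil// big_cons; apply: PM.
Qed.

Lemma refl_morphism2 w : (refl_morphism w).2 = w.
Proof.
elim/word_ind: w => [|s w IH]; first by rewrite (morphism1 refl_morphismM).
by rewrite refl_morphismM refl_morphism_gen /= IH.
Qed.

Definition inversion (w r : W) : bool := (refl_morphism w).1 r.

Lemma inversionM v w r :
  inversion (v * w) r = inversion v r (+) inversion w (v^-1 * r * v).
Proof. by rewrite /inversion refl_morphismM /= refl_morphism2. Qed.

Lemma inversion1 r : inversion 1 r = false.
Proof. by rewrite /inversion (morphism1 refl_morphismM). Qed.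

Lemma inversion_gen s r : inversion (gen s) r = (r == gen s).
Proof. by rewrite /inversion refl_morphism_gen. Qed.

(** The letter [s_i] of [s_1 ... s_n] contributes
    [s_1 ... s_{i-1} s_i s_{i-1} ... s_1]. *)
Fixpoint word_refls (l : seq S) : seq W :=
  if l is s :: l' then gen s :: [seq gen s * r * gen s | r <- word_refls l']
  else [::].

Lemma word_prod_cons s l : word_prod X (s :: l) = gen s * word_prod X l.
Proof. by rewrite /word_prod big_cons. Qed.

Lemma word_prod_cat l1 l2 :
  word_prod X (l1 ++ l2) = word_prod X l1 * word_prod X l2.
Proof. by rewrite /word_prod big_cat. Qed.

Lemma word_prod_nil : word_prod X [::] = 1.
Proof. by rewrite /word_prod big_nil. Qed.

Lemma conj_gen_inj s : injective (fun r => gen s * r * gen s).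
Proof. by move=> x y /mulIg/mulgI. Qed.

Lemma conj_genK s : involutive (fun r => gen s * r * gen s).
Proof. by move=> x; rewrite !mulgA gen2 mul1g genKr. Qed.

(** The homomorphism can be evaluated along any word, so this parity depends on
    the element only. *)
Lemma inversion_word_prod l r :
  inversion (word_prod X l) r = odd (count_mem r (word_refls l)).
Proof.
elim: l r => [|s l IH] r; first by rewrite word_prod_nil inversion1.
rewrite word_prod_cons inversionM inversion_gen IH /= oddD oddb eq_sym.
congr (_ (+) odd _); rewrite count_map genV; apply: eq_count => x /=.
by rewrite (inv_eq (conj_genK s)).
Qed.

Lemma len_le l : (len (word_prod X l) <= size l)%N.
Proof.
rewrite /word_length; case: ex_minnP => n _; apply.
by apply/asboolP; exists l.
Qed.

Definition rword (w : W) : seq S := xget [::] [set l | reduced_expression X w l].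

Lemma rwordP w : reduced_expression X w (rword w).
Proof.
rewrite /rword; case: xgetP => //= no; exfalso.
have [n /asboolP [l lw ln] min] := ex_minnP (word_length_subproof X w).
apply: (no l); split => //; rewrite ln /word_length; case: ex_minnP => m hm hmin.
apply/eqP; rewrite eqn_leq min// hmin//; apply/asboolP; by exists l.
Qed.

Lemma rwordK w : word_prod X (rword w) = w. Proof. by case: (rwordP w). Qed.
Lemma size_rword w : size (rword w) = len w. Proof. by case: (rwordP w). Qed.

Lemma len1 : len 1 = 0%N.
Proof. by apply/eqP; rewrite -leqn0 -{1}word_prod_nil (leq_trans (len_le _)). Qed.

Lemma len_eq0 w : len w = 0%N -> w = 1.
Proof.
by rewrite -size_rword => /eqP/nilP h; rewrite -(rwordK w) h word_prod_nil.
Qed.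

Lemma len_gen_le s w : (len (gen s * w) <= (len w).+1)%N.
Proof.
by rewrite -{1}(rwordK w) -word_prod_cons (leq_trans (len_le _))//= size_rword.
Qed.

Lemma lenM_le v w : (len (v * w) <= len v + len w)%N.
Proof.
rewrite -{1}(rwordK v) -{1}(rwordK w) -word_prod_cat (leq_trans (len_le _))//.
by rewrite size_cat !size_rword.
Qed.

Lemma word_prod_rev l : word_prod X (rev l) = (word_prod X l)^-1.
Proof.
elim: l => [|s l IH]; first by rewrite word_prod_nil invg1.
by rewrite rev_cons -cats1 word_prod_cat !word_prod_cons word_prod_nil mulg1 invgM IH genV.
Qed.

Lemma lenV w : len w^-1 = len w.
Proof.
have h v : (len v^-1 <= len v)%N.
  by rewrite -{1}(rwordK v) -word_prod_rev (leq_trans (len_le _))// size_rev size_rword.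
by apply/eqP; rewrite eqn_leq h -{1}(invgK w) h.
Qed.

(** Deleting the letter attached to a reflection multiplies the word by that
    reflection. *)
Lemma refl_deletion l r : r \in word_refls l ->
  exists2 l', word_prod X l' = r * word_prod X l & (size l' < size l)%N.
Proof.
elim: l r => //= s l IH r; rewrite inE => /orP[/eqP ->|/mapP[r' /IH[l' h sz]] ->].
  by exists l; rewrite // word_prod_cons genK.
by exists (s :: l'); rewrite // !word_prod_cons h !mulgA genKr.
Qed.

Lemma inversion_len r w : inversion w r -> (len (r * w) < len w)%N.
Proof.
rewrite -{1}(rwordK w) inversion_word_prod => odc.
have /refl_deletion[l' h sz] : r \in word_refls (rword w).
  by rewrite -has_pred1 has_count; case: count odc.
by rewrite -{1}(rwordK w) -h (leq_ltn_trans (len_le _))// -size_rword.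
Qed.

Lemma inversion_flip s w : inversion (gen s * w) (gen s) = ~~ inversion w (gen s).
Proof. by rewrite inversionM inversion_gen eqxx mulVg mul1g. Qed.

(** An inversion shortens the element by deletion of a letter. Conversely, exactly
    one of [w] and [s w] has [s] as an inversion, and it is the longer one. *)
Lemma descE s w : desc s w = inversion w (gen s).
Proof.
apply/idP/idP => [dsw|]; last exact: inversion_len.
apply: contraLR dsw => ninv; rewrite /left_descent -leqNgt ltnW//.
have := @inversion_len (gen s) (gen s * w).
by rewrite inversion_flip ninv genK => /(_ isT).
Qed.

Lemma desc_flip s w : desc s (gen s * w) = ~~ desc s w.
Proof. by rewrite !descE inversion_flip. Qed.

Lemma len_desc s w : desc s w -> len w = (len (gen s * w)).+1.
Proof.
move=> d; apply/eqP; rewrite eqn_leq; apply/andP; split; last exact: d.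
by rewrite -{1}(genK s w) len_gen_le.
Qed.

Lemma len_asc s w : ~~ desc s w -> len (gen s * w) = (len w).+1.
Proof.
by move=> d; rewrite (@len_desc s (gen s * w)) ?desc_flip// genK.
Qed.

Lemma desc1 s : desc s 1 = false.
Proof. by rewrite /left_descent len1 ltn0. Qed.

Lemma len_gen s : len (gen s) = 1%N.
Proof. by rewrite -[gen s]mulg1 len_asc ?desc1// len1. Qed.

Lemma gen_neq1 s : gen s != 1.
Proof. by apply/eqP => h; have := len_gen s; rewrite h len1. Qed.

Lemma exists_desc w : w != 1 -> exists s, desc s w.
Proof.
move=> w1; case E : (rword w) => [|s l].
  by move: w1; rewrite -(rwordK w) E word_prod_nil eqxx.
have ew : gen s * w = word_prod X l by rewrite -(rwordK w) E word_prod_cons genK.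
by exists s; rewrite /left_descent ew -(size_rword w) E ltnS len_le.
Qed.

Lemma len_ind (P : W -> Prop) : P 1 ->
  (forall s w, ~~ desc s w -> P w -> P (gen s * w)) -> forall w, P w.
Proof.
move=> P1 PM w; move: {2}(len w) (leqnn (len w)) => n.
elim: n w => [|n IH] w.
  by rewrite leqn0 => /eqP/len_eq0->.
have [->|/exists_desc[s dsw]] := eqVneq w 1; first by [].
rewrite (len_desc dsw) ltnS => /IH Pw; rewrite -(genK s w).
by apply: PM => //; rewrite desc_flip negbK.
Qed.

(** A right multiplication changes left descents only when it acts as a left
    multiplication: the inversion sets of [w] and [w s] differ exactly in the
    reflection [w s w^-1]. *)
Lemma desc_mulr s t w : gen t * w != w * gen s -> desc t (w * gen s) = desc t w.
Proof.
move=> ne; rewrite !descE inversionM inversion_gen; case: eqP => [h|]; last by rewrite addbF.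
by case/eqP: ne; rewrite -h !mulgA mulgV mul1g.
Qed.

Lemma reduced_cons s l : size (s :: l) = len (word_prod X (s :: l)) ->
  size l = len (word_prod X l) /\ ~~ desc s (word_prod X l).
Proof.
rewrite word_prod_cons /= => h.
have := len_le l; have := len_gen_le s (word_prod X l); rewrite -h ltnS => a b.
have e : size l = len (word_prod X l) by apply/eqP; rewrite eqn_leq a b.
by split => //; rewrite /left_descent -h -e -leqNgt leqW.
Qed.

(** A repetition among the reflections would make the first letter of some suffix
    of the word a descent of the rest of that suffix. *)
Lemma reduced_refls l : size l = len (word_prod X l) ->
  uniq (word_refls l) /\ forall r, inversion (word_prod X l) r = (r \in word_refls l).
Proof.
elim: l => [|s l IH] h; first by split => // r; rewrite word_prod_nil inversion1.
have [/IH[ul memr] nd] := reduced_cons h.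
have u : uniq (word_refls (s :: l)).
  rewrite /= map_inj_uniq ?ul ?andbT; last exact: conj_gen_inj.
  apply: contra nd => /mapP[r rl e]; rewrite descE memr.
  suff -> : gen s = r by [].
  by rewrite -[r](conj_genK s) -e ?mulgA gen2 mul1g.
by split => // r; rewrite inversion_word_prod count_uniq_mem// oddb.
Qed.

End Inversions.

Section ReducedWords.
Variables (W : groupType) (S : choiceType) (X : coxeterSystem W S).
Local Notation gen := (cox_gen X).
Local Notation len := (word_length X).
Local Notation desc := (left_descent X).
Local Open Scope group_scope.

(** Two reduced words of one element carry the same reflections, and a
    conjugation invariant labelling of the letters is a labelling of the
    reflections. *)
Lemma perm_reduced (T : eqType) (z : S -> T) l l' : conj_invariant X z ->
  size l = len (word_prod X l) -> size l' = len (word_prod X l') ->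
  word_prod X l = word_prod X l' -> perm_eq (map z l) (map z l').
Proof.
move=> zconj redl redl' ll'.
pose z' (r : W) : option T :=
  if pselect (exists s w, gen s ^ w = r) is left e then Some (z (sval (cid e)))
  else None.
have z'E s w : z' (gen s ^ w) = Some (z s).
  rewrite /z'; case: pselect => [e|[]]; last by exists s, w.
  case: (cid e) => s' /= [w' h]; congr Some; apply: (zconj _ _ (w' * w^-1)).
  by rewrite conjgM h conjgK.
have z'map (k : seq S) (v : W) : [seq z' (r ^ v) | r <- word_refls X k] =
    [seq Some (z s) | s <- k].
  elim: k v => //= s k IH v; rewrite z'E -map_comp; congr cons.
  rewrite -(IH (gen s * v)); apply: eq_map => r /=; congr z'.
  by rewrite conjgM; congr (_ ^ v); rewrite conjgE genV mulgA.
apply: (@perm_map_inj _ _ (@Some T)); first by move=> x y [].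
rewrite -!map_comp -(z'map l 1) -(z'map l' 1); apply: perm_map.
have [u memr] := reduced_refls redl; have [u' memr'] := reduced_refls redl'.
by apply: uniq_perm => // r; rewrite -memr -memr' ll'.
Qed.

Lemma perm_rword_cons (T : eqType) (z : S -> T) s w : conj_invariant X z ->
  ~~ desc s w ->
  perm_eq (map z (rword X (gen s * w))) (z s :: map z (rword X w)).
Proof.
move=> zc nd; rewrite -map_cons; apply: perm_reduced => //.
- by rewrite rwordK size_rword.
- by rewrite word_prod_cons rwordK /= size_rword len_asc.
- by rewrite word_prod_cons !rwordK.
Qed.

Lemma rword1 : rword X 1 = [::].
Proof. by apply/nilP; rewrite /nilp size_rword len1. Qed.

End ReducedWords.

Section RightAngled.
Variables (W : groupType) (S : choiceType) (X : coxeterSystem W S).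
Hypothesis raX : right_angled X.
Local Notation gen := (cox_gen X).
Local Notation len := (word_length X).
Local Notation desc := (left_descent X).
Local Open Scope group_scope.

Lemma ra_m_eq s t : s != t -> cox_m X s t = Some 2%N \/ cox_m X s t = None.
Proof.
move=> st; have := raX s t; rewrite !inE => /or3P[|/eqP ->|/eqP ->]; auto.
by move=> /eqP /(cox_m_ge2 st).
Qed.

Lemma m2_comm s t : cox_m X s t = Some 2%N -> gen s * gen t = gen t * gen s.
Proof.
move=> /cox_relations; rewrite expg2 => /mulg1_eq <-.
by rewrite invgM !genV.
Qed.

Lemma ra_cases s t : s != t -> cox_edge X s t \/ gen s * gen t = gen t * gen s.
Proof.
move=> /ra_m_eq[|] h; [right; exact: m2_comm|by left; rewrite /cox_edge h].
Qed.

Lemma edge_None s t : cox_edge X s t -> cox_m X s t = None.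
Proof.
rewrite /cox_edge; have := raX s t.
by rewrite !inE => /or3P[] /eqP ->.
Qed.

Lemma edge_sym s t : cox_edge X s t = cox_edge X t s.
Proof. by rewrite /cox_edge cox_m_sym. Qed.

Lemma edge_neq s t : cox_edge X s t -> s != t.
Proof. by apply: contraTneq => ->; rewrite /cox_edge cox_m_diag. Qed.

(** Sending [s] to the reflection at 0, [t] to the reflection at 1/2 and the
    other generators to 1 respects the relations of a right-angled system. *)
Lemma ra_dihedral s t : cox_m X s t = None -> exists phi : W -> dihedral,
  [/\ {morph phi : x y / x * y}, phi (gen s) = (0%R, true) &
      phi (gen t) = (1%R, true)].
Proof.
move=> mst.
have st : s != t by apply/eqP => h; move: mst; rewrite h cox_m_diag.
pose f u : dihedral := if u == s then (0%R, true) else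
  if u == t then (1%R, true) else (0%R, false).
have [u v k muv|phi phiM phig] := cox_universal (f := f) (c := X); last first.
  by exists phi; rewrite !phig /f !eqxx eq_sym (negPf st).
have [uv|uv] := eqVneq u v.
  move: muv; rewrite uv cox_m_diag => -[<-]; rewrite expg1 /f.
  by case: ifP => _ //; case: ifP => _.
have [m2|] := ra_m_eq uv; last by rewrite muv.
move: muv; rewrite m2 => -[<-]; rewrite expg2 /f.
have [us|us] := eqVneq u s; have [vs|vs] := eqVneq v s.
- by move: uv; rewrite us vs eqxx.
- by have [vt|//] := eqVneq v t; move: m2; rewrite us vt mst.
- by have [ut|//] := eqVneq u t; move: m2; rewrite ut vs cox_m_sym mst.
- by have [ut|ut] := eqVneq u t; have [vt|vt] := eqVneq v t.
Qed.

Lemma edge_infinite_order s t k : cox_m X s t = None ->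
  (gen s * gen t) ^+ k.+1 <> 1.
Proof.
move=> /ra_dihedral[phi [phiM phis phit]] /(congr1 phi).
have -> n : phi ((gen s * gen t) ^+ n) = ((- n%:Z)%R, false).
  elim: n => [|n IH]; first by rewrite (morphism1 phiM).
  rewrite expgS !phiM phis phit IH !dih_mulE /dih_mul /=; congr pair.
  by rewrite expr0 expr1; lia.
by rewrite (morphism1 phiM) => -[].
Qed.

(** Sending [t] to a reflection and the other generators to 1 defines a
    homomorphism, which separates [t] from the conjugates of [s]. *)
Lemma ra_gen_conj s t w : gen s ^ w = gen t -> s = t.
Proof.
have [//|st] := eqVneq s t.
pose f u : dihedral := if u == t then (0%R, true) else (0%R, false).
have [u v k muv|phi phiM phig] := cox_universal (f := f) (c := X); last first.
  move=> /(congr1 phi); rewrite conjgE !phiM !phig /f eqxx (negPf st).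
  rewrite (_ : (0%R, false) = 1 :> dihedral)// mul1g -phiM mulVg.
  by rewrite (morphism1 phiM).
have [uv|uv] := eqVneq u v.
  move: muv; rewrite uv cox_m_diag => -[<-]; rewrite expg1 /f.
  by case: ifP => _.
have [m2|] := ra_m_eq uv; last by rewrite muv.
move: muv; rewrite m2 => -[<-]; rewrite expg2 /f.
by case: ifP => _; case: ifP => _.
Qed.

Lemma ra_conj_invariant (T : Type) (z : S -> T) : conj_invariant X z.
Proof. by move=> s t w /ra_gen_conj ->. Qed.

Lemma ra_gen_mul_eq s t w : gen s * w = w * gen t -> s = t.
Proof.
by move=> h; apply: (@ra_gen_conj _ _ w); rewrite conjgE h mulKg.
Qed.

(** * Elements of a dihedral subgroup *)

Fixpoint alt_word (s t : S) n : seq S :=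
  if n is n'.+1 then s :: alt_word t s n' else [::].

Local Notation altp s t n := (word_prod X (alt_word s t n)).

Lemma alt_refls s t n r : r \in word_refls X (alt_word s t n) ->
  exists i, r = (gen s * gen t) ^+ i * gen s.
Proof.
elim: n s t r => //= n IH s t r; rewrite inE => /orP[/eqP ->|].
  by exists 0%N; rewrite mul1g.
move=> /mapP[_ /IH[i ->] ->]; exists i.+1; congr (_ * _).
elim: i => [|i IHi]; first by rewrite mul1g expg1.
by rewrite [in LHS]expgSr [RHS]expgSr -IHi !mulgA.
Qed.

Definition dihedral_elt s t x := exists n, x = altp s t n \/ x = altp t s n.

Lemma dihedral_sym s t x : dihedral_elt s t x -> dihedral_elt t s x.
Proof. by case=> n [] ->; exists n; [right|left]. Qed.

Lemma dihedral_gen_mul s t x : dihedral_elt s t x -> dihedral_elt s t (gen s * x).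
Proof.
case=> n [] ->; last by exists n.+1; left; rewrite word_prod_cons.
case: n => [|n]; first by exists 1%N; left; rewrite word_prod_cons.
by exists n; right; rewrite word_prod_cons genK.
Qed.

Lemma dihedral_mul s t x y :
  dihedral_elt s t x -> dihedral_elt s t y -> dihedral_elt s t (x * y).
Proof.
have h n : forall s t, dihedral_elt s t y -> dihedral_elt s t (altp s t n * y).
  elim: n => [|n IH] {}s {}t yst; first by rewrite word_prod_nil mul1g.
  rewrite word_prod_cons -mulgA; apply: dihedral_gen_mul.
  by apply: dihedral_sym; apply: IH; apply: dihedral_sym.
by case=> n [] -> yst; [|apply: dihedral_sym; move/dihedral_sym in yst]; apply: h.
Qed.

Lemma dihedral1 s t : dihedral_elt s t 1.
Proof. by exists 0%N; left; rewrite word_prod_nil. Qed.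

Lemma dihedral_gen s t : dihedral_elt s t (gen s).
Proof. by rewrite -[gen s]mulg1; apply/dihedral_gen_mul/dihedral1. Qed.

Lemma dihedralV s t x : dihedral_elt s t x -> dihedral_elt s t x^-1.
Proof.
have h n : forall s t, dihedral_elt s t (altp s t n)^-1.
  elim: n => [|n IH] {}s {}t; first by rewrite word_prod_nil invg1; exact: dihedral1.
  rewrite word_prod_cons invgM genV; apply: dihedral_mul; last exact: dihedral_gen.
  by apply: dihedral_sym; apply: IH.
by case=> n [] ->; [|apply: dihedral_sym].
Qed.

(** Write [w = x d] with [x] in the subgroup generated by [s] and [t] and [d]
    of minimal length in its coset. No reflection of that subgroup inverts [d],
    so [s] and [t] invert [x]; but the inversions of an alternating product
    beginning with [s] are of the form [(s t)^i s]. *)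
Lemma edge_desc s t w : cox_edge X s t -> desc s w -> ~~ desc t w.
Proof.
move=> est ds; apply/negP => dt.
pose P n := `[< exists2 y, dihedral_elt s t y & len (y * w) = n >].
have exP : exists n, P n.
  by exists (len (1 * w)); apply/asboolP; exists 1 => //; exact: dihedral1.
have [n /asboolP[y yst leny] nmin] := ex_minnP exP.
have inv_d r : dihedral_elt s t r -> inversion X (y * w) r = false.
  move=> rst; apply/negP => /inversion_len; rewrite leny ltnNge nmin//.
  by apply/asboolP; exists (r * y); rewrite ?mulgA//; apply: dihedral_mul.
have inv_x r : dihedral_elt s t r -> inversion X w r = inversion X y^-1 r.
  move=> rst; rewrite -{1}(mulKg y w) inversionM inv_d ?addbF// invgK.
  by apply: dihedral_mul (dihedralV yst); apply: dihedral_mul.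
have sst := dihedral_gen s t; have tst := dihedral_sym (dihedral_gen t s).
move: ds dt; rewrite !descE !inv_x//.
have mst := edge_None est; have mts := mst; rewrite cox_m_sym in mts.
have mem r l : inversion X (word_prod X l) r -> r \in word_refls X l.
  by rewrite inversion_word_prod -has_pred1 has_count; case: count.
case: (dihedralV yst) => k [] -> /mem/alt_refls[i si] /mem/alt_refls[j tj].
- apply: (@edge_infinite_order _ _ j mst).
  by rewrite expgSr mulgA -tj gen2.
- apply: (@edge_infinite_order _ _ i mts).
  by rewrite expgSr mulgA -si gen2.
Qed.

Lemma desc_comm s t w : desc s w -> desc t w -> gen s * gen t = gen t * gen s.
Proof.
move=> ds dt; have [->//|/ra_cases[/edge_desc/(_ ds)|//]] := eqVneq s t.
by rewrite dt.
Qed.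

Lemma desc_mul_comm s t w : s != t -> gen s * gen t = gen t * gen s ->
  desc t (gen s * w) = desc t w.
Proof.
move=> st c; rewrite !descE inversionM inversion_gen.
rewrite (inj_eq (@cox_gen_inj _ _ X)) eq_sym (negPf st) genV -mulgA -c.
by rewrite genK.
Qed.

(** If [t] were a descent of [w], then it would remain one of [w s = s w], where
    it would meet the descent [s]. *)
Lemma comm_asc_edge s t w : gen s * w = w * gen s -> ~~ desc s w ->
  cox_edge X s t -> ~~ desc t w.
Proof.
move=> c ns est; apply/negP => dt.
have dst : desc t (gen s * w).
  rewrite c desc_mulr//; apply/eqP => /ra_gen_mul_eq ts.
  by have := edge_neq est; rewrite ts eqxx.
have dss : desc s (gen s * w) by rewrite desc_flip.
by have := edge_desc est dss; rewrite dst.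
Qed.

(** A descent of a reduced product [a b] that is not one of [a] has to move
    past every letter of [a]. *)
Lemma desc_prefix s a b : len (a * b) = (len a + len b)%N ->
  ~~ desc s a -> desc s (a * b) -> gen s * a = a * gen s /\ desc s b.
Proof.
elim/(@len_ind _ _ X): a => [|t a nta IH]; first by rewrite !mul1g mulg1.
rewrite len_asc// -mulgA => red nsa ds.
have red' : len (a * b) = (len a + len b)%N.
  apply/eqP; rewrite eqn_leq lenM_le -ltnS -addSn -red.
  exact: len_gen_le.
have st : s != t by apply: contraNneq nsa => ->; rewrite desc_flip.
have dt : desc t (gen t * (a * b)).
  rewrite desc_flip /left_descent -leqNgt red' red.
  by rewrite addSn leqW.
have c := desc_comm ds dt.
have ts : t != s by rewrite eq_sym.
move: ds nsa; rewrite !desc_mul_comm// => ds nsa.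
have [cs db] := IH red' nsa ds.
by rewrite mulgA c -mulgA cs mulgA.
Qed.

End RightAngled.

(** * Reduced factorizations in right-angled groups *)

Section Prefixes.
Variables (W : groupType) (S : choiceType) (X : coxeterSystem W S).
Hypothesis raX : right_angled X.
Local Notation gen := (cox_gen X).
Local Notation len := (word_length X).
Local Notation desc := (left_descent X).
Local Open Scope group_scope.
Implicit Types (s t : S) (a b c u v w y : W).

Definition letter_count w s : nat := count_mem s (rword X w).

Lemma letter_count_gen s w t : ~~ desc s w ->
  letter_count (gen s * w) t = ((s == t) + letter_count w t)%N.
Proof.
move=> nd; have := perm_rword_cons (ra_conj_invariant raX id) nd.
by rewrite !map_id => /permP h; rewrite /letter_count h.
Qed.

Lemma letter_count_le w s : (letter_count w s <= len w)%N.
Proof. by rewrite -size_rword count_size. Qed.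

(** Every letter of a reduced word of [a] commutes with [s], and none of them is
    [s] because [s] is not a descent of [a]. *)
Lemma comm_letter_count s a : gen s * a = a * gen s -> ~~ desc s a ->
  letter_count a s = 0%N.
Proof.
elim/(@len_ind _ _ X): a => [|t a nta IH] c nsa; first by rewrite /letter_count rword1.
have dt : desc t (gen t * a) by rewrite desc_flip.
have st : s != t by apply: contraNneq nsa => ->.
have cst : gen s * gen t = gen t * gen s.
  by have [/(comm_asc_edge raX c nsa)|//] := ra_cases raX st; rewrite dt.
have ts : t != s by rewrite eq_sym.
rewrite letter_count_gen// (negPf ts) add0n; apply: IH.
  by apply: (@mulgI _ (gen t)); rewrite mulgA -cst -mulgA c mulgA.
by rewrite -(@desc_mul_comm _ _ X t s a).
Qed.

Definition reduced_prefix a v := len v = (len a + len (a^-1 * v))%N.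

(** Induction along [s v]: a prefix that has [s] as a descent is stripped of it,
    and a prefix that has not commutes with [s] and contains no letter [s]. Equal
    letter counts put the two prefixes into the same case. *)
Lemma prefix_letter_count a b v : reduced_prefix a v -> reduced_prefix b v ->
  (forall s, letter_count a s = letter_count b s) -> a = b.
Proof.
elim/(@len_ind _ _ X): v a b => [|s v nsv IH] a b pa pb cab.
  have p1 c : reduced_prefix c 1 -> c = 1.
    by rewrite /reduced_prefix len1 => h; apply: (@len_eq0 _ _ X); lia.
  by rewrite (p1 _ pa) (p1 _ pb).
have dsv : desc s (gen s * v) by rewrite desc_flip.
have dP c : reduced_prefix c (gen s * v) -> desc s c ->
    reduced_prefix (gen s * c) v /\ letter_count c s != 0%N.
  move=> pc dc; split; last first.
    by rewrite -[c](genK X s) (@letter_count_gen s (gen s * c)) ?desc_flip ?dc// eqxx.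
  move: pc; rewrite /reduced_prefix len_asc// (len_desc dc) invgM genV -mulgA.
  by rewrite addSn => -[].
have nP c : reduced_prefix c (gen s * v) -> ~~ desc s c ->
    reduced_prefix c v /\ letter_count c s = 0%N.
  move=> pc nc; have e : c * (c^-1 * (gen s * v)) = gen s * v by rewrite mulVKg.
  have [cs du] : gen s * c = c * gen s /\ desc s (c^-1 * (gen s * v)).
    by apply: desc_prefix => //; rewrite e.
  split; last exact: comm_letter_count.
  have csV : c^-1 * gen s = gen s * c^-1.
    by apply: invg_inj; rewrite !invgM !genV invgK.
  move: pc; rewrite /reduced_prefix len_asc// (len_desc du) addnS => -[->].
  by rewrite [c^-1 * (_ * v)]mulgA csV -mulgA genK.
case: (boolP (desc s a)) => da; case: (boolP (desc s b)) => db.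
- have [pa' _] := dP _ pa da; have [pb' _] := dP _ pb db.
  apply: (@mulgI _ (gen s)); apply: IH => // t.
  have := cab t; rewrite -{1}[a](genK X s) -{1}[b](genK X s).
  rewrite (@letter_count_gen s (gen s * a)) ?desc_flip ?da//.
  by rewrite (@letter_count_gen s (gen s * b)) ?desc_flip ?db// => /addnI.
- by have [_ /eqP] := dP _ pa da; have [_ <-] := nP _ pb db; rewrite cab.
- by have [_ /eqP] := dP _ pb db; have [_ <-] := nP _ pa da; rewrite cab.
- by have [pa' _] := nP _ pa da; have [pb' _] := nP _ pb db; apply: IH.
Qed.

Variable es : seq S.
Hypothesis es_full : forall s, s \in es.

Definition prefix_bound k := (k.+1 ^ size es)%N.

(** A prefix is determined by its letter counts, so an element has polynomially
    many prefixes of a given length. *)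
Lemma card_prefixes k v (L : seq W) : uniq L ->
  (forall a, a \in L -> reduced_prefix a v /\ (len a <= k)%N) ->
  (size L <= prefix_bound k)%N.
Proof.
move=> uL hL.
pose phi a : (size es).-tuple 'I_k.+1 :=
  map_tuple (fun s => inord (letter_count a s)) (in_tuple es).
have uphi : uniq (map phi L).
  rewrite map_inj_in_uniq// => a b aL bL /(congr1 val) /= e.
  have [pa la] := hL _ aL; have [pb lb] := hL _ bL.
  apply: prefix_letter_count pa pb _ => s.
  have /eq_in_map/(_ s (es_full s))/(congr1 val) := e.
  by rewrite /= !inordK// ltnS (leq_trans (letter_count_le _ _)).
rewrite -(size_map phi) -(card_uniqP uphi) (leq_trans (max_card _))//.
by rewrite card_tuple card_ord.
Qed.

Lemma card_suffixes k a (L : seq W) : uniq L -> (len a <= k)%N ->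
  (forall c, c \in L -> len a = (len (a * c^-1) + len c)%N) ->
  (size L <= prefix_bound k)%N.
Proof.
move=> uL lk hL; rewrite -(size_map (fun c => c^-1)).
apply: (@card_prefixes k a^-1); first by rewrite map_inj_uniq//; exact: invg_inj.
move=> _ /mapP[c /hL h ->]; rewrite /reduced_prefix !lenV invgK.
rewrite -[len (c * a^-1)]lenV invgM invgK addnC; split=> //.
by rewrite (leq_trans _ lk)// h leq_addl.
Qed.

(** * The expansion of a product of basis elements *)

(** A quadruple [(a, c, u, b)] encodes a term of [T_v delta_w]: with [v = a u] and
    [w = u^-1 b], the letters of [u] are cancelled, those of the suffix [c] of [a]
    are absorbed by the equal prefix of [b], and the result is a multiple of
    [delta_(a c^-1 b)]. *)
Definition term : Type := ((W * W) * (W * W))%type.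
Implicit Type m : term.

Definition term_val m : W := m.1.1 * m.1.2^-1 * m.2.2.

(** A new letter [s] that shortens the value of the term either cancels against
    [b], and joins [u], or is absorbed with a factor [p_s], and joins [a] and
    [c]. *)
Definition term_step s m : seq term :=
  if desc s (term_val m) then
    [:: (m.1, (gen s * m.2.1, gen s * m.2.2));
        ((gen s * m.1.1, gen s * m.1.2), m.2)]
  else [:: ((gen s * m.1.1, m.1.2), m.2)].

Fixpoint terms (l : seq S) (w : W) : seq term :=
  if l is s :: l' then flatten [seq term_step s m | m <- terms l' w]
  else [:: ((1, 1), (1, w))].

Definition term_ok v w m := let: ((a, c), (u, b)) := m in
  [/\ v = a * u /\ len v = (len a + len u)%N,
      len a = (len (a * c^-1) + len c)%N,
      w = u^-1 * b /\ len w = (len u + len b)%N &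
      len (a * c^-1 * b) = (len a + len (c^-1 * b))%N].

Lemma asc_prefix s x y :
  len (x * y) = (len x + len y)%N -> ~~ desc s (x * y) -> ~~ desc s x.
Proof.
move=> r; apply: contra => dx; rewrite /left_descent mulgA r.
by apply: leq_ltn_trans (lenM_le _ _ _) _; rewrite ltn_add2r.
Qed.

(** A descent of the value that is not one of [v] moves past [a] and [c]. *)
Lemma term_desc s v w m : term_ok v w m -> ~~ desc s v -> desc s (term_val m) ->
  let: ((a, c), (u, b)) := m in
  [/\ gen s * a = a * gen s, gen s * c = c * gen s &
      [/\ ~~ desc s a, ~~ desc s u, ~~ desc s c & desc s b]].
Proof.
case: m => [[a c] [u b]] [[ev rv] ra [ew rw] ry] nsv ds.
have nsa : ~~ desc s a by apply: (@asc_prefix s a u); rewrite -ev.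
pose d := a * c^-1; pose e := c^-1 * b.
have ea : a = d * c by rewrite /d mulgVK.
have eb : b = c * e by rewrite /e mulVKg.
have nsd : ~~ desc s d by apply: (@asc_prefix s d c); rewrite -ea.
have rb : len b = (len c + len e)%N.
  apply/eqP; rewrite eqn_leq; apply/andP; split.
    by rewrite {1}eb lenM_le.
  have := lenM_le X d b; rewrite ry ra -/d -/e; lia.
have ry' : len (d * b) = (len d + len b)%N by rewrite ry ra rb -/d -/e addnA.
have [cd db] := desc_prefix raX ry' nsd ds.
have nsc : ~~ desc s c.
  apply: contra nsa => dc; rewrite /left_descent ea mulgA cd -mulgA -ea.
  apply: leq_ltn_trans (lenM_le _ _ _) _; rewrite ra -/d ltn_add2l.
  exact: dc.
have [cc de] : gen s * c = c * gen s /\ desc s e.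
  by apply: desc_prefix => //; rewrite -eb.
have ca : gen s * a = a * gen s by rewrite ea mulgA cd -mulgA cc mulgA.
split=> //; split=> //; apply: contra nsv => du.
rewrite /left_descent ev mulgA ca -mulgA -ev rv.
by apply: leq_ltn_trans (lenM_le _ _ _) _; rewrite ltn_add2l.
Qed.

Lemma comm_inv s c : gen s * c = c * gen s -> c^-1 * gen s = gen s * c^-1.
Proof. by move=> h; apply: invg_inj; rewrite !invgM !genV invgK. Qed.

(** [s] commutes with [a] and [c] whenever it reaches [b], so it can be moved
    between the places where the two kinds of terms record it. *)
Lemma term_step_ok s v w m m' : ~~ desc s v -> term_ok v w m ->
  m' \in term_step s m -> term_ok (gen s * v) w m'.
Proof.
move=> nsv ok; rewrite /term_step; case: ifP => ds; last first.
  rewrite inE => /eqP ->; case: m ok ds => [[a c] [u b]] ok ds.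
  case: (ok) => -[ev rv] ra [ew rw] ry; rewrite /term_val /= in ds *.
  have nsa : ~~ desc s a by apply: (@asc_prefix s a u); rewrite -ev.
  have nsd : ~~ desc s (a * c^-1).
    by apply: (@asc_prefix s _ c); rewrite mulgVK.
  split=> //.
  - by split; [rewrite {1}ev mulgA|rewrite !len_asc// rv addSn].
  - by rewrite -mulgA !len_asc// ra addSn.
  - by rewrite -!mulgA !len_asc ?mulgA ?ds// ry addSn.
have := term_desc ok nsv ds; case: m ok ds => [[a c] [u b]] ok ds.
case: (ok) => -[ev rv] ra [ew rw] ry [ca cc [nsa nsu nsc db]].
have cV := comm_inv cc.
rewrite !inE => /orP[/eqP ->|/eqP ->] /=.
- split=> //.
  + by split; [rewrite mulgA -ca -mulgA -ev|rewrite !len_asc// rv addnS].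
  + rewrite invgM genV -mulgA genK; split=> //.
    by rewrite rw len_asc// (len_desc db) addnS addSn.
  + have e1 : a * c^-1 * (gen s * b) = gen s * (a * c^-1 * b).
      by rewrite -!mulgA [c^-1 * (gen s * b)]mulgA cV !mulgA ca.
    have e2 : c^-1 * (gen s * b) = gen s * (c^-1 * b) by rewrite mulgA cV mulgA.
    have de : desc s (c^-1 * b).
      have := ry; have := len_desc ds; rewrite /term_val /= -e1.
      rewrite -[a * c^-1 * (gen s * b)]mulgA e2 mulgA -ca -[gen s * a * _]mulgA.
      rewrite [a * c^-1 * b](_ : _ = a * (c^-1 * b)) ?mulgA//.
      move=> h1 h2; apply/negPn/negP => nde.
      have rp : len (a * (c^-1 * b)) = (len a + len (c^-1 * b))%N.
        by rewrite mulgA.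
      have [_ d2] : gen s * a = a * gen s /\ desc s (c^-1 * b).
        by apply: desc_prefix => //; rewrite mulgA.
      by rewrite d2 in nde.
    have := len_desc ds; have := len_desc de.
    by rewrite e1 e2 /term_val /= ry; lia.
- have e0 : gen s * a * (gen s * c)^-1 = a * c^-1.
    by rewrite invgM genV ca !mulgA -[a * gen s * _]mulgA -cV !mulgA genKr.
  split=> //.
  + by split; [rewrite {1}ev mulgA|rewrite !len_asc// rv addSn].
  + by rewrite e0 !len_asc// ra addnS.
  + rewrite e0 ry !len_asc// invgM genV.
    have de : desc s (c^-1 * b).
      have [_ //] : gen s * a = a * gen s /\ desc s (c^-1 * b).
      by apply: desc_prefix => //; rewrite mulgA.
    by rewrite cV -mulgA (len_desc de) addnS addSn.
Qed.

Lemma terms_ok l w m : size l = len (word_prod X l) -> m \in terms l w ->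
  term_ok (word_prod X l) w m.
Proof.
elim: l m => [|s l IH] m red.
  rewrite inE => /eqP -> /=.
  by split; rewrite ?word_prod_nil ?invg1 ?mulg1 ?mul1g ?len1.
have [redl ns] := reduced_cons red.
by move=> /flattenP[_ /mapP[m' /(IH _ redl) ok ->]]; rewrite word_prod_cons; exact: term_step_ok.
Qed.

Lemma term_step_val s v w m : ~~ desc s v -> term_ok v w m ->
  map term_val (term_step s m) =
  if desc s (term_val m) then [:: gen s * term_val m; term_val m]
  else [:: gen s * term_val m].
Proof.
move=> nsv ok; rewrite /term_step; case: ifP => ds; last first.
  by rewrite /term_val /= !mulgA.
have := term_desc ok nsv ds; case: m ok ds => [[a c] [u b]] ok ds.
case=> ca cc [nsa nsu nsc db]; have cV := comm_inv cc.
rewrite /term_val /=; congr [:: _; _].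
  by rewrite -!mulgA [c^-1 * (gen s * b)]mulgA cV !mulgA ca.
by rewrite invgM genV ca !mulgA -[a * gen s * _]mulgA -cV !mulgA genKr.
Qed.

Lemma term_step_inj s v w m1 m2 m : ~~ desc s v ->
  term_ok v w m1 -> term_ok v w m2 ->
  m \in term_step s m1 -> m \in term_step s m2 -> m1 = m2.
Proof.
move=> nsv.
have nsa m0 : term_ok v w m0 -> ~~ desc s m0.1.1.
  case: m0 => [[a c] [u b]] [[ev rv] _ _ _] /=.
  by apply: (@asc_prefix s _ u); rewrite -ev.
(* A quadruple obtained by absorbing [s] differs from one obtained by prepending
   [s] to [a]: in the first [s] is a descent of the suffix [c]. *)
have mixed m0 m0' : term_ok v w m0 -> term_ok v w m0' ->
    desc s (term_val m0) -> ~~ desc s (term_val m0') ->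
    ((gen s * m0.1.1, gen s * m0.1.2), m0.2) <> ((gen s * m0'.1.1, m0'.1.2), m0'.2).
  move=> ok ok' ds nds'; have := term_desc ok nsv ds; have := nsa _ ok'.
  case: m0 m0' ok ok' ds nds' => [[a c] [u b]] [[a' c'] [u' b']] ok ok' ds nds' /= na'.
  move=> [ca cc [na nu nc db]] [/mulgI ea ec eu eb].
  case: ok' => _ ra' _ _; move: na'; rewrite -{}ea -{}ec in ra' *.
  have dc : desc s (gen s * c) by rewrite desc_flip.
  have cV := comm_inv cc.
  rewrite /left_descent -leqNgt leqNgt => /negP; apply.
  have e : gen s * a = (a * (gen s * c)^-1) * c.
    by rewrite invgM genV cV mulgA -ca -!mulgA mulVg mulg1.
  rewrite e ra'; apply: leq_ltn_trans (lenM_le _ _ _) _.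
  by rewrite ltn_add2l len_asc.
move=> ok1 ok2; have na1 := nsa _ ok1; have na2 := nsa _ ok2.
rewrite /term_step; case: ifPn => d1; case: ifPn => d2; rewrite !inE.
- move=> /orP[] /eqP -> /orP[] /eqP.
  + case: m1 m2 {ok1 ok2 na1 na2 d1 d2} => [[a c] [u b]] [[a' c'] [u' b']] /=.
    by case=> -> -> /mulgI -> /mulgI ->.
  + by move=> [e _]; move: na1; rewrite e /= desc_flip na2.
  + by move=> [e _]; move: na2; rewrite -e /= desc_flip na1.
  + case: m1 m2 {ok1 ok2 na1 na2 d1 d2} => [[a c] [u b]] [[a' c'] [u' b']] /=.
    by case=> /mulgI -> /mulgI -> -> ->.
- move=> /orP[] /eqP -> /eqP.
  + by move=> [e _]; move: na1; rewrite e /= desc_flip na2.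
  + by move/(mixed _ _ ok1 ok2 d1 d2).
- move=> /eqP -> /orP[] /eqP.
  + by move=> [e _]; move: na2; rewrite -e /= desc_flip na1.
  + by move/esym/(mixed _ _ ok2 ok1 d2 d1).
- move=> /eqP -> /eqP.
  case: m1 m2 {ok1 ok2 na1 na2 d1 d2} => [[a c] [u b]] [[a' c'] [u' b']] /=.
  by case=> /mulgI -> -> -> ->.
Qed.

Lemma uniq_flatten_map (I J : eqType) (f : I -> seq J) (L : seq I) :
  uniq L -> (forall i, i \in L -> uniq (f i)) ->
  (forall i j x, i \in L -> j \in L -> x \in f i -> x \in f j -> i = j) ->
  uniq (flatten (map f L)).
Proof.
elim: L => //= i L IH /andP[iL uL] uf inj.
rewrite cat_uniq uf ?inE ?eqxx// IH//; first last.
- by move=> j k x jL kL; apply: inj; rewrite inE ?jL ?kL orbT.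
- by move=> j jL; apply: uf; rewrite inE jL orbT.
rewrite andbT /=; apply/hasPn => x /flattenP[_ /mapP[j jL ->] xj].
apply: contra iL => xi; rewrite (inj i j x) ?inE ?eqxx ?jL ?orbT//.
Qed.

(** Without repetitions, a sum over the terms is at most the sum over all the
    quadruples that satisfy [term_ok]. *)
Lemma terms_uniq l w : size l = len (word_prod X l) -> uniq (terms l w).
Proof.
elim: l => //= s l IH red; have [redl ns] := reduced_cons red.
apply: uniq_flatten_map; first exact: IH.
- move=> m /(terms_ok redl) ok; rewrite /term_step; case: ifP => //= ds.
  rewrite andbT inE; apply/eqP => -[e _].
  have := term_desc ok ns ds; case: m e {ok ds} => [[a c] [u b]] /= [ea _] [_ _ [na _ _ _]].
  by have := na; rewrite {1}ea desc_flip na.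
- by move=> m1 m2 m /(terms_ok redl) ok1 /(terms_ok redl) ok2; exact: (term_step_inj ns ok1 ok2).
Qed.

End Prefixes.

Local Open Scope ring_scope.
Local Open Scope complex_scope.
Local Notation normc := ComplexField.Normc.normc.

(** * Square-summable functions through finite sums *)

Lemma sumr_sub (R : realType) (I : eqType) (L K : seq I) (F : I -> R) :
  uniq L -> uniq K -> {subset L <= K} -> (forall i, 0 <= F i) ->
  \sum_(i <- L) F i <= \sum_(i <- K) F i.
Proof.
move=> uL uK LK F0; rewrite [leRHS](bigID (fun i => i \in L)) /=.
rewrite -[X in _ <= X + _]big_filter.
have e : perm_eq [seq i <- K | i \in L] L.
  apply: uniq_perm; rewrite ?filter_uniq// => i; rewrite mem_filter.
  by apply/andP/idP => [[]//|h]; split => //; exact: LK.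
by rewrite (perm_big _ e) lerDl; apply: sumr_ge0.
Qed.

Section FiniteSums.
Variables (R : realType) (I : Type).
Implicit Types (r : seq I) (x y : I -> R).

Lemma cauchy_schwarz_seq r x y :
  (\sum_(i <- r) x i * y i) ^+ 2 <=
  (\sum_(i <- r) x i ^+ 2) * (\sum_(i <- r) y i ^+ 2).
Proof.
set A := \sum_(i <- r) x i ^+ 2; set C := \sum_(i <- r) y i ^+ 2.
set B := \sum_(i <- r) _.
have A0 : 0 <= A by apply: sumr_ge0 => i _; exact: sqr_ge0.
have C0 : 0 <= C by apply: sumr_ge0 => i _; exact: sqr_ge0.
have key (a b : R) : 0 <= a ^+ 2 * A - 2 * a * b * B + b ^+ 2 * C.
  suff -> : a ^+ 2 * A - 2 * a * b * B + b ^+ 2 * C =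
      \sum_(i <- r) (a * x i - b * y i) ^+ 2.
    by apply: sumr_ge0 => i _; exact: sqr_ge0.
  rewrite /A /B /C !mulr_sumr -sumrB -big_split /=.
  by apply: eq_bigr => i _; ring.
have [A0'|Apos] := leP A 0.
  have A00 : A = 0 by apply/le_anti; rewrite A0'.
  rewrite A00 mul0r leNgt; apply/negP => B0.
  have Bn0 : B != 0 by rewrite -sqrf_eq0 gt_eqF.
  have := key ((1 + C) / B) 1; rewrite A00.
  have -> : ((1 + C) / B) ^+ 2 * 0 - 2 * ((1 + C) / B) * 1 * B + 1 ^+ 2 * C =
    - 2 - C by field.
  by move: C0; lra.
have := key B A; rewrite (_ : _ + _ = A * (A * C - B ^+ 2)); last by ring.
by rewrite pmulr_rge0// subr_ge0.
Qed.

End FiniteSums.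

Section ComplexNorm.
Variable R : realType.
Implicit Types z w : R[i].

Definition sqn z : R := normc z ^+ 2.

Lemma sqnE z : sqn z = complex.Re z ^+ 2 + complex.Im z ^+ 2.
Proof. by case: z => a b; rewrite /sqn /normc sqr_sqrtr// addr_ge0 ?sqr_ge0. Qed.

Lemma normc_ge0 z : 0 <= normc z. Proof. by case: z => a b; exact: sqrtr_ge0. Qed.
Lemma sqn_ge0 z : 0 <= sqn z. Proof. exact: sqr_ge0. Qed.
Lemma sqn0 : sqn (0 : R[i]) = 0. Proof. by rewrite sqnE /= expr0n addr0. Qed.
Lemma normcM z w : normc (z * w) = normc z * normc w.
Proof. exact: ComplexField.Normc.normcM. Qed.
Lemma normcN z : normc (- z) = normc z. Proof. exact: (@normcN R). Qed.
Lemma normcD z w : normc (z + w) <= normc z + normc w.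
Proof. exact: (@le_normcD R). Qed.
Lemma normcR (x : R) : normc x%:C = `|x|.
Proof. by rewrite /normc /= expr0n addr0 sqrtr_sqr. Qed.
Lemma normc_sum I (r : seq I) (F : I -> R[i]) :
  normc (\sum_(i <- r) F i) <= \sum_(i <- r) normc (F i).
Proof.
elim: r => [|i r IH]; first by rewrite !big_nil ComplexField.Normc.normc0.
by rewrite !big_cons (le_trans (normcD _ _))// lerD2l.
Qed.
Lemma sqnM z w : sqn (z * w) = sqn z * sqn w.
Proof. by rewrite /sqn normcM exprMn. Qed.
Lemma normc_conj z : normc z^* = normc z.
Proof. by case: z => a b; rewrite /normc /= sqrrN. Qed.
Lemma normc_eq0 z : normc z = 0 -> z = 0.
Proof. exact: ComplexField.Normc.eq0_normc. Qed.
Lemma normcB z w : normc z - normc w <= normc (z - w).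
Proof. by rewrite lerBlDr -{1}(subrK w z) normcD. Qed.
Lemma normc_dist z w : normc (z - w) = normc (w - z).
Proof. by rewrite -normcN opprB. Qed.
Lemma sqn_conj z : z * conjc z = (sqn z)%:C.
Proof. by rewrite -sqr_normc normc_def sqnE -rmorphXn /= sqr_sqrtr// addr_ge0 ?sqr_ge0. Qed.

Lemma normc_le_ReIm z : normc z <= `|complex.Re z| + `|complex.Im z|.
Proof.
case: z => a b /=.
rewrite -[leRHS]ger0_norm ?addr_ge0// -[leRHS]sqrtr_sqr ler_wsqrtr//.
rewrite sqrrD !real_normK ?num_real// -addrA lerD2l lerDr.
by rewrite mulrn_wge0// mulr_ge0.
Qed.

Lemma ReIm_le_normc z : `|complex.Re z| <= normc z /\ `|complex.Im z| <= normc z.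
Proof.
by case: z => a b /=; split; rewrite -sqrtr_sqr ler_wsqrtr// ?lerDl ?lerDr sqr_ge0.
Qed.

End ComplexNorm.

Section L2Norm.
Variables (R : realType) (W : choiceType).
Local Notation C := R[i].
Local Notation H := (l2 R W).
Local Notation delta := (@l2_delta R W).
Implicit Types (f g h k : H) (F : seq W).

Lemma l2D f g w : (f + g) w = f w + g w. Proof. by []. Qed.
Lemma l2B f g w : (f - g) w = f w - g w. Proof. by []. Qed.
Lemma l2Z (c : C) f w : (c *: f) w = c * f w. Proof. by []. Qed.
Lemma l20 w : (0 : H) w = 0. Proof. by []. Qed.
Lemma l2_sum I (r : seq I) (f : I -> H) w :
  (\sum_(i <- r) f i) w = \sum_(i <- r) f i w.
Proof. by elim: r => [|i r IH]; rewrite ?big_nil ?big_cons ?l2D ?IH. Qed.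
Lemma l2_deltaE v w : delta v w = (w == v)%:R. Proof. by []. Qed.
Lemma l2_delta_id w : delta w w = 1. Proof. by rewrite l2_deltaE eqxx. Qed.
Lemma l2_delta_ne v w : v <> w -> delta v w = 0.
Proof. by move=> /eqP/negPf h; rewrite l2_deltaE eq_sym h. Qed.
Lemma l2_delta_sym v w : delta v w = delta w v.
Proof. by rewrite !l2_deltaE eq_sym. Qed.
Lemma l2_ext f g : (forall w, f w = g w) -> f = g.
Proof. by move=> fg; apply/val_inj/funext. Qed.

Definition nsq f : R := fine (sqr_sum f).

Lemma l2_summable f : (sqr_sum f < +oo)%E.
Proof. by apply/square_summableP; case: f. Qed.

Lemma sqr_sumE f : sqr_sum f = (nsq f)%:E.
Proof. by rewrite fineK// ge0_fin_numE ?sqr_sum_ge0// l2_summable. Qed.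

Lemma nsq_ge0 f : 0 <= nsq f.
Proof. exact/fine_ge0/sqr_sum_ge0. Qed.

Lemma l2_normE f : l2_norm f ^+ 2 = nsq f.
Proof. by rewrite sqr_sqrtr// nsq_ge0. Qed.

Lemma l2_norm_ge0 f : 0 <= l2_norm f. Proof. exact: sqrtr_ge0. Qed.

Lemma sum_sqn_fsbig F (f : W -> C) : uniq F ->
  (\sum_(w \in [set` F]) (sqn (f w))%:E)%E = (\sum_(w <- F) sqn (f w))%:E.
Proof. by move=> uF; rewrite -fsbig_seq// sumEFin. Qed.

Lemma sum_sqn_le F (f : W -> C) (M : R) : uniq F -> (sqr_sum f <= M%:E)%E ->
  \sum_(w <- F) sqn (f w) <= M.
Proof.
move=> uF fM; rewrite -lee_fin (le_trans _ fM)// -(sum_sqn_fsbig f uF).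
by apply: ereal_sup_ubound; exists [set` F] => //; split => //; exact: finite_seq.
Qed.

Lemma sum_nsq_le F f : uniq F -> \sum_(w <- F) sqn (f w) <= nsq f.
Proof. by move=> uF; apply: sum_sqn_le => //; rewrite sqr_sumE. Qed.

Lemma sqr_sum_le (f : W -> C) (M : R) :
  (forall F, uniq F -> \sum_(w <- F) sqn (f w) <= M) -> (sqr_sum f <= M%:E)%E.
Proof.
move=> h; apply: ge_ereal_sup => _ [A [finA _] <-].
rewrite fsbig_finite//= sumEFin lee_fin; apply: h; exact: fset_uniq.
Qed.

Lemma nsq_le f (M : R) :
  (forall F, uniq F -> \sum_(w <- F) sqn (f w) <= M) -> nsq f <= M.
Proof. by move=> /sqr_sum_le; rewrite sqr_sumE lee_fin. Qed.

Lemma nsq2_le f g h k :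
  (forall w, sqn (f w) + sqn (g w) <= sqn (h w) + sqn (k w)) ->
  nsq f + nsq g <= nsq h + nsq k.
Proof.
move=> le; rewrite -lee_fin !EFinD -!sqr_sumE /sqr_sum.
have p (e : W -> C) w : [set: W] w -> (0 <= (normc (e w) ^+ 2)%:E :> \bar R)%E.
  by rewrite lee_fin sqr_ge0.
rewrite -!esumD//; [|exact: p..]; apply: le_esum => w _.
by rewrite -!EFinD lee_fin le.
Qed.

Lemma nsq2_eq f g h k :
  (forall w, sqn (f w) + sqn (g w) = sqn (h w) + sqn (k w)) ->
  nsq f + nsq g = nsq h + nsq k.
Proof. by move=> e; apply/le_anti; rewrite !nsq2_le// => w; rewrite e. Qed.

Lemma nsq_mono f g : (forall w, sqn (f w) <= sqn (g w)) -> nsq f <= nsq g.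
Proof.
by move=> le; apply: nsq_le => F uF; rewrite (le_trans _ (sum_nsq_le g uF))// ler_sum.
Qed.

Lemma nsq0 : nsq 0 = 0.
Proof.
apply/le_anti; rewrite nsq_ge0 andbT; apply: nsq_le => F _.
by rewrite big1// => w _; rewrite l20 sqn0.
Qed.

Lemma sqn_le_nsq f w : sqn (f w) <= nsq f.
Proof. by have := @sum_nsq_le [:: w] f isT; rewrite big_seq1. Qed.

Lemma l2_norm_sq_le f (M : R) : 0 <= M -> nsq f <= M ^+ 2 -> l2_norm f <= M.
Proof.
by move=> M0 fM; rewrite -(ger0_norm M0) -sqrtr_sqr ler_wsqrtr.
Qed.

Lemma l2_normc f w : normc (f w) <= l2_norm f.
Proof.
rewrite -(ler_pXn2r (n := 2))// ?nnegrE ?normc_ge0 ?l2_norm_ge0//.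
by rewrite l2_normE sqn_le_nsq.
Qed.

Lemma nsq_eq0 f : nsq f = 0 -> f = 0.
Proof.
move=> f0; apply: l2_ext => w; apply: normc_eq0.
have := sqn_le_nsq f w; rewrite f0 /sqn => h.
by apply/eqP; rewrite -sqrf_eq0 eq_le h sqr_ge0.
Qed.

Lemma l2_norm0 : l2_norm (0 : H) = 0.
Proof. by rewrite /l2_norm -/(nsq 0) nsq0 sqrtr0. Qed.

Lemma l2_norm_eq0 f : l2_norm f = 0 -> f = 0.
Proof. by move=> f0; apply: nsq_eq0; rewrite -l2_normE f0 expr0n. Qed.

Lemma nsqZ (c : C) f : nsq (c *: f) = sqn c * nsq f.
Proof.
apply/le_anti/andP; split.
  apply: nsq_le => F uF; under eq_bigr do rewrite l2Z sqnM.
  by rewrite -mulr_sumr ler_wpM2l ?sqn_ge0// sum_nsq_le.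
have [->|c0] := eqVneq c 0; first by rewrite sqn0 mul0r nsq_ge0.
have sc : 0 < sqn c.
  rewrite lt_neqAle sqn_ge0 andbT eq_sym sqrf_eq0; apply: contra c0 => /eqP.
  by move/normc_eq0 => ->.
rewrite mulrC -ler_pdivlMr//; apply: nsq_le => F uF.
rewrite ler_pdivlMr// mulr_suml (le_trans _ (sum_nsq_le (c *: f) uF))//.
by apply: ler_sum => w _; rewrite l2Z sqnM mulrC.
Qed.

Lemma l2_normZ (c : C) f : l2_norm (c *: f) = normc c * l2_norm f.
Proof.
rewrite /l2_norm -/(nsq _) nsqZ sqrtrM ?sqn_ge0// sqrtr_sqr ger0_norm//.
exact: normc_ge0.
Qed.

Lemma l2_normN f : l2_norm (- f) = l2_norm f.
Proof. by rewrite -scaleN1r l2_normZ normcN ComplexField.Normc.normc1 mul1r. Qed.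

Lemma l2_normD f g : l2_norm (f + g) <= l2_norm f + l2_norm g.
Proof.
apply: l2_norm_sq_le; first by rewrite addr_ge0 ?l2_norm_ge0.
apply: nsq_le => F uF.
pose a := \sum_(w <- F) normc (f w) ^+ 2; pose b := \sum_(w <- F) normc (g w) ^+ 2.
pose c := \sum_(w <- F) normc (f w) * normc (g w).
have cs : c ^+ 2 <= a * b := cauchy_schwarz_seq F _ _.
have la : a <= l2_norm f ^+ 2 by rewrite l2_normE sum_nsq_le.
have lb : b <= l2_norm g ^+ 2 by rewrite l2_normE sum_nsq_le.
have a0 : 0 <= a by apply: sumr_ge0 => w _; exact: sqr_ge0.
have b0 : 0 <= b by apply: sumr_ge0 => w _; exact: sqr_ge0.
have c0 : 0 <= c by apply: sumr_ge0 => w _; rewrite mulr_ge0 ?normc_ge0.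
have cle : c <= l2_norm f * l2_norm g.
  rewrite -(ler_pXn2r (n := 2))// ?nnegrE ?mulr_ge0 ?l2_norm_ge0//.
  by rewrite exprMn (le_trans cs)// ler_pM.
apply: (@le_trans _ _ (a + 2 * c + b)).
  rewrite /a /b /c mulr_sumr -!big_split; apply: ler_sum => w _.
  rewrite l2D /=; apply: (@le_trans _ _ ((normc (f w) + normc (g w)) ^+ 2)).
    by rewrite /sqn lerXn2r// ?nnegrE ?addr_ge0 ?normc_ge0// normcD.
  by rewrite le_eqVlt; apply/orP; left; apply/eqP; ring.
by rewrite sqrrD; lra.
Qed.

Lemma l2_normB f g : l2_norm (f - g) <= l2_norm f + l2_norm g.
Proof. by rewrite (le_trans (l2_normD _ _))// l2_normN. Qed.

Lemma l2_norm_tri f g h : l2_norm (f - h) <= l2_norm (f - g) + l2_norm (g - h).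
Proof. by rewrite -[f - h](_ : (f - g) + (g - h) = _) ?l2_normD// addrA subrK. Qed.

Lemma l2_normBC f g : l2_norm (f - g) = l2_norm (g - f).
Proof. by rewrite -l2_normN opprB. Qed.

Lemma parallelogram f g : nsq (f + g) + nsq (f - g) = 2 * nsq f + 2 * nsq g.
Proof.
have e2 (h : H) : 2 * nsq h = nsq ((Num.sqrt 2)%:C *: h).
  by rewrite nsqZ /sqn normcR ger0_norm ?sqrtr_ge0// sqr_sqrtr.
rewrite !e2; apply: nsq2_eq => w; rewrite l2D l2B !l2Z !sqnM.
rewrite {3 5}/sqn normcR ger0_norm ?sqrtr_ge0// sqr_sqrtr// !sqnE.
by case: (f w) (g w) => [a b] [c d] /=; ring.
Qed.

(** * Truncations *)

Definition finvec F (c : W -> C) : H := \sum_(w <- F) c w *: delta w.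
Definition trunc F f : H := finvec F f.

Lemma finvecE F c w : uniq F -> finvec F c w = if w \in F then c w else 0.
Proof.
move=> uF; rewrite /finvec l2_sum; case: ifP => [wF|wF].
  rewrite (bigD1_seq w)// big1 => [|v vw].
    by rewrite l2Z l2_deltaE eqxx mulr1; exact: addr0.
  by rewrite l2Z l2_deltaE eq_sym (negPf vw) mulr0.
rewrite big_seq big1// => v vF; rewrite l2Z l2_deltaE.
by case: eqP wF => [->|]; rewrite ?vF ?mulr0.
Qed.

Lemma truncE F f w : uniq F -> trunc F f w = if w \in F then f w else 0.
Proof. exact: finvecE. Qed.

Lemma trunc_norm F f : uniq F -> l2_norm (trunc F f) <= l2_norm f.
Proof.
move=> uF; rewrite ler_wsqrtr// nsq_mono// => w; rewrite truncE//.
by case: ifP => // _; rewrite sqn0 sqn_ge0.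
Qed.

Lemma finvec_nsq F c : uniq F -> nsq (finvec F c) = \sum_(w <- F) sqn (c w).
Proof.
move=> uF; apply/le_anti/andP; split; last first.
  rewrite (le_trans _ (sum_nsq_le _ uF))// !big_seq ler_sum// => w wF.
  by rewrite finvecE// wF.
apply: nsq_le => G uG; under eq_bigr do rewrite finvecE//.
rewrite (bigID (mem F)) /= [X in _ + X]big1 ?addr0 => [|w /negPf ->]; last exact: sqn0.
rewrite (eq_bigr (fun w => sqn (c w))) => [|w ->//].
rewrite -big_filter; apply: sumr_sub => // [|w|w]; first exact: filter_uniq.
  by rewrite mem_filter => /andP[].
exact: sqn_ge0.
Qed.

Lemma trunc_nsq F f : uniq F -> nsq (trunc F f) = \sum_(w <- F) sqn (f w).
Proof. exact: finvec_nsq. Qed.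

(** The squared norm is the supremum of its finite partial sums, and the squared
    distance to a truncation is the missing part of the sum. *)
Lemma trunc_dense f (e : R) : 0 < e ->
  exists2 F, uniq F & l2_norm (f - trunc F f) <= e.
Proof.
move=> e0.
have [F uF hF] : exists2 F, uniq F & nsq f - e ^+ 2 < \sum_(w <- F) sqn (f w).
  apply: contrapT => no.
  have : nsq f <= nsq f - e ^+ 2.
    apply: nsq_le => F uF; rewrite leNgt; apply/negP => lt; apply: no.
    by exists F.
  by rewrite lerDl oppr_ge0 leNgt exprn_gt0.
exists F => //; apply: l2_norm_sq_le (ltW e0) _.
have : nsq (f - trunc F f) + nsq (trunc F f) = nsq f + nsq 0.
  apply: nsq2_eq => w; rewrite l2B !truncE// l20 sqn0 addr0.
  by case: ifP; rewrite ?subrr ?subr0 sqn0 ?addr0 ?add0r.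
by rewrite nsq0 addr0 trunc_nsq//; lra.
Qed.

Lemma nsq_delta w : nsq (delta w) = 1.
Proof.
have u : uniq [:: w] by [].
have := trunc_nsq (delta w) u; rewrite big_seq1 l2_deltaE eqxx.
rewrite /trunc /finvec big_seq1 l2_deltaE eqxx scale1r => ->.
by rewrite /sqn ComplexField.Normc.normc1 expr1n.
Qed.

Lemma l2_norm_delta w : l2_norm (delta w) = 1.
Proof. by rewrite /l2_norm -/(nsq _) nsq_delta sqrtr1. Qed.

End L2Norm.

(** * Bounded operators and generated algebras *)

Section Operators.
Variables (R : realType) (W : choiceType).
Local Notation C := R[i].
Local Notation H := (l2 R W).
Local Notation op := (H -> H).
Local Notation delta := (@l2_delta R W).
Implicit Types (f g h : H) (a b c x y : op) (M : R).

Section Linear.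
Variable a : op.
Hypothesis la : linear a.

Lemma lin_comb (c : C) f g : a (c *: f + g) = c *: a f + a g.
Proof. exact: la. Qed.
Lemma lin0 : a 0 = 0.
Proof. by have := la (-1) 0 0; rewrite scaleN1r addNr scaleN1r addNr. Qed.
Lemma linZ (c : C) f : a (c *: f) = c *: a f.
Proof. by rewrite -[c *: f]addr0 lin_comb lin0 addr0. Qed.
Lemma linD f g : a (f + g) = a f + a g.
Proof. by rewrite -{1}[f]scale1r lin_comb scale1r. Qed.
Lemma linN f : a (- f) = - a f.
Proof. by rewrite -scaleN1r linZ scaleN1r. Qed.
Lemma linB f g : a (f - g) = a f - a g.
Proof. by rewrite linD linN. Qed.
Lemma lin_sum I (r : seq I) (f : I -> H) :
  a (\sum_(i <- r) f i) = \sum_(i <- r) a (f i).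
Proof.
by elim: r => [|i r IH]; rewrite ?big_nil ?lin0// !big_cons linD IH.
Qed.

Lemma lin_trunc F f w : a (trunc F f) w = \sum_(v <- F) f v * a (delta v) w.
Proof.
by rewrite /trunc /finvec lin_sum l2_sum; apply: eq_bigr => v _; rewrite linZ.
Qed.

End Linear.

Lemma half_pos (e : R) : 0 < e -> 0 < e / 2.
Proof. by move=> e0; rewrite divr_gt0. Qed.

Definition opbd a M := forall f, l2_norm (a f) <= M * l2_norm f.

Lemma opbd_le a M M' : M <= M' -> opbd a M -> opbd a M'.
Proof.
by move=> le h f; rewrite (le_trans (h f))// ler_wpM2r ?l2_norm_ge0.
Qed.

Lemma bounded_lin a : bounded_op a -> linear a. Proof. by case. Qed.

Lemma bounded_bd a : bounded_op a -> exists2 M, 0 < M & opbd a M.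
Proof.
case=> _ [M h]; exists (Num.max M 1); first by rewrite lt_max ltr01 orbT.
by apply: opbd_le h; rewrite le_max lexx.
Qed.

Lemma op_norm_le a M : 0 <= M -> opbd a M -> op_norm a <= M.
Proof.
move=> M0 h; apply: ge_sup.
  by exists (l2_norm (a 0)); exists 0 => //=; rewrite l2_norm0.
move=> _ [f /= f1 <-]; rewrite (le_trans (h f))//.
by rewrite -[leRHS]mulr1 ler_wpM2l.
Qed.

Lemma op_norm_bd a : bounded_op a -> opbd a (op_norm a).
Proof.
move=> ba f; have [M M0 h] := bounded_bd ba.
have [f0|f0] := eqVneq (l2_norm f) 0.
  by rewrite (l2_norm_eq0 f0) (lin0 (bounded_lin ba)) l2_norm0 mulr0.
have fpos : 0 < l2_norm f by rewrite lt_neqAle eq_sym f0 l2_norm_ge0.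
rewrite -ler_pdivrMr//.
have -> : l2_norm (a f) / l2_norm f = l2_norm (a ((l2_norm f)^-1%:C *: f)).
  rewrite (linZ (bounded_lin ba)) l2_normZ normcR mulrC ger0_norm//.
  by rewrite invr_ge0 l2_norm_ge0.
apply: ub_le_sup.
  exists M => _ [g /= g1 <-]; rewrite (le_trans (h g))//.
  by rewrite -[leRHS]mulr1 ler_wpM2l// ltW.
exists ((l2_norm f)^-1%:C *: f) => //=; rewrite l2_normZ normcR.
by rewrite ger0_norm ?invr_ge0 ?l2_norm_ge0// mulVf.
Qed.

(** Inequalities [|a f| <= M |f|] are easier to combine than the supremum in
    [op_norm]; here is the translation for approximations. *)
Lemma norm_closed_bd (A : set op) a : norm_closed A -> bounded_op a ->
  (forall e, 0 < e -> exists2 b, A b & opbd (a - b) e) -> A a.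
Proof.
move=> cA ba h; apply: cA => // e e0.
have [b Ab bd] := h (e / 2) (half_pos e0).
exists b => //; apply: (@le_lt_trans _ _ (e / 2)).
  by apply: op_norm_le => //; rewrite ltW// divr_gt0.
by rewrite ltr_pdivrMr// ltr_pMr// ltr1n.
Qed.

Lemma opbd_comb (k : C) a b M N : opbd a M -> opbd b N ->
  opbd (k *: a + b) (normc k * M + N).
Proof.
move=> ha hb f; rewrite mulrDl (le_trans (l2_normD _ _))// lerD//.
rewrite [X in l2_norm X](_ : _ = k *: a f)// l2_normZ -mulrA.
by rewrite ler_wpM2l ?normc_ge0.
Qed.

Lemma opbd_comp a b M N : 0 <= M -> opbd a M -> opbd b N -> opbd (a \o b) (M * N).
Proof.
by move=> M0 ha hb f; rewrite /= (le_trans (ha _))// -mulrA ler_wpM2l.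
Qed.

Lemma bounded_intro a M : linear a -> opbd a M -> bounded_op a.
Proof. by move=> la h; split => //; exists M. Qed.

Lemma bounded_id : bounded_op (id : op).
Proof. by split => //; exists 1 => f; rewrite mul1r. Qed.

Lemma bounded_comb (k : C) a b :
  bounded_op a -> bounded_op b -> bounded_op (k *: a + b).
Proof.
move=> ba bb; have [M _ ha] := bounded_bd ba; have [N _ hb] := bounded_bd bb.
apply: (bounded_intro _ (opbd_comb k ha hb)) => z f g.
rewrite -[LHS]/(k *: a (z *: f + g) + b (z *: f + g)).
rewrite -[RHS]/(z *: (k *: a f + b f) + (k *: a g + b g)).
rewrite (lin_comb (bounded_lin ba)) (lin_comb (bounded_lin bb)).
rewrite !scalerDr !scalerA [k * z]mulrC -!addrA; congr (_ + _).
by rewrite addrCA.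
Qed.

Lemma bounded0 : bounded_op (0 : op).
Proof.
split; last by exists 0 => f; rewrite mul0r l2_norm0.
by move=> z f g; rewrite -[LHS]/0 -[RHS]/(z *: 0 + 0) scaler0 addr0.
Qed.

Lemma bounded_comp a b : bounded_op a -> bounded_op b -> bounded_op (a \o b).
Proof.
move=> ba bb; have [M M0 ha] := bounded_bd ba; have [N _ hb] := bounded_bd bb.
apply: (bounded_intro _ (opbd_comp (ltW M0) ha hb)) => z f g /=.
by rewrite (lin_comb (bounded_lin bb)) (lin_comb (bounded_lin ba)).
Qed.

Lemma op_subE a b f : (a - b) f = a f - b f. Proof. by []. Qed.
Lemma op_addE a b f : (a + b) f = a f + b f. Proof. by []. Qed.
Lemma op_scaleE (k : C) a f : (k *: a) f = k *: a f. Proof. by []. Qed.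

Lemma op_subN1 a b : a - b = (-1) *: b + a.
Proof. by rewrite scaleN1r addrC. Qed.

Lemma bounded_sub a b : bounded_op a -> bounded_op b -> bounded_op (a - b).
Proof. by move=> ba bb; rewrite op_subN1; apply: bounded_comb. Qed.

Lemma opbd_sub a b M N : opbd a M -> opbd b N -> opbd (a - b) (M + N).
Proof. by move=> ha hb f; rewrite op_subE mulrDl (le_trans (l2_normB _ _))// lerD. Qed.

Lemma opbd_add a b M N : opbd a M -> opbd b N -> opbd (a + b) (M + N).
Proof. by move=> ha hb f; rewrite op_addE mulrDl (le_trans (l2_normD _ _))// lerD. Qed.

Lemma opbd_subC a b M : opbd (a - b) M -> opbd (b - a) M.
Proof. by move=> h f; rewrite op_subE l2_normBC; exact: h. Qed.

Lemma opbd_tri a b c M N : opbd (a - b) M -> opbd (b - c) N -> opbd (a - c) (M + N).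
Proof.
move=> h k f; rewrite op_subE mulrDl (le_trans (l2_norm_tri _ (b f) _))//.
by rewrite lerD//; [exact: h|exact: k].
Qed.

Lemma small_le0 (x M : R) : 0 <= M -> (forall e, 0 < e -> x <= M * e) -> x <= 0.
Proof.
move=> M0 h; rewrite leNgt; apply/negP => x0.
have M1 : 0 < M + 1 by rewrite ltr_pwDr.
have := h (x / (M + 1)) (divr_gt0 x0 M1).
rewrite mulrA ler_pdivlMr// mulrC ler_pM2r//.
by rewrite gerDl ler10.
Qed.

Lemma bounded_dense_le a M f : bounded_op a ->
  (forall F, uniq F -> l2_norm (a (trunc F f)) <= M) -> l2_norm (a f) <= M.
Proof.
move=> ba h; have [N N0 hN] := bounded_bd ba.
rewrite -subr_le0; apply: (small_le0 (ltW N0)) => e e0.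
have [F uF hF] := trunc_dense f e0.
rewrite lerBlDl -[a f](subrK (a (trunc F f))) (le_trans (l2_normD _ _))//.
rewrite [leRHS]addrC; apply: lerD; last exact: h.
rewrite -(linB (bounded_lin ba)); apply: le_trans (hN _) _.
by apply: ler_wpM2l => //; exact: ltW.
Qed.

Lemma opbd_dense a M : bounded_op a -> 0 <= M ->
  (forall F f, uniq F -> l2_norm (a (trunc F f)) <= M * l2_norm (trunc F f)) ->
  opbd a M.
Proof.
move=> ba M0 h f; apply: bounded_dense_le => // F uF.
by rewrite (le_trans (h _ _ uF))// ler_wpM2l// trunc_norm.
Qed.

Lemma bounded_eq a b : bounded_op a -> bounded_op b ->
  (forall w, a (delta w) = b (delta w)) -> a = b.
Proof.
move=> ba bb ab; apply/funext => f; apply/eqP; rewrite -subr_eq0; apply/eqP.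
apply: l2_norm_eq0; apply/le_anti; rewrite l2_norm_ge0 andbT -op_subE.
apply: bounded_dense_le => [|F uF]; first exact: bounded_sub.
rewrite op_subE /trunc /finvec (lin_sum (bounded_lin ba)) (lin_sum (bounded_lin bb)).
rewrite (eq_bigr (fun v => b (f v *: delta v))) ?subrr ?l2_norm0// => v _.
by rewrite (linZ (bounded_lin ba)) (linZ (bounded_lin bb)) ab.
Qed.

(** * Adjoints through matrix coefficients *)

(** Adjointness of bounded operators on matrix coefficients: no infinite sum
    occurs, and the inner product is only used along finite truncations. *)
Definition adj_mx a b := forall v w, a (delta v) w = conjc (b (delta w) v).

Lemma adj_mx_sym a b : adj_mx a b -> adj_mx b a.
Proof. by move=> h v w; rewrite h conjcK. Qed.

Lemma partial_sum_lim (u : W -> C^o) w : (forall v, v != w -> u v = 0) ->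
  summability.sum u = u w.
Proof.
move=> u0; have tF := @summability.totally_filter W.
apply: (@cvg_lim C^o) => //; apply: cvg_near_cst.
exists [fset w]%fset => //= A wA; rewrite /summability.partial_sum.
have wA' : w \in A by move/fsubsetP : wA; apply; rewrite inE.
rewrite (bigD1 [` wA']%fset)//= big1 ?addr0// => -[v vA] ne; apply: u0.
by apply: contra ne => /eqP vw; apply/eqP/val_inj.
Qed.

Lemma num_conjE (z : C) : Num.conj z = conjc z. Proof. by []. Qed.

Lemma op_adjoint_mx a b : op_adjoint a b -> adj_mx a b.
Proof.
move=> ab v w; have := ab (delta v) (delta w); rewrite /l2_dot.
rewrite (@partial_sum_lim _ w); last first.
  by move=> u /negPf uw; rewrite l2_deltaE uw num_conjE conjc_nat; exact: mulr0.
rewrite (@partial_sum_lim _ v); last first.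
  by move=> u /negPf uw; rewrite l2_deltaE uw; exact: mul0r.
by rewrite !l2_deltaE !eqxx !num_conjE conjc_nat mulr1 mul1r.
Qed.

Lemma dot_le F f g : uniq F ->
  normc (\sum_(v <- F) f v * conjc (g v)) <= l2_norm f * l2_norm g.
Proof.
move=> uF; rewrite (le_trans (normc_sum _ _))//.
under eq_bigr do rewrite normcM normc_conj.
rewrite -(ler_pXn2r (n := 2))// ?nnegrE ?mulr_ge0 ?l2_norm_ge0//; last first.
  by apply: sumr_ge0 => v _; rewrite mulr_ge0 ?normc_ge0.
rewrite (le_trans (cauchy_schwarz_seq _ _ _))// exprMn !l2_normE.
by rewrite ler_pM ?sum_nsq_le// sumr_ge0// => v _; exact: sqr_ge0.
Qed.

Lemma adj_mx_dot a b F G f g : linear a -> linear b -> adj_mx a b ->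
  \sum_(w <- G) a (trunc F f) w * conjc (g w) =
  \sum_(v <- F) f v * conjc (b (trunc G g) v).
Proof.
move=> la lb ab.
under eq_bigr do rewrite (lin_trunc la) mulr_suml.
rewrite exchange_big /=; apply: eq_bigr => v _.
rewrite (lin_trunc lb) rmorph_sum mulr_sumr; apply: eq_bigr => w _.
by rewrite ab rmorphM /= -mulrA; congr (_ * _); exact: mulrC.
Qed.

(** [|b f|^2] is, up to truncations, the inner product of [f] with [a (b f)], which
    is at most [M |f| |b f|]. *)
Lemma adj_mx_bd a b M : bounded_op a -> bounded_op b -> adj_mx a b -> 0 <= M ->
  opbd a M -> opbd b M.
Proof.
move=> ba bb /adj_mx_sym ab M0 ha; apply: opbd_dense => // F f uF.
apply: l2_norm_sq_le; first by rewrite mulr_ge0// l2_norm_ge0.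
apply: nsq_le => G uG; set g := b _.
have sG : (\sum_(w <- G) sqn (g w))%:C = \sum_(w <- G) g w * conjc (g w).
  by rewrite rmorph_sum; apply: eq_bigr => w _; rewrite sqn_conj.
have nG : \sum_(w <- G) sqn (g w) <= l2_norm (trunc F f) * (M * l2_norm (trunc G g)).
  rewrite -[leLHS]ger0_norm; last by apply: sumr_ge0 => w _; exact: sqn_ge0.
  rewrite -normcR sG (adj_mx_dot _ _ _ _ (bounded_lin bb) (bounded_lin ba) ab).
  rewrite (eq_big_seq (fun v => trunc F f v * conjc (a (trunc G g) v))); last first.
    by move=> v vF; rewrite truncE// vF.
  by rewrite (le_trans (dot_le _ _ uF))// ler_wpM2l ?l2_norm_ge0.
move: nG; rewrite -trunc_nsq// -l2_normE.
set t := l2_norm (trunc G g); set k := l2_norm _ => nG.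
have t0 : 0 <= t := l2_norm_ge0 _.
have k0 : 0 <= k := l2_norm_ge0 _.
rewrite lerXn2r// ?nnegrE ?mulr_ge0//.
have [->|tp] := eqVneq t 0; first by rewrite mulr_ge0.
have tpos : 0 < t by rewrite lt_neqAle eq_sym tp.
by rewrite -(ler_pM2r tpos) -expr2 (le_trans nG)// mulrA [k * M]mulrC.
Qed.

Lemma trunc_mono F G f : uniq F -> uniq G -> {subset F <= G} ->
  l2_norm (f - trunc G f) <= l2_norm (f - trunc F f).
Proof.
move=> uF uG FG; apply: ler_wsqrtr; apply: nsq_mono => w.
rewrite !l2B !truncE//; case: ifP => wG; case: ifP => wF //.
  by rewrite subrr sqn0 sqn_ge0.
by move: wG; rewrite FG.
Qed.

Lemma trunc_dense2 f g (e : R) : 0 < e -> exists F, [/\ uniq F,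
  l2_norm (f - trunc F f) <= e & l2_norm (g - trunc F g) <= e].
Proof.
move=> e0; have [F uF hF] := trunc_dense f e0; have [G uG hG] := trunc_dense g e0.
exists (undup (F ++ G)); split; first exact: undup_uniq.
- apply: le_trans hF; apply: trunc_mono => // [|w wF]; first exact: undup_uniq.
  by rewrite mem_undup mem_cat wF.
- apply: le_trans hG; apply: trunc_mono => // [|w wF]; first exact: undup_uniq.
  by rewrite mem_undup mem_cat wF orbT.
Qed.

Lemma adj_mx_comp a b a' b' : bounded_op a -> bounded_op b ->
  bounded_op a' -> bounded_op b' ->
  adj_mx a b -> adj_mx a' b' -> adj_mx (a \o a') (b' \o b).
Proof.
move=> ba bb ba' bb' ab ab' v w /=.
set g := a' _; set h := b _.
have [M M0 ha] := bounded_bd ba; have [N N0 hb] := bounded_bd bb'.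
apply/eqP; rewrite -subr_eq0; apply/eqP/normc_eq0/le_anti.
rewrite normc_ge0 andbT; apply: (@small_le0 _ (M + N)) => [|e e0].
  by rewrite addr_ge0// ltW.
have [F [uF gF hF]] := trunc_dense2 g h e0.
have ew : a (trunc F g) w = conjc (b' (trunc F h) v).
  rewrite (lin_trunc (bounded_lin ba)) (lin_trunc (bounded_lin bb')).
  rewrite rmorph_sum; apply: eq_bigr => u _.
  by rewrite ab (adj_mx_sym ab') rmorphM /= conjcK; exact: mulrC.
rewrite -[a g](subrK (a (trunc F g))) l2D ew -addrA -rmorphB.
rewrite (le_trans (normcD _ _))// mulrDl lerD//.
  rewrite -(linB (bounded_lin ba)) (le_trans (l2_normc _ _))// (le_trans (ha _))//.
  by rewrite ler_wpM2l// ltW.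
rewrite normc_conj -l2B -(linB (bounded_lin bb')).
rewrite (le_trans (l2_normc _ _))// (le_trans (hb _))//.
by rewrite l2_normBC ler_wpM2l// ltW.
Qed.

Lemma adj_mx_comb (k : C) a b a' b' : adj_mx a b -> adj_mx a' b' ->
  adj_mx (k *: a + a') (conjc k *: b + b').
Proof.
move=> ab ab' v w; rewrite !op_addE !op_scaleE !l2D !l2Z ab ab'.
by rewrite rmorphD rmorphM /= conjcK.
Qed.

Lemma adj_mx_sub a b a' b' : adj_mx a b -> adj_mx a' b' ->
  adj_mx (a - a') (b - b').
Proof. by move=> ab ab' v w; rewrite !op_subE !l2B ab ab' rmorphB. Qed.

Lemma adj_mx_id : adj_mx id id.
Proof.
by move=> v w; rewrite !l2_deltaE conjc_nat eq_sym.
Qed.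

(** * Polynomials in self-adjoint operators are dense *)

(** For self-adjoint generators this is the generated star algebra. *)
Inductive op_poly (G : set op) : op -> Prop :=
| OpGen a of G a : op_poly G a
| OpId : op_poly G id
| OpComb (k : C) a b of op_poly G a & op_poly G b : op_poly G (k *: a + b)
| OpComp a b of op_poly G a & op_poly G b : op_poly G (a \o b).

Section Generated.
Variable G : set op.
Hypothesis Gbd : forall a, G a -> bounded_op a.
Hypothesis Gsa : forall a, G a -> adj_mx a a.
Local Notation A := (generated_cstar_algebra G).

Lemma poly_bounded a : op_poly G a -> bounded_op a.
Proof.
elim=> [{}a /Gbd//||k b c _ bb _ bc|b c _ bb _ bc].
- exact: bounded_id.
- exact: bounded_comb.
- exact: bounded_comp.
Qed.

Lemma poly_adj a : op_poly G a -> exists2 b, op_poly G b & adj_mx a b.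
Proof.
elim=> [{}a Ga||k b c _ [b' pb hb] _ [c' pc hc]|b c pb [b' pb' hb] pc [c' pc' hc]].
- by exists a; [exact: OpGen|exact: Gsa].
- by exists id; [exact: OpId|exact: adj_mx_id].
- by exists (conjc k *: b' + c'); [exact: OpComb|exact: adj_mx_comb].
- exists (c' \o b'); [exact: OpComp|apply: adj_mx_comp => //; exact: poly_bounded].
Qed.

Definition poly_closure : set op :=
  [set a | bounded_op a /\
     forall e, 0 < e -> exists2 x, op_poly G x & opbd (a - x) e].

Lemma poly_closure_poly x : op_poly G x -> poly_closure x.
Proof.
move=> px; split; first exact: poly_bounded.
move=> e e0; exists x => // f; rewrite op_subE subrr l2_norm0.
by rewrite mulr_ge0 ?l2_norm_ge0// ltW.
Qed.

(** Closure under adjoints is the only delicate point: the adjoint of an operator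
    at distance at most [e] from [x] is at distance at most [e] from the adjoint
    of [x], which is a polynomial again. *)
Lemma poly_closure_cstar : unital_cstar_subalgebra poly_closure.
Proof.
split; first split.
- by move=> a [].
- exact/poly_closure_poly/OpId.
- move=> k a b [ba ha] [bb hb]; split; first exact: bounded_comb.
  move=> e e0; pose n := normc k + 1.
  have n0 : 0 < n by rewrite ltr_wpDl ?normc_ge0.
  have [x px hx] := ha (e / 2 / n) (divr_gt0 (half_pos e0) n0).
  have [y py hy] := hb (e / 2) (half_pos e0).
  exists (k *: x + y); first exact: OpComb.
  apply: (@opbd_le _ (normc k * (e / 2 / n) + e / 2)).
    rewrite [leRHS](splitr e) lerD2r mulrCA -[leRHS]mulr1 ler_wpM2l ?divr_ge0 ?(ltW e0)//.
    by rewrite ler_pdivrMr// mul1r lerDl.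
  have := opbd_comb k hx hy.
  by rewrite scalerBr opprD addrACA.
- move=> a b [ba ha] [bb hb]; split; first exact: bounded_comp.
  move=> e e0; have [M M0 hM] := bounded_bd ba; have [N N0 hN] := bounded_bd bb.
  pose e' := Num.min 1 (e / (M + N + 1)).
  have D0 : 0 < M + N + 1 by rewrite !addr_gt0.
  have e'0 : 0 < e' by rewrite lt_min ltr01 divr_gt0.
  have [x px hx] := ha e' e'0; have [y py hy] := hb e' e'0.
  exists (x \o y); first exact: OpComp.
  have hy' : opbd y (N + 1).
    rewrite -[y](subrK b) addrC; apply: opbd_add => //.
    by apply: opbd_le (opbd_subC hy); rewrite ge_min lexx.
  apply: (@opbd_le _ (M * e' + e' * (N + 1))).
    rewrite [M * _]mulrC -mulrDr addrA -ler_pdivlMr//.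
    by rewrite ge_min lexx orbT.
  move=> f; rewrite op_subE /= (le_trans (l2_norm_tri _ (a (y f)) _))//.
  rewrite mulrDl lerD//.
    rewrite -(linB (bounded_lin ba)) (le_trans (hM _))// -mulrA.
    by rewrite ler_wpM2l ?(ltW M0)//; exact: hy.
  rewrite (le_trans (hx _))// -mulrA ler_wpM2l// ltW//.
- move=> a b [ba ha] bb /op_adjoint_mx ab; split => // e e0.
  have [x px hx] := ha e e0; have [y py hy] := poly_adj px.
  exists y => //; apply: (@adj_mx_bd (a - x)) => //; try exact: ltW.
  + by apply: bounded_sub => //; exact: poly_bounded.
  + by apply: bounded_sub => //; exact: poly_bounded.
  + exact: adj_mx_sub.
- move=> a ba ha; split => // e e0.
  have e2 : 0 < e / 2 by rewrite divr_gt0.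
  have [b [bb hb] ab] := ha _ e2; have [x px hx] := hb _ e2.
  exists x => //; rewrite (splitr e); apply: opbd_tri hx.
  by apply: opbd_le (ltW ab) _; apply/op_norm_bd/bounded_sub.
Qed.

Lemma generated_cstar : unital_cstar_subalgebra A.
Proof.
have all B : unital_cstar_subalgebra B -> G `<=` B -> A `<=` B.
  by move=> cB GB a Aa; apply: Aa.
split; first split.
- move=> a /(all _ poly_closure_cstar) -[]// b Gb.
  exact/poly_closure_poly/OpGen.
- by move=> B [[[_ + _ _ _] _] _].
- move=> k a b Aa Ab B cB; case: (cB) => -[[_ _ + _ _] _] _; apply.
    exact: Aa. exact: Ab.
- move=> a b Aa Ab B cB; case: (cB) => -[[_ _ _ + _] _] _; apply.
    exact: Aa. exact: Ab.
- move=> a b Aa bb ab B cB; case: (cB) => -[[_ _ _ _ h] _] _; apply: (h a) => //.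
  exact: Aa.
- move=> a ba h B cB; case: (cB) => -[_ +] _; apply => // e /h[b Ab ab].
  by exists b => //; exact: Ab.
Qed.

Lemma generated_gen a : G a -> A a.
Proof. by move=> Ga B [_]; apply. Qed.

Lemma generated_poly x : op_poly G x -> A x.
Proof.
have [[_ Aid Acomb Acomp _] _] := generated_cstar.
elim=> [a /generated_gen//|//|k a b _ Aa _ Ab|a b _ Aa _ Ab].
- exact: Acomb.
- exact: Acomp.
Qed.

Lemma generated_dense a e : A a -> 0 < e ->
  exists2 x, op_poly G x & opbd (a - x) e.
Proof.
move=> Aa e0; have [_ h] : poly_closure a; last exact: h.
by apply: Aa; split=> [|b Gb]; [exact: poly_closure_cstar|exact/poly_closure_poly/OpGen].
Qed.

End Generated.

End Operators.

(** * The Hecke operators and the canonical trace *)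

Section PolyExtra.
Variables (R : realType) (W : choiceType).
Local Notation H := (l2 R W).
Local Notation op := (H -> H).
Variable G : set op.

Lemma poly0 : op_poly G 0.
Proof.
rewrite (_ : 0 = (-1 : R[i]) *: id + id :> op); last first.
  by rewrite scaleN1r addNr.
by apply: OpComb; exact: OpId.
Qed.

Lemma polyZ (k : R[i]) a : op_poly G a -> op_poly G (k *: a).
Proof. by move=> pa; rewrite -[k *: a]addr0; apply: OpComb poly0. Qed.

Lemma polyD a b : op_poly G a -> op_poly G b -> op_poly G (a + b).
Proof. by move=> pa pb; rewrite -[a]scale1r; apply: OpComb. Qed.

Lemma poly_sum I (r : seq I) (F : I -> op) :
  (forall i, op_poly G (F i)) -> op_poly G (\sum_(i <- r) F i).
Proof.
move=> pF; elim: r => [|i r IH]; first by rewrite big_nil; exact: poly0.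
by rewrite big_cons; apply: polyD.
Qed.

(** Commuting with a bounded operator passes to norm limits, hence from the
    generators to the polynomials and to the algebra. *)
Lemma generated_commute (r : op) :
  (forall a, G a -> bounded_op a) -> (forall a, G a -> adj_mx a a) ->
  bounded_op r -> (forall a, G a -> a \o r = r \o a) ->
  forall a, generated_cstar_algebra G a -> a \o r = r \o a.
Proof.
move=> Gbd Gsa br Gr a Aa.
have pr x : op_poly G x -> x \o r = r \o x.
  elim=> [b /Gr //|//|k b c _ hb _ hc|b c _ hb _ hc].
  - apply/funext => f /=; rewrite !op_addE !op_scaleE (linD (bounded_lin br)).
    rewrite (linZ (bounded_lin br)) -[b (r f)]/((b \o r) f) hb.
    by rewrite -[c (r f)]/((c \o r) f) hc.
  - by rewrite -compA hc compA hb.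
have [N N0 hN] := bounded_bd br.
apply/funext => f; apply/eqP; rewrite -subr_eq0; apply/eqP/l2_norm_eq0/le_anti.
rewrite l2_norm_ge0 andbT /=.
have M0 : 0 <= 2 * N * l2_norm f by rewrite !mulr_ge0 ?l2_norm_ge0// ltW.
apply: (small_le0 M0) => e e0.
have [x px hx] := generated_dense Gbd Gsa Aa e0.
have xr : x (r f) = r (x f) by rewrite -[LHS]/((x \o r) f) pr.
apply: le_trans (l2_norm_tri _ (x (r f)) _) _.
have -> : 2 * N * l2_norm f * e = e * (N * l2_norm f) + N * (e * l2_norm f) by ring.
apply: lerD.
  by apply: le_trans (hx (r f)) _; rewrite ler_wpM2l ?(ltW e0).
rewrite xr -(linB (bounded_lin br)); apply: le_trans (hN _) _.
by rewrite ler_wpM2l ?(ltW N0)// l2_normBC; exact: hx.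
Qed.

End PolyExtra.

Lemma nonneg_closed (R : realType) (c : R[i]) (N : R) : 0 <= N ->
  (forall e, 0 < e -> exists2 r : R, 0 <= r & normc (c - r%:C) <= N * e) ->
  0 <= c.
Proof.
move=> N0 h.
case: c h => a b h; rewrite lecE /=; apply/andP; split.
  rewrite -normr_le0; apply: (small_le0 N0) => e /h[r r0 hr].
  by apply: le_trans hr; have /= [_] := ReIm_le_normc ((a +i* b) - r%:C); rewrite subr0.
rewrite -oppr_le0; apply: (small_le0 N0) => e /h[r r0 hr].
apply: le_trans hr; have /= [+ _] := ReIm_le_normc ((a +i* b) - r%:C) => /(le_trans _); apply.
by rewrite -normrN (le_trans _ (ler_norm _))// opprB lerDr.
Qed.

Section Hecke.
Variables (R : realType) (W : groupType) (S : choiceType).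
Variables (X : coxeterSystem W S) (q : S -> R).
Local Notation C := R[i].
Local Notation H := (l2 R W).
Local Notation op := (H -> H).
Local Notation delta := (@l2_delta R W).
Local Notation gen := (cox_gen X).
Local Notation len := (word_length X).
Local Notation desc := (left_descent X).
Local Notation T := (hecke_op X q).
Local Notation p := (hecke_p q).
Local Notation A := (hecke_cstar_algebra X q).
Implicit Types (f g : H) (s t : S) (v w : W).

Lemma heckeE s f v :
  T s f v = f (gen s * v)%g + (p s)%:C * (if desc s v then f v else 0).
Proof. by []. Qed.

Lemma hecke_bounded a : range T a -> bounded_op a.
Proof. by case=> s _ <-; exact: hecke_op_bounded. Qed.

Lemma hecke_selfadj a : range T a -> adj_mx a a.
Proof.
case=> s _ <- v w; rewrite !heckeE.
have cD (x y : C) : conjc (x + y) = conjc x + conjc y by exact: rmorphD.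
have pE (z : C) : conjc ((p s)%:C * z) = (p s)%:C * conjc z.
  by rewrite rmorphM; congr (_ * _); exact: conjc_real.
have dE x y : conjc (delta x y) = delta x y by exact: conjc_nat.
rewrite cD pE dE; congr (_ + _ * _).
  have [->|ne] := pselect (v = gen s * w)%g; first by rewrite genK !l2_delta_id.
  by rewrite !l2_delta_ne// => h; apply: ne; rewrite h genK.
have [->|ne] := pselect (v = w); first by case: ifP; rewrite ?dE ?conjc0.
have ne' : w <> v by move=> h; apply: ne.
by rewrite !l2_delta_ne//; do 2 case: ifP => _; rewrite ?conjc0.
Qed.

Lemma hecke_poly s : op_poly (range T) (T s). Proof. by apply: OpGen; exists s. Qed.

Lemma hecke_A s : A (T s). Proof. by apply: generated_gen; exists s. Qed.

Lemma poly_A a : op_poly (range T) a -> A a.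
Proof. move=> h. exact: (generated_poly hecke_bounded hecke_selfadj h). Qed.

Let cstar_A : unital_cstar_subalgebra A := generated_cstar hecke_bounded hecke_selfadj.

Lemma A_bounded a : A a -> bounded_op a.
Proof. by case: cstar_A => -[+ _ _ _ _] _; apply. Qed.

Lemma A_lin a : A a -> linear a. Proof. by move/A_bounded/bounded_lin. Qed.

Lemma A_id : A id. Proof. by case: cstar_A => -[]. Qed.

Lemma A_comb (k : C) a b : A a -> A b -> A (k *: a + b).
Proof. by case: cstar_A => -[_ _ + _ _] _; apply. Qed.

Lemma A_comp a b : A a -> A b -> A (a \o b).
Proof. by case: cstar_A => -[_ _ _ + _] _; apply. Qed.

Lemma A_sub a b : A a -> A b -> A (a - b).
Proof. by move=> Aa Ab; rewrite op_subN1; exact: A_comb. Qed.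

Lemma A_add a b : A a -> A b -> A (a + b).
Proof. by move=> Aa Ab; rewrite -[a]scale1r; apply: A_comb. Qed.

Lemma A_0 : A 0. Proof. by apply: poly_A; exact: poly0. Qed.

Lemma A_scale (k : C) a : A a -> A (k *: a).
Proof. by move=> Aa; rewrite -[k *: a]addr0; apply: A_comb A_0. Qed.

Lemma A_closed : norm_closed A. Proof. by case: cstar_A. Qed.

Lemma A_dense a e : A a -> 0 < e ->
  exists2 x, op_poly (range T) x & opbd (a - x) e.
Proof. by move=> h e0; exact: (generated_dense hecke_bounded hecke_selfadj h e0). Qed.

(** * Right multiplications *)

Lemma sqr_sum_inv (f : W -> C) : sqr_sum (fun v => f v^-1%g) = sqr_sum f.
Proof.
rewrite /sqr_sum [RHS](reindex_esum [set: W] _ (fun v => v^-1%g))//.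
split=> // [x y _ _|x _]; first exact: invg_inj.
by exists x^-1%g => //; rewrite invgK.
Qed.

Lemma flip_subproof f : (fun v => f v^-1%g) \in @square_summable R W.
Proof. by apply/square_summableP; rewrite sqr_sum_inv l2_summable. Qed.

Definition flip f : H := L2 (flip_subproof f).

Lemma flipE f v : flip f v = f v^-1%g. Proof. by []. Qed.
Lemma flipK f : flip (flip f) = f.
Proof. by apply: l2_ext => v; rewrite !flipE invgK. Qed.
Lemma flip_nsq f : nsq (flip f) = nsq f.
Proof. by rewrite /nsq -[in RHS](sqr_sum_inv f). Qed.
Lemma flip_norm f : l2_norm (flip f) = l2_norm f.
Proof. by rewrite /l2_norm -/(nsq _) flip_nsq. Qed.
Lemma flip_lin : linear flip. Proof. by move=> k f g; apply: l2_ext. Qed.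
Lemma flip_bounded : bounded_op flip.
Proof. by apply: (@bounded_intro _ _ _ 1) flip_lin _ => f; rewrite flip_norm mul1r. Qed.
Lemma flip_delta w : flip (delta w) = delta w^-1%g.
Proof.
by apply: l2_ext => v; rewrite flipE !l2_deltaE -[in RHS](eqg_inv v) invgK.
Qed.

(** The inversion [v |-> v^-1] of [W] exchanges left and right multiplications. *)
Definition right_op s : op := flip \o T s \o flip.

Lemma right_opE s f v : right_op s f v =
  f (v * gen s)%g + (p s)%:C * (if desc s v^-1%g then f v else 0).
Proof. by rewrite -[right_op s f]/(flip (T s (flip f))) flipE heckeE !flipE invgM invgK genV. Qed.

Lemma right_op_bounded s : bounded_op (right_op s).
Proof.
apply: bounded_comp; last exact: flip_bounded.
by apply: bounded_comp; [exact: flip_bounded|exact: hecke_op_bounded].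
Qed.

Lemma left_descE s v : desc s v = (len (gen s * v)%g < len v)%N. Proof. by []. Qed.

Lemma hecke_delta_asc s w : ~~ desc s w -> T s (delta w) = delta (gen s * w)%g.
Proof. by move=> /negPf n; rewrite hecke_op_delta n addr0. Qed.

Lemma right_delta_asc s w : ~~ desc s w^-1%g ->
  right_op s (delta w) = delta (w * gen s)%g.
Proof.
by move=> n; rewrite -[LHS]/(flip (T s (flip (delta w)))) flip_delta hecke_delta_asc// flip_delta invgM invgK genV.
Qed.

Hypothesis qconj : conj_invariant X q.

(** Left multiplication by [t] and right multiplication by [s] interact only at
    elements [v] with [t v = v s]; there [s] and [t] are conjugate, and
    [p_s = p_t]. *)
Lemma hecke_right_comm s t f : T t (right_op s f) = right_op s (T t f).
Proof.
apply: l2_ext => v; rewrite heckeE !right_opE !heckeE mulgA.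
have [tv|tv] := eqVneq (gen t * v)%g (v * gen s)%g; last first.
  rewrite (desc_mulr tv) invgM genV (@desc_mulr _ _ X t s).
    by case: ifP => _; case: ifP => _; ring.
  apply: contra tv => /eqP h; apply/eqP; apply: invg_inj.
  by rewrite !invgM !genV h.
have pst : p s = p t.
  rewrite /hecke_p (qconj (s := s) (t := t) (w := v^-1%g))//.
  by rewrite conjgE invgK mulgA -tv mulgK.
have dst : desc s v^-1%g = desc t v.
  by rewrite !left_descE -[X in _ = (X < _)%N]lenV -[X in (X < _)%N]lenV invgM genV invgK -tv lenV lenV.
have sv : (v^-1 * gen t = gen s * v^-1)%g.
  by apply: invg_inj; rewrite !invgM !genV invgK.
rewrite -tv desc_flip invgM genV sv desc_flip dst pst.
by case: (desc t v) => /=; ring.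
Qed.

Lemma A_right_comm s a f : A a -> a (right_op s f) = right_op s (a f).
Proof.
move=> Aa; rewrite -[LHS]/((a \o right_op s) f).
rewrite (generated_commute hecke_bounded hecke_selfadj (right_op_bounded s))//.
by move=> _ [t _ <-]; apply/funext => g /=; rewrite hecke_right_comm.
Qed.

(** [delta 1] is separating, since right multiplications move it to every
    [delta w]. *)
Lemma A_separating a : A a -> a (delta 1%g) = 0 -> a = 0.
Proof.
move=> Aa a1; apply: (bounded_eq (A_bounded Aa) (@bounded0 _ _)) => w.
rewrite -[w]invgK; elim/(@len_ind _ _ X): (w^-1)%g => [|s u nd IH].
  by rewrite invg1 a1.
rewrite invgM genV -right_delta_asc ?invgK// A_right_comm// IH.
exact: lin0 (bounded_lin (right_op_bounded s)).
Qed.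

Lemma A_eq a b : A a -> A b -> a (delta 1%g) = b (delta 1%g) -> a = b.
Proof.
move=> Aa Ab ab; apply/eqP; rewrite -subr_eq0; apply/eqP/A_separating.
  exact: A_sub.
by rewrite op_subE ab subrr.
Qed.

(** The canonical trace, [<a delta_1, delta_1>]. *)
Definition htrace (a : op) : C := a (delta 1%g) 1%g.

Lemma htrace_comp (a b : op) : htrace (a \o b) = a (b (delta 1%g)) 1%g.
Proof. by []. Qed.

(** [T_s delta_1] is also the image of [delta_1] under a right multiplication,
    which commutes with [b]. *)
Lemma htrace_hecke s b : A b -> htrace (T s \o b) = htrace (b \o T s).
Proof.
move=> Ab; rewrite !htrace_comp heckeE desc1 mulr0 addr0 mulg1.
rewrite hecke_delta_asc ?desc1// mulg1.
have -> : delta (gen s) = right_op s (delta 1%g).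
  by rewrite right_delta_asc ?invg1 ?desc1// mul1g.
by rewrite A_right_comm// right_opE invg1 desc1 mulr0 addr0 mul1g.
Qed.

Lemma htrace_poly x b : op_poly (range T) x -> A b ->
  htrace (x \o b) = htrace (b \o x).
Proof.
move=> px; elim: px b => [_ [s _ <-] b /htrace_hecke//|//|k a c _ ha _ hc b Ab|
    a c pa ha pc hc b Ab].
- rewrite !htrace_comp !op_addE !op_scaleE (linD (A_lin Ab)) (linZ (A_lin Ab)).
  rewrite !l2D !l2Z; congr (_ * _ + _); first exact: ha.
  exact: hc.
- have Aa := poly_A pa; have Ac := poly_A pc.
  rewrite -[LHS]/(htrace (a \o (c \o b))) ha; last exact: A_comp.
  rewrite -[LHS]/(htrace (c \o (b \o a))) hc//; exact: A_comp.
Qed.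

Lemma htrace_bd a M : opbd a M -> normc (htrace a) <= M.
Proof.
move=> h; rewrite (le_trans (l2_normc _ _))// (le_trans (h _))//.
by rewrite l2_norm_delta mulr1.
Qed.

Lemma htraceC a b : A a -> A b -> htrace (a \o b) = htrace (b \o a).
Proof.
move=> Aa Ab; apply/eqP; rewrite -subr_eq0; apply/eqP/normc_eq0/le_anti.
rewrite normc_ge0 andbT.
have [M M0 hM] := bounded_bd (A_bounded Ab).
have MM : 0 <= M + M by rewrite addr_ge0 ?ltW.
apply: (small_le0 MM) => e e0; have [x px hx] := A_dense Aa e0.
have -> : htrace (a \o b) - htrace (b \o a) =
   htrace ((a - x) \o b) - htrace (b \o (a - x)).
  rewrite !htrace_comp !op_subE (linB (A_lin Ab)) !l2B.
  by have := htrace_poly px Ab; rewrite !htrace_comp => ->; ring.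
rewrite (le_trans (normcD _ _))// mulrDl normcN lerD//; apply: htrace_bd.
  by rewrite mulrC; apply: opbd_comp hM => //; exact: ltW.
by apply: opbd_comp => //; exact: ltW.
Qed.

Lemma htrace_pos a b : bounded_op a -> bounded_op b -> adj_mx a b ->
  0 <= htrace (b \o a).
Proof.
move=> ba bb /adj_mx_sym ab; have [N N0 hN] := bounded_bd bb.
apply: (nonneg_closed (ltW N0)) => e e0; set g := a (delta 1%g).
have [F uF hF] := trunc_dense g e0.
exists (\sum_(w <- F) sqn (g w)).
  by apply: sumr_ge0 => w _; exact: sqn_ge0.
have -> : (\sum_(w <- F) sqn (g w))%:C = b (trunc F g) 1%g.
  rewrite (lin_trunc (bounded_lin bb)) rmorph_sum; apply: eq_bigr => w _.
  by rewrite ab -/g sqn_conj.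
rewrite htrace_comp -l2B -(linB (bounded_lin bb)) (le_trans (l2_normc _ _))//.
by rewrite (le_trans (hN _))// ler_wpM2l ?(ltW N0).
Qed.

Lemma htrace_state : tracial_state A htrace.
Proof.
split=> //.
- by move=> a b Aa Ab /op_adjoint_mx; apply: htrace_pos; exact: A_bounded.
- exact: l2_delta_id.
- exact: htraceC.
Qed.

(** * A character prevents simplicity and uniqueness of the trace *)

(** The kernel of [chi] is a closed ideal that contains [T_s - chi(T_s)] but not 1.
    As a tracial state, [chi] differs from the canonical trace, which vanishes at
    [T_s]. *)
Lemma character_not_simple (chi : op -> C) :
  (forall k a b, A a -> A b -> chi (k *: a + b) = k * chi a + chi b) ->
  (forall a b, A a -> A b -> chi (a \o b) = chi a * chi b) ->
  chi id = 1 ->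
  (forall a b, A a -> A b -> adj_mx a b -> 0 <= chi (b \o a)) ->
  (forall a M, A a -> opbd a M -> normc (chi a) <= M) ->
  (exists s, chi (T s) != 0) ->
  ~ cstar_simple A /\ ~ unique_tracial_state A.
Proof.
move=> chilin chiM chi1 chipos chibd [s chis]; split; last first.
  move=> [tau _ uniq].
  have chist : tracial_state A chi.
    split=> //.
    - by move=> a b Aa Ab /op_adjoint_mx; exact: chipos.
    - by move=> a b Aa Ab; rewrite (chiM a b)// (chiM b a)// mulrC.
  have := uniq _ chist _ (hecke_A s); rewrite -(uniq _ htrace_state _ (hecke_A s)).
  rewrite /htrace hecke_delta_asc ?desc1// mulg1 l2_delta_ne; last exact/eqP/gen_neq1.
  by move/eqP; rewrite (negPf chis).
pose I := [set a | A a /\ chi a = 0].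
have chisub a b : A a -> A b -> chi (a - b) = chi a - chi b.
  by move=> Aa Ab; rewrite op_subN1 chilin// mulN1r addrC.
have chi0 : chi 0 = 0.
  by have := chisub _ _ A_id A_id; rewrite !subrr.
have A0 : A 0 := A_0.
have idealI : closed_ideal A I.
  split=> //; first by move=> a [].
  - move=> k a b [Aa a0] [Ab b0]; split; first exact: A_comb.
    by rewrite chilin// a0 b0 mulr0 addr0.
  - move=> a b Aa [Ab b0]; split; split; try exact: A_comp.
    + by rewrite (chiM a b)// b0 mulr0.
    + by rewrite (chiM b a)// b0 mul0r.
  - move=> a ba h.
    have Aa : A a.
      by apply: A_closed => // e /h[b [Ab _] ab]; exists b.
    split=> //; apply/normc_eq0/le_anti; rewrite normc_ge0 andbT.
    apply: (@small_le0 _ _ 1) => // e /h[b [Ab b0] ab]; rewrite mul1r.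
    rewrite -[chi a]subr0 -b0 -chisub//; apply: chibd; first exact: A_sub.
    apply: opbd_le (ltW ab) _; apply: op_norm_bd.
    by apply: bounded_sub => //; exact: A_bounded.
move=> /(_ I idealI)[I0|IA]; last first.
  have : I id by rewrite IA; exact: A_id.
  by case=> _; rewrite chi1 => /eqP; rewrite oner_eq0.
pose a := T s - chi (T s) *: id.
have Ia : I a.
  have Ak : A (chi (T s) *: id) := A_scale _ A_id.
  split; first by apply: A_sub => //; exact: hecke_A.
  rewrite chisub//; last exact: hecke_A.
  rewrite -[_ *: id]addr0 chilin//; last exact: A_id.
  by rewrite chi1 chi0 mulr1 addr0 subrr.
have a0 : a = 0 by move: Ia; rewrite I0.
have : a (delta 1%g) (gen s) = 0 by rewrite a0.
rewrite /a op_subE op_scaleE l2B l2Z hecke_delta_asc ?desc1// mulg1.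
rewrite l2_delta_id l2_delta_ne ?mulr0 ?subr0; last first.
  by move=> h; have := gen_neq1 X s; rewrite -h eqxx.
by move/eqP; rewrite oner_eq0.
Qed.

End Hecke.

(** * Approximate eigenvectors *)

(** Two-sided approximation by numbers of prescribed accuracy determines a
    limit: it is the supremum of the lower ends. *)
Lemma approx_limit (R : realType) (P : R -> R -> Prop) :
  (forall e, 0 < e -> exists x, P e x) ->
  (forall e x e' x', P e x -> P e' x' -> `|x - x'| <= e + e') ->
  exists l, forall e x, P e x -> `|x - l| <= e.
Proof.
move=> ex close; pose E := [set r : R | exists e x, P e x /\ r = x - e].
have ubE e x : P e x -> ubound E (x + e).
  move=> Px _ [e' [x' [Px' ->]]].
  by have := close _ _ _ _ Px' Px; rewrite ler_norml => /andP[_]; lra.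
have [x1 Px1] := ex 1 ltr01.
have E0 : E !=set0 by exists (x1 - 1), 1, x1.
have hub : has_ubound E by exists (x1 + 1); exact: ubE.
exists (sup E) => e x Px; rewrite ler_norml.
have lo : x - e <= sup E by apply: ub_le_sup => //; exists e, x.
have hi : sup E <= x + e by apply: ge_sup => //; exact: ubE.
by apply/andP; split; lra.
Qed.

Lemma bernoulli_ge (R : realType) (x : R) n : 0 <= x -> 1 + x *+ n <= (1 + x) ^+ n.
Proof.
move=> x0; elim: n => [|n IH]; first by rewrite mulr0n addr0.
rewrite exprS; apply: le_trans (_ : (1 + x) * (1 + x *+ n) <= _).
  by rewrite mulrS; have := mulrn_wge0 n x0; move: (x *+ n) => y; nra.
by rewrite ler_wpM2l// addr_ge0.
Qed.

Lemma geometric_small (R : realType) (r K e : R) : 0 < r -> r < 1 -> 0 <= K ->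
  0 < e -> exists n, K * r ^+ n <= e.
Proof.
move=> r0 r1 K0 e0; pose x := r^-1 - 1.
have x0 : 0 < x by rewrite subr_gt0 invf_gt1.
have := archi_boundP (divr_ge0 K0 (ltW (mulr_gt0 e0 x0))).
set n := Num.bound _; rewrite ltr_pdivrMr ?mulr_gt0// => lt.
exists n; rewrite -[r]invrK exprVn ler_pdivrMr; last first.
  by rewrite exprn_gt0// invr_gt0.
have e1 : 1 + x = r^-1 by rewrite /x addrC subrK.
have := bernoulli_ge n (ltW x0); rewrite e1 => le.
apply: le_trans (ltW lt) _.
have -> : n%:R * (e * x) = e * (x *+ n) by rewrite -mulr_natl; ring.
rewrite ler_wpM2l ?(ltW e0)//; apply: le_trans le.
by rewrite lerDr.
Qed.

Lemma pow_le_linear (R : realType) (x : R) d : 0 <= x -> x <= 1 ->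
  (1 + x) ^+ d <= 1 + 3 ^+ d * x.
Proof.
move=> x0 x1; elim: d => [|d IH]; first by rewrite !expr0 mul1r lerDl.
have c1 : 1 <= 3 ^+ d :> R by rewrite exprn_ege1// ler1n.
rewrite exprS; apply: le_trans (_ : (1 + x) * (1 + 3 ^+ d * x) <= _).
  by rewrite ler_wpM2l// addr_ge0.
rewrite exprS; move: c1; set c := 3 ^+ d => c1.
have h1 : 0 <= x * (c - 1) by rewrite mulr_ge0// subr_ge0.
have h2 : 0 <= c * x * (1 - x) by rewrite !mulr_ge0 ?subr_ge0// (le_trans ler01).
by move: h1 h2; rewrite !(mulrBr, mulrDl, mulrDr, mulr1, mul1r); lra.
Qed.

(** Choose [x > 0] with [(1 + x)^d <= rho]; up to a factor, [n + 2] is at most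
    [1 + n x], hence at most [(1 + x)^n]. *)
Lemma poly_subexp (R : realType) d (rho : R) : 1 < rho ->
  exists2 M : R, 0 <= M & forall n, (n.+2)%:R ^+ d <= M * rho ^+ n.
Proof.
move=> rho1; pose x := Num.min 1 ((rho - 1) / 3 ^+ d) : R.
have c0 : 0 < 3 ^+ d :> R by rewrite exprn_gt0.
have x0 : 0 < x by rewrite lt_min ltr01 divr_gt0// subr_gt0.
have x1 : x <= 1 by rewrite ge_min lexx.
have xr : (1 + x) ^+ d <= rho.
  apply: le_trans (pow_le_linear d (ltW x0) x1) _.
  rewrite -lerBrDl mulrC -ler_pdivlMr//.
  by rewrite /x ge_min lexx orbT.
exists ((2 / x) ^+ d); first by rewrite exprn_ge0// divr_ge0// ltW.
move=> n; apply: le_trans (_ : (2 / x * (1 + x) ^+ n) ^+ d <= _); last first.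
  rewrite exprMn ler_wpM2l ?exprn_ge0 ?divr_ge0 ?(ltW x0)//.
  rewrite -!exprM mulnC exprM lerXn2r// nnegrE ?exprn_ge0 ?addr_ge0 ?(ltW x0)//.
  by rewrite (le_trans ler01)// ltW.
have pos : 0 <= 2 / x * (1 + x) ^+ n.
  by rewrite mulr_ge0 ?divr_ge0 ?exprn_ge0 ?addr_ge0 ?(ltW x0).
rewrite lerXn2r// ?nnegrE//.
apply: le_trans (_ : 2 / x * (1 + x *+ n) <= _); last first.
  by rewrite ler_wpM2l ?divr_ge0 ?(ltW x0)// bernoulli_ge// ltW.
rewrite mulrDr mulr1 -[x *+ n]mulr_natr mulrA mulfVK ?gt_eqF//.
have : 2 <= 2 / x by rewrite ler_pdivlMr// ler_piMr.
have -> : n.+2%:R = n%:R + 2 :> R by rewrite -natrD addn2.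
have : 0 <= n%:R :> R by [].
by move: (2 / x) (n%:R) => u v; lra.
Qed.

Section Balls.
Variables (W : groupType) (S : choiceType) (X : coxeterSystem W S).
Local Notation gen := (cox_gen X).
Implicit Types (F : seq S) (w : W).

Fixpoint wball F n : seq W :=
  if n is n'.+1 then
    undup (wball F n' ++ [seq (gen s * w)%g | s <- F, w <- wball F n'])
  else [:: 1%g].

Lemma wball_uniq F n : uniq (wball F n).
Proof. by case: n => // n; exact: undup_uniq. Qed.

Lemma wballS F n : {subset wball F n <= wball F n.+1}.
Proof. by move=> w wB; rewrite /= mem_undup mem_cat wB. Qed.

Lemma wball_gen F n s w : s \in F -> w \in wball F n -> (gen s * w)%g \in wball F n.+1.
Proof.
move=> sF wB; rewrite /= mem_undup mem_cat; apply/orP; right.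
by apply/allpairsP; exists (s, w).
Qed.

Lemma wball_ind F (P : nat -> W -> Prop) : P 0%N 1%g ->
  (forall n w, P n w -> P n.+1 w) ->
  (forall n s w, s \in F -> P n w -> P n.+1 (gen s * w)%g) ->
  forall n w, w \in wball F n -> P n w.
Proof.
move=> P1 PS Pg; elim=> [|n IH] w; first by rewrite inE => /eqP ->.
rewrite /= mem_undup mem_cat => /orP[/IH/PS//|/allpairsP[[s v] /= [sF vB ->]]].
by apply: Pg => //; exact: IH.
Qed.

Lemma wball_len_le F n w : w \in wball F n -> (word_length X w <= n)%N.
Proof.
elim/wball_ind: n w / => [|n w|n s w _]; first by rewrite len1.
  by move/leq_trans; apply.
by move=> le; apply: leq_trans (len_gen_le _ _ _) _.
Qed.

Lemma wball_len F n w : (forall s, s \in F) ->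
  (w \in wball F n) = (word_length X w <= n)%N.
Proof.
move=> allF; apply/idP/idP; first exact: wball_len_le.
elim: n w => [|n IH] w; first by rewrite leqn0 => /eqP/len_eq0 ->; rewrite inE.
have [->|/(@exists_desc _ _ X)[s ds]] := eqVneq w 1%g.
  by move=> _; apply/wballS/IH; rewrite len1.
rewrite (len_desc ds) ltnS => /IH h; rewrite -(genK X s w).
exact: wball_gen.
Qed.

End Balls.
Arguments wball : simpl never.

Section Character.
Variables (R : realType) (W : groupType) (S : choiceType).
Variables (X : coxeterSystem W S) (q : S -> R).
Hypothesis qX : multi_parameter X q.
Local Notation C := R[i].
Local Notation H := (l2 R W).
Local Notation op := (H -> H).
Local Notation gen := (cox_gen X).
Local Notation desc := (left_descent X).
Local Notation T := (hecke_op X q).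
Local Notation p := (hecke_p q).
Local Notation A := (hecke_cstar_algebra X q).
Implicit Types (f g : H) (s t : S) (v w : W) (F : seq S).

Let qpos : forall s, 0 < q s. Proof. by case: qX. Qed.
Let qconj : conj_invariant X q. Proof. by case: qX. Qed.

(** The roots of [x^2 = 1 + p_s x] are [q_s^(1/2)] and [- q_s^(-1/2)]; take the
    one of modulus at most 1. *)
Definition root_s s : R :=
  if q s <= 1 then Num.sqrt (q s) else - (Num.sqrt (q s))^-1.

Lemma root_sE s : root_s s ^+ 2 = 1 + p s * root_s s.
Proof.
have sq0 : 0 < Num.sqrt (q s) by rewrite sqrtr_gt0.
have sqq : q s = Num.sqrt (q s) ^+ 2 by rewrite sqr_sqrtr// ltW.
rewrite /hecke_p /root_s sqq; move: (Num.sqrt (q s)) sq0 => r r0.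
have rn0 : r != 0 by rewrite gt_eqF.
by rewrite sqrtr_sqr (ger0_norm (ltW r0)); case: ifP => _; field.
Qed.

Lemma root_s_neq0 s : root_s s != 0.
Proof.
have sq0 : Num.sqrt (q s) != 0 by rewrite gt_eqF// sqrtr_gt0.
by rewrite /root_s; case: ifP => // _; rewrite oppr_eq0 invr_eq0.
Qed.

Lemma root_s_sqr s : root_s s ^+ 2 = if q s <= 1 then q s else (q s)^-1.
Proof.
rewrite /root_s; case: ifP => _; first by rewrite sqr_sqrtr// ltW.
by rewrite sqrrN exprVn sqr_sqrtr// ltW.
Qed.

Lemma root_s_le1 s : root_s s ^+ 2 <= 1.
Proof.
rewrite root_s_sqr; case: ifPn => //; rewrite -ltNge => q1.
by rewrite invf_le1 ?ltW.
Qed.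

Definition root_w w : R := \prod_(s <- rword X w) root_s s.

Lemma root_w_gen s w : ~~ desc s w -> root_w (gen s * w)%g = root_s s * root_w w.
Proof.
move=> nd; rewrite /root_w -!(big_map root_s xpredT id).
rewrite (perm_big _ (perm_rword_cons _ nd)) ?big_cons//.
by move=> a b v h; rewrite /root_s (qconj h).
Qed.

Lemma root_w1 : root_w 1%g = 1. Proof. by rewrite /root_w rword1 big_nil. Qed.

Lemma root_w_sqr w : root_w w ^+ 2 = \prod_(s <- rword X w) root_s s ^+ 2.
Proof. by rewrite /root_w -prodrXl. Qed.

Lemma root_w_le1 w : root_w w ^+ 2 <= 1.
Proof.
rewrite root_w_sqr; elim: (rword X w) => [|s l IH]; first by rewrite big_nil.
rewrite big_cons -[leRHS]mulr1 ler_pM ?sqr_ge0 ?root_s_le1//.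
by apply: prodr_ge0 => i _; exact: sqr_ge0.
Qed.

(** Approximate joint eigenvectors of the [T_s] for the character. Their finite
    support makes the inner product with such a vector a finite sum. *)
Definition eigvec F (e : R) (f : H) :=
  [/\ f != 0, exists2 B : seq W, uniq B & f = trunc B f &
   forall s, s \in F -> l2_norm (T s f - (root_s s)%:C *: f) <= e * l2_norm f].

Lemma eigvec_sub F G e e' f : {subset F <= G} -> e' <= e ->
  eigvec G e' f -> eigvec F e f.
Proof.
move=> FG ee [f0 fB h]; split=> // s /FG/h sf; rewrite (le_trans sf)//.
by rewrite ler_wpM2r ?l2_norm_ge0.
Qed.

(** The squared norm of the truncation of [root_w] to a ball. *)
Definition growth F n : R := \sum_(w <- wball X F n) root_w w ^+ 2.

Definition subexponential := forall F (rho : R), 1 < rho ->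
  exists M : R, forall n, growth F n <= M * rho ^+ n.

Definition shell F n : seq W := [seq w <- wball X F n.+1 | w \notin wball X F n].

Lemma growthS F n :
  growth F n.+1 = growth F n + \sum_(w <- shell F n) root_w w ^+ 2.
Proof.
rewrite /growth /shell big_filter (bigID (mem (wball X F n))) /=; congr (_ + _).
rewrite -big_filter; apply: perm_big.
apply: uniq_perm; rewrite ?filter_uniq ?wball_uniq// => w.
by rewrite mem_filter; apply/andP/idP => [[]//|h]; split => //; exact: wballS.
Qed.

Lemma growth_mono F n : growth F n <= growth F n.+1.
Proof. by rewrite growthS lerDl; apply: sumr_ge0 => w _; exact: sqr_ge0. Qed.

Lemma growth_ge1 F n : 1 <= growth F n.
Proof.
elim: n => [|n IH]; first by rewrite /growth big_seq1 root_w1 expr1n.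
exact: le_trans IH (growth_mono _ _).
Qed.

(** If every shell had a fixed share of the mass of its ball, then the growth
    would be exponential. *)
Lemma thin_shell F (e : R) : subexponential -> 0 < e ->
  exists n, growth F n.+1 - growth F n <= e * growth F n.+1.
Proof.
move=> sub e0; apply: contrapT => no.
have e2 : 0 < 1 + e / 2 by rewrite addr_gt0// divr_gt0.
have step n : (1 + e) * growth F n <= growth F n.+1.
  rewrite leNgt; apply/negP => lt; apply: no; exists n.
  apply: le_trans (_ : e * growth F n <= _).
    by rewrite lerBlDl -[X in _ <= X + _]mul1r -mulrDl ltW.
  by rewrite ler_wpM2l ?growth_mono// ltW.
have big n : (1 + e) ^+ n <= growth F n.
  elim: n => [|n IH]; first exact: growth_ge1.
  by rewrite exprS (le_trans _ (step n))// ler_wpM2l// addr_ge0// ltW.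
have [|M hM] := sub F (1 + e / 2); first by rewrite ltrDl divr_gt0.
pose d := (e / 2) / (1 + e / 2).
have d0 : 0 < d by rewrite !divr_gt0.
have lin n : 1 + d *+ n <= M.
  apply: le_trans (bernoulli_ge n (ltW d0)) _.
  have -> : 1 + d = (1 + e) / (1 + e / 2) by rewrite /d; field; rewrite gt_eqF //; lra.
  rewrite expr_div_n ler_pdivrMr ?exprn_gt0//.
  exact: le_trans (big n) (hM n).
have M0 : 0 <= M.
  by apply: le_trans (lin 0%N); rewrite mulr0n addr0.
have := archi_boundP (divr_ge0 M0 (ltW d0)).
rewrite ltr_pdivrMr// mulr_natl; set n := Num.bound _ => lt.
by move: lt (lin n); move: (d *+ n) => y; lra.
Qed.

Lemma left_shift_subproof s f : shift_fun X s f \in @square_summable R W.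
Proof. by apply/square_summableP; rewrite sqr_sum_shift l2_summable. Qed.

Definition left_shift s f : H := L2 (left_shift_subproof s f).

Lemma left_shiftE s f v : left_shift s f v = f (gen s * v)%g. Proof. by []. Qed.
Lemma left_shift_nsq s f : nsq (left_shift s f) = nsq f.
Proof. by rewrite /nsq -[in RHS](sqr_sum_shift X s). Qed.
Lemma left_shift_norm s f : l2_norm (left_shift s f) = l2_norm f.
Proof. by rewrite /l2_norm -!/(nsq _) left_shift_nsq. Qed.

Definition shell_const F : R := \sum_(s <- F) ((`|p s| + 1) ^+ 2 + 1) + 1.

(** The truncation of [root_w] to a ball solves the eigenvector equations away
    from the outermost shell, whose share of the mass is small for a suitable
    radius. *)
Lemma exists_eigvec F (e : R) : subexponential -> 0 < e ->
  exists f, eigvec F e f.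
Proof.
move=> sub e0; pose K := shell_const F.
have K1 : 1 <= K.
  by rewrite lerDr; apply: sumr_ge0 => s _; rewrite addr_ge0 ?sqr_ge0.
have K0 : 0 < K by rewrite (lt_le_trans ltr01).
have [n thin] := @thin_shell F (e ^+ 2 / K) sub (divr_gt0 (exprn_gt0 2 e0) K0).
pose B := wball X F n.+1; pose B' := wball X F n.
have uB : uniq B := wball_uniq X F n.+1.
have ush : uniq (shell F n) by rewrite filter_uniq.
pose c w : C := (root_w w)%:C.
have sqc w : sqn (c w) = root_w w ^+ 2 by rewrite /sqn normcR real_normK ?num_real.
pose f := finvec B c; pose g := finvec (shell F n) c.
have nf : nsq f = growth F n.+1.
  by rewrite finvec_nsq//; apply: eq_bigr => w _; rewrite sqc.
have ng : nsq g = growth F n.+1 - growth F n.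
  rewrite finvec_nsq// growthS addrAC subrr add0r.
  by apply: eq_bigr => w _; rewrite sqc.
have fpos : 0 < nsq f by rewrite nf (lt_le_trans ltr01)// growth_ge1.
exists f; split.
- by apply: contraTneq fpos => ->; rewrite nsq0 ltxx.
- exists B => //; apply: l2_ext => w.
  by rewrite truncE// finvecE//; case: ifP => // ->.
move=> s sF; set u := _ - _.
have sum_le : (`|p s| + 1) ^+ 2 + 1 <= K.
  rewrite /K /shell_const (big_rem s)//= -addrA lerDl addr_ge0//.
  by apply: sumr_ge0 => t _; rewrite addr_ge0 ?sqr_ge0.
have root1 : `|root_s s| <= 1.
  by rewrite -(ler_pXn2r (n := 2))// ?nnegrE// real_normK ?num_real// expr1n root_s_le1.
pose k : C := (`|p s| + 1)%:C.
have sqk : sqn k = (`|p s| + 1) ^+ 2.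
  by rewrite /sqn normcR ger0_norm// addr_ge0.
have key : nsq u + nsq (0 : H) <= nsq (k *: g) + nsq (left_shift s g).
  apply: nsq2_le => v; rewrite l20 sqn0 addr0 l2Z left_shiftE sqnM sqk.
  have le0 : 0 <= (`|p s| + 1) ^+ 2 * sqn (g v) + sqn (g (gen s * v)%g).
    by apply: addr_ge0; [apply: mulr_ge0; [exact: sqr_ge0|exact: sqn_ge0]|exact: sqn_ge0].
  rewrite /u l2B l2Z heckeE !finvecE// !mem_filter -/B -/B'.
  have inB w : w \in B' -> (gen s * w)%g \in B by move=> wB; exact: wball_gen.
  case: (boolP (v \in B)) => vB; case: (boolP (gen s * v \in B)%g) => svB.
  - suff -> : c (gen s * v)%g + (p s)%:C * (if desc s v then c v else 0) -
      (root_s s)%:C * c v = 0 by rewrite sqn0; move: le0; rewrite !finvecE// !mem_filter -/B -/B' vB svB.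
    case: ifP => dv; last by rewrite mulr0 addr0 /c root_w_gen ?dv// -rmorphM subrr.
    have cv : c v = (root_s s)%:C * c (gen s * v)%g.
      by rewrite /c -rmorphM -root_w_gen ?desc_flip ?dv// genK.
    rewrite cv mulrA mulrA -expr2 -rmorphXn root_sE -rmorphM rmorphD rmorph1 mulrDl mul1r.
    by rewrite subrr.
  - have vB' : v \notin B' by apply: contra svB; exact: inB.
    rewrite vB' !andbT /= andbF sqn0 addr0 add0r.
    have -> : (p s)%:C * (if desc s v then c v else 0) - (root_s s)%:C * c v =
       ((if desc s v then p s else 0) - root_s s)%:C * c v.
      by rewrite rmorphB mulrBl; case: ifP => _; rewrite ?mulr0 ?rmorph0 ?mul0r.
    rewrite sqnM ler_wpM2r ?sqn_ge0// /sqn normcR lerXn2r// ?nnegrE ?addr_ge0//.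
    apply: le_trans (ler_normB _ _) _; apply: lerD => //.
    by case: ifP => _; rewrite ?normr0.
  - have svB' : (gen s * v)%g \notin B'.
      by apply: contra vB => /inB; rewrite genK.
    rewrite svB' /= andbF !mulr0 sqn0 mulr0 add0r.
    by case: ifP => _; rewrite ?mulr0 subr0 addr0.
  - by rewrite !andbF !mulr0; case: ifP => _; rewrite ?mulr0 subr0 addr0 sqn0 mulr0 addr0.
move: key; rewrite nsq0 addr0 nsqZ left_shift_nsq sqk -[X in _ + X]mul1r -mulrDl => key.
rewrite -(ler_pXn2r (n := 2))// ?nnegrE ?mulr_ge0 ?l2_norm_ge0 ?(ltW e0)//.
rewrite exprMn !l2_normE; apply: le_trans key _.
apply: le_trans (_ : K * nsq g <= _); first by rewrite ler_wpM2r// nsq_ge0.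
rewrite ng nf -ler_pdivlMl//; apply: le_trans thin _.
by rewrite mulrA [K^-1 * _]mulrC.
Qed.

(** [c] is the value at [a] of the limit of the vector states given by the
    approximate eigenvectors, in a form that makes its multiplicativity plain. *)
Definition eigval (a : op) (c : C) := forall e : R, 0 < e ->
  exists F d, 0 < d /\ forall f, eigvec F d f ->
    l2_norm (a f - c *: f) <= e * l2_norm f.

Lemma eigval_hecke s : eigval (T s) (root_s s)%:C.
Proof.
move=> e e0; exists [:: s], e; split=> // f [_ _ h]; apply: h.
by rewrite inE.
Qed.

Lemma eigval_id : eigval id 1.
Proof.
move=> e e0; exists [::], 1; split=> // f _.
by rewrite scale1r subrr l2_norm0 mulr_ge0 ?l2_norm_ge0// ltW.
Qed.

Lemma eigval2 a b ca cb (e : R) : eigval a ca -> eigval b cb -> 0 < e ->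
  exists F d, 0 < d /\ forall f, eigvec F d f ->
    l2_norm (a f - ca *: f) <= e * l2_norm f /\
    l2_norm (b f - cb *: f) <= e * l2_norm f.
Proof.
move=> ha hb e0; have [F [d [d0 hF]]] := ha e e0; have [G [d' [d'0 hG]]] := hb e e0.
exists (F ++ G), (Num.min d d'); split; first by rewrite lt_min d0.
move=> f fe; split; [apply: hF|apply: hG]; apply: eigvec_sub fe;
  by [move=> s sF; rewrite mem_cat sF ?orbT|rewrite ge_min lexx ?orbT].
Qed.

Lemma eigval_comb k a b ca cb :
  eigval a ca -> eigval b cb -> eigval (k *: a + b) (k * ca + cb).
Proof.
move=> ha hb e e0; have n0 : 0 < normc k + 1 by rewrite ltr_wpDl ?normc_ge0.
have [F [d [d0 h]]] := eigval2 ha hb (divr_gt0 e0 n0).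
exists F, d; split=> // f /h[h1 h2]; rewrite op_addE op_scaleE.
have -> : k *: a f + b f - (k * ca + cb) *: f =
   k *: (a f - ca *: f) + (b f - cb *: f).
  by rewrite scalerDl scalerBr scalerA opprD addrACA.
apply: le_trans (l2_normD _ _) _; rewrite l2_normZ.
have -> : e * l2_norm f = normc k * (e / (normc k + 1) * l2_norm f) +
    e / (normc k + 1) * l2_norm f by field; rewrite gt_eqF.
apply: lerD; last exact: h2.
by apply: ler_wpM2l; [exact: normc_ge0|exact: h1].
Qed.

Lemma eigval_comp a b ca cb : bounded_op a ->
  eigval a ca -> eigval b cb -> eigval (a \o b) (ca * cb).
Proof.
move=> ba ha hb e e0; have [M M0 hM] := bounded_bd ba.
have n0 : 0 < M + normc cb by rewrite ltr_pwDl ?normc_ge0.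
have [F [d [d0 h]]] := eigval2 ha hb (divr_gt0 e0 n0).
exists F, d; split=> // f /h[h1 h2] /=.
have -> : a (b f) - (ca * cb) *: f = a (b f - cb *: f) + cb *: (a f - ca *: f).
  rewrite (linB (bounded_lin ba)) (linZ (bounded_lin ba)) scalerBr scalerA.
  by rewrite addrA subrK mulrC.
apply: le_trans (l2_normD _ _) _; rewrite l2_normZ.
have -> : e * l2_norm f = M * (e / (M + normc cb) * l2_norm f) +
    normc cb * (e / (M + normc cb) * l2_norm f) by field; rewrite gt_eqF.
apply: lerD; last by apply: ler_wpM2l; [exact: normc_ge0|exact: h1].
apply: le_trans (hM _) _; apply: ler_wpM2l; [exact: ltW|exact: h2].
Qed.

Lemma eigval_poly x : op_poly (range T) x -> exists c, eigval x c.
Proof.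
elim=> [_ [s _ <-]||k a b _ [ca ha] _ [cb hb]|a b pa [ca ha] _ [cb hb]].
- by exists (root_s s)%:C; exact: eigval_hecke.
- by exists 1; exact: eigval_id.
- by exists (k * ca + cb); exact: eigval_comb.
- exists (ca * cb); apply: eigval_comp ha hb.
  by apply: (@A_bounded _ _ _ X q); exact: poly_A.
Qed.

Hypothesis sub : subexponential.

Lemma eigvec_pos F d f : eigvec F d f -> 0 < l2_norm f.
Proof.
case=> f0 _ _; rewrite lt_neqAle l2_norm_ge0 andbT eq_sym.
by apply: contra f0 => /eqP/l2_norm_eq0 ->.
Qed.

(** The eigenvectors of [exists_eigvec] make [eigval] a bounded relation, which
    yields uniqueness and the passage to norm limits. *)
Lemma eigval_bd a c M : opbd a M -> eigval a c -> normc c <= M.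
Proof.
move=> hM ha; rewrite -subr_le0; apply: (@small_le0 _ _ 1) => // e e0.
have [F [d [d0 h]]] := ha e e0; have [f fe] := exists_eigvec F sub d0.
have fp := eigvec_pos fe; rewrite mul1r lerBlDl -(ler_pM2r fp) -l2_normZ.
rewrite mulrDl -[c *: f](subKr (a f)); apply: le_trans (l2_normB _ _) _.
by apply: lerD; [exact: hM|exact: h].
Qed.

Lemma eigval_dist a b ca cb M : opbd (a - b) M -> eigval a ca -> eigval b cb ->
  normc (ca - cb) <= M.
Proof.
move=> hM ha hb; apply: eigval_bd hM _.
rewrite op_subN1 [ca - cb](_ : _ = (-1) * cb + ca); last by ring.
exact: eigval_comb.
Qed.

Lemma eigval_uniq a c c' : eigval a c -> eigval a c' -> c = c'.
Proof.
move=> h h'; apply/eqP; rewrite -subr_eq0; apply/eqP/normc_eq0/le_anti.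
rewrite normc_ge0 andbT; apply: eigval_dist h h' => f.
by rewrite op_subE subrr l2_norm0 mul0r.
Qed.

(** The values at the polynomials that approximate [a] are as close to each other
    as these polynomials, hence they have a limit. Real and imaginary parts are
    treated separately. *)
Lemma eigval_A a : A a -> exists c, eigval a c.
Proof.
move=> Aa.
pose P (pr : C -> R) (e x : R) := 0 < e /\ exists y c,
  [/\ op_poly (range T) y, opbd (a - y) e, eigval y c & x = pr c].
have lim (pr : C -> R) : (forall c c', `|pr c - pr c'| <= normc (c - c')) ->
    exists l, forall e x, P pr e x -> `|x - l| <= e.
  move=> prle; apply: approx_limit => [e e0|e x e' x'].
    have [y py hy] := A_dense Aa e0; have [c hc] := eigval_poly py.
    by exists (pr c); split=> //; exists y, c.
  move=> [_ [y [c [py hy hc ->]]]] [_ [y' [c' [py' hy' hc' ->]]]].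
  apply: le_trans (prle _ _) _; apply: eigval_dist hc hc'.
  exact: opbd_tri (opbd_subC hy) hy'.
have [|lr hr] := lim (fun c : C => complex.Re c).
  by move=> c c'; have := (ReIm_le_normc (c - c')).1; case: c c' => ? ? [].
have [|li hi] := lim (fun c : C => complex.Im c).
  by move=> c c'; have := (ReIm_le_normc (c - c')).2; case: c c' => ? ? [].
exists (lr +i* li) => e e0.
have e4 : 0 < e / 4 by rewrite divr_gt0.
have [y py hy] := A_dense Aa e4; have [c hc] := eigval_poly py.
have [F [d [d0 h]]] := hc _ e4; exists F, d; split=> // f /h hf.
have cl : normc (c - (lr +i* li)) <= e / 4 + e / 4.
  apply: le_trans (normc_le_ReIm _) _; apply: lerD.
    have := hr (e / 4) (complex.Re c); case: (c) hc => x x' hc /=; apply.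
    by split=> //; exists y, (x +i* x').
  have := hi (e / 4) (complex.Im c); case: (c) hc => x x' hc /=; apply.
  by split=> //; exists y, (x +i* x').
apply: le_trans (l2_norm_tri _ (y f) _) _.
have -> : e * l2_norm f = e / 4 * l2_norm f + (e / 4 * l2_norm f +
  (e / 4 + e / 4) * l2_norm f) by field.
apply: lerD; first exact: hy.
apply: le_trans (l2_norm_tri _ (c *: f) _) _; apply: lerD; first exact: hf.
rewrite -scalerBl l2_normZ; apply: ler_wpM2r; [exact: l2_norm_ge0|exact: cl].
Qed.

(** For an approximate unit eigenvector [f], both [c_a] and the conjugate of [c_b]
    are close to [<a f, f> = <f, b f>]. *)
Lemma eigval_adj a b ca cb : bounded_op a -> bounded_op b -> adj_mx a b ->
  eigval a ca -> eigval b cb -> cb = conjc ca.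
Proof.
move=> ba bb ab ha hb; apply/eqP; rewrite -subr_eq0; apply/eqP/normc_eq0/le_anti.
rewrite normc_ge0 andbT; apply: (@small_le0 _ _ 2) => // e e0.
have [F [d [d0 h]]] := eigval2 ha hb e0; have [f fe] := exists_eigvec F sub d0.
have fp := eigvec_pos fe; have [h1 h2] := h _ fe.
case: fe => _ [B uB fB] _.
have sqf : \sum_(w <- B) f w * conjc (f w) = (nsq f)%:C.
  by rewrite [in RHS]fB trunc_nsq// rmorph_sum; apply: eq_bigr => w _; rewrite sqn_conj.
have dotE (g : H) (c : C) : \sum_(w <- B) (g - c *: f) w * conjc (f w) =
    \sum_(w <- B) g w * conjc (f w) - c * (nsq f)%:C.
  rewrite -sqf mulr_sumr -sumrB; apply: eq_bigr => w _.
  by rewrite l2B l2Z mulrBl mulrA.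
have adj : \sum_(w <- B) a f w * conjc (f w) = conjc (\sum_(w <- B) b f w * conjc (f w)).
  rewrite {1}fB (adj_mx_dot _ _ _ _ (bounded_lin ba) (bounded_lin bb) ab) -fB.
  rewrite rmorph_sum; apply: eq_bigr => w _; rewrite rmorphM /= conjcK.
  exact: mulrC.
have d1 := dot_le (a f - ca *: f) f uB; have d2 := dot_le (b f - cb *: f) f uB.
rewrite -(ler_pM2r (exprn_gt0 2 fp)) l2_normE.
have -> : normc (cb - conjc ca) * nsq f = normc ((cb - conjc ca) * (nsq f)%:C).
  by rewrite normcM normcR ger0_norm ?nsq_ge0.
have -> : (cb - conjc ca) * (nsq f)%:C =
   conjc (\sum_(w <- B) (a f - ca *: f) w * conjc (f w)) -
   \sum_(w <- B) (b f - cb *: f) w * conjc (f w).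
  have cB (x y : C) : conjc (x - y) = conjc x - conjc y by exact: rmorphB.
  have cM (x : C) (r : R) : conjc (x * r%:C) = conjc x * r%:C.
    by rewrite rmorphM; congr (_ * _); exact: conjc_real.
  by rewrite !dotE adj cB cM conjcK; ring.
apply: le_trans (normcD _ _) _; rewrite normcN normc_conj -l2_normE.
have -> : 2 * e * l2_norm f ^+ 2 = e * l2_norm f * l2_norm f + e * l2_norm f * l2_norm f.
  by ring.
have f0 := ltW fp.
have b1 := le_trans d1 (ler_wpM2r f0 h1).
have b2 := le_trans d2 (ler_wpM2r f0 h2).
apply: lerD.
  exact: b1.
exact: b2.
Qed.

(** Subexponential growth makes the one-dimensional representation [root_s]
    continuous for the operator norm. *)
Theorem subexponential_not_simple (s0 : S) :
  ~ cstar_simple A /\ ~ unique_tracial_state A.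
Proof.
pose chi a := xget 0 [set c | eigval a c].
have chiP a : A a -> eigval a (chi a).
  by move=> /eigval_A[c hc]; rewrite /chi; apply: (xgetPex 0); exists c.
apply: (@character_not_simple _ _ _ X q qconj chi).
- move=> k a b Aa Ab; apply: (@eigval_uniq (k *: a + b)).
    by apply: chiP; exact: A_comb.
  by apply: eigval_comb; exact: chiP.
- move=> a b Aa Ab; apply: (@eigval_uniq (a \o b)).
    by apply: chiP; exact: A_comp.
  by apply: eigval_comp; [exact: (A_bounded Aa)|exact: chiP|exact: chiP].
- by have h := chiP _ (@A_id _ _ _ X q); exact: (eigval_uniq h eigval_id).
- move=> a b Aa Ab ab; have ba := A_bounded Aa; have bb := A_bounded Ab.
  have -> : chi (b \o a) = chi b * chi a.
    apply: (@eigval_uniq (b \o a)); first by apply: chiP; exact: A_comp.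
    by apply: eigval_comp => //; exact: chiP.
  rewrite (eigval_adj ba bb ab (chiP _ Aa) (chiP _ Ab)) mulrC -sqr_normc.
  by rewrite exprn_ge0.
- by move=> a M Aa hM; apply: eigval_bd hM (chiP _ Aa).
- exists s0; rewrite (eigval_uniq (chiP _ (@hecke_A _ _ _ X q s0)) (eigval_hecke s0)).
  by apply: contra (root_s_neq0 s0) => /eqP[->].
Qed.

End Character.

(** * Subexponential growth *)

Section VirtuallyAbelian.
Variable W : groupType.
Local Open Scope group_scope.

Fixpoint power_products (Y : seq W) (N : nat) : seq W :=
  if Y is y :: Y' then
    [seq y ^+ i * z | i <- iota 0 N.+1, z <- power_products Y' N]
  else [:: 1].

Lemma power_productsE y Y N : power_products (y :: Y) N =
  [seq y ^+ i * z | i <- iota 0 N.+1, z <- power_products Y N].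
Proof. by []. Qed.

Lemma mem_power_products y Y N w : reflect
  (exists i z, [/\ (i <= N)%N, z \in power_products Y N & w = y ^+ i * z])
  (w \in power_products (y :: Y) N).
Proof.
rewrite power_productsE; apply: (iffP allpairsP).
  by case=> -[i z] [iN zY ->]; exists i, z; split => //; move: iN; rewrite mem_iota.
by case=> i [z [iN zY ->]]; exists (i, z); split => //; rewrite mem_iota.
Qed.

Lemma size_power_products Y N : size (power_products Y N) = (N.+1 ^ size Y)%N.
Proof.
elim: Y => [//|y Y IH].
by rewrite power_productsE size_allpairs size_iota IH expnS.
Qed.

Lemma power_productsS Y N : {subset power_products Y N <= power_products Y N.+1}.
Proof.
elim: Y => [//|y Y IH] w /mem_power_products[i [z [iN zY ->]]].
by apply/mem_power_products; exists i, z; split; [exact: leqW|exact: IH|].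
Qed.

Lemma power_products1 Y N : 1 \in power_products Y N.
Proof.
elim: Y => [|y Y IH]; first by rewrite inE.
by apply/mem_power_products; exists 0%N, 1; split => //; rewrite mulg1.
Qed.

Lemma power_products_mul Y N h z :
  (forall x y, x \in Y -> y \in Y -> commute x y) ->
  h \in Y -> z \in power_products Y N -> h * z \in power_products Y N.+1.
Proof.
elim: Y h z => [//|y Y IH] h z comm hY /mem_power_products[i [u [iN uY ->]]].
apply/mem_power_products; move: hY; rewrite inE => /orP[/eqP ->|hY].
  by exists i.+1, u; split => //; [exact: power_productsS|rewrite expgS mulgA].
exists i, (h * u); split.
- exact: leqW.
- by apply: IH => // a b aY bY; apply: comm; rewrite inE ?aY ?bY orbT.
- rewrite !mulgA; congr (_ * _); apply: commuteX; apply: comm.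
    by rewrite inE hY orbT.
  by rewrite inE eqxx.
Qed.

End VirtuallyAbelian.
Arguments power_products : simpl never.

Section Growth.
Variables (R : realType) (W : groupType) (S : choiceType).
Variables (X : coxeterSystem W S) (q : S -> R).
Hypothesis qX : multi_parameter X q.
Local Notation gen := (cox_gen X).
Implicit Types (F : seq S) (w : W).

Lemma growth_card F n : growth X q F n <= (size (wball X F n))%:R.
Proof.
rewrite /growth -sum1_size natr_sum; apply: ler_sum => w _; exact: root_w_le1.
Qed.

Lemma card_subexponential : (forall F, exists k d, forall n,
  (size (wball X F n) <= k * n.+2 ^ d)%N) -> subexponential X q.
Proof.
move=> h F rho rho1; have [k [d hk]] := h F.
have [M M0 hM] := poly_subexp d rho1.
exists (k%:R * M) => n; apply: le_trans (growth_card F n) _.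
apply: le_trans (_ : (k * n.+2 ^ d)%:R <= _); first by rewrite ler_nat.
by rewrite natrM natrX -mulrA ler_wpM2l.
Qed.

(** All the balls lie in the finite subgroup generated by [F]. *)
Lemma spherical_subexponential : spherical_type W -> subexponential X q.
Proof.
move=> lf; apply: card_subexponential => F.
have /lf/finite_seqP[s hs] : finite_set [set` map gen F] by exact: finite_seq.
exists (size s), 0%N => n; rewrite expn0 muln1.
apply: uniq_leq_size (wball_uniq _ _ _) _ => w wB.
suff : [set` s] w by [].
rewrite -hs; elim/wball_ind: n w / wB => [|n w //|n t w tF Hw].
- by move=> K [[]].
- move=> K [Ksub KF]; have Kw := Hw K (conj Ksub KF).
  have Kt : K (gen t) by apply: KF => /=; apply: map_f.
  case: Ksub => K1 KV; have KV' : K w^-1%g by rewrite -[w^-1%g]mul1g; apply: KV.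
  by rewrite -[w]invgK; apply: KV.
Qed.

(** Rewriting a product of [n] generators through coset representatives of an
    abelian subgroup leaves a product of [n] elements of a fixed finite subset
    of that subgroup. *)
Lemma virtually_abelian_subexponential :
  virtually_abelian W -> subexponential X q.
Proof.
move=> [H [[H1 HV] Hcomm /finite_seqP[cs hcs]]]; apply: card_subexponential => F.
pose coset w : set W := [set (w * h)%g | h in H].
pose rep w : W := xget 1%g (coset w).
have repP w : exists2 h, H h & rep w = (w * h)%g.
  have : coset w (rep w).
    by apply: (xgetPex 1%g); exists (w * 1)%g, 1%g.
  by case=> h Hh <-; exists h.
pose reps := [seq xget 1%g C | C <- cs].
have rep_in w : rep w \in reps.
  apply: map_f; suff : [set` cs] (coset w) by [].
  by rewrite -hcs; exists w.
pose dev w := ((rep w)^-1 * w)%g.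
have Hdev w : H (dev w).
  rewrite /dev; have [h Hh ->] := repP w; rewrite invgM mulgVK.
  by rewrite -[h^-1%g]mul1g; apply: HV.
pose Y := dev 1%g :: [seq dev (gen s * t)%g | s <- F, t <- reps].
have HY y : y \in Y -> H y.
  by rewrite inE => /orP[/eqP ->//|/allpairsP[? [_ _ ->]]].
have Ycomm x y : x \in Y -> y \in Y -> commute x y.
  by move=> /HY Hx /HY Hy; apply: Hcomm.
exists (size reps), (size Y) => n.
have -> : (size reps * n.+2 ^ size Y)%N =
    size [seq (t * z)%g | t <- reps, z <- power_products Y n.+1].
  by rewrite size_allpairs size_power_products.
apply: uniq_leq_size (wball_uniq _ _ _) _ => w wB.
elim/wball_ind: n w / wB => [|n w|n s w sF].
- apply/allpairsP; exists (rep 1%g, dev 1%g); split => //=; last first.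
    by rewrite /dev mulVKg.
  rewrite -[dev 1%g]mulg1; apply: power_products_mul => //.
    by rewrite inE eqxx.
  exact: power_products1.
- move=> /allpairsP[[t z] /= [tr zY ->]]; apply/allpairsP; exists (t, z).
  by split => //; exact: power_productsS.
- move=> /allpairsP[[t z] /= [tr zY ->]]; apply/allpairsP.
  exists (rep (gen s * t)%g, (dev (gen s * t) * z)%g); split => //=.
    apply: power_products_mul => //; rewrite inE; apply/orP; right.
    by apply/allpairsP; exists (s, t).
  by rewrite /dev !mulgA mulgV mul1g.
Qed.

Lemma affine_subexponential : affine_type W -> subexponential X q.
Proof. by case=> _ _; exact: virtually_abelian_subexponential. Qed.

End Growth.

(** * The closure of the region of convergence *)

(** A convergent net of finite partial sums of complex numbers is absolutely
    summable: far out in the net, the terms whose real (or imaginary) part has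
    a given sign have bounded sums. *)
Lemma partial_sums_bounded (R : realType) (I : choiceType) (u : I -> R[i]^o) :
  cvg (summability.partial_sum u @ summability.totally) ->
  exists M : R, forall B : seq I, uniq B -> \sum_(i <- B) normc (u i) <= M.
Proof.
move=> cu; set l := lim _ in cu.
have tF := @summability.totally_filter I.
have : \forall A \near @summability.totally I,
    `|l - summability.partial_sum u A| < 1 :> R[i].
  by have /cvgrPdist_lt/(_ 1 ltr01) := cu.
move=> [A0 _ hA0].
have sumE (A : {fset I}) : summability.partial_sum u A = \sum_(i <- enum_fset A) u i.
  by rewrite /summability.partial_sum big_seq_fsetE.
have tail (B : seq I) : uniq B -> {in B, forall i, i \notin A0} ->
    normc (\sum_(i <- B) u i) <= 2.
  move=> uB dB.
  have h0 := hA0 A0 (fsubset_refl _).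
  have h1 := hA0 (A0 `|` [fset i in B])%fset (fsubsetUl _ _).
  have e : summability.partial_sum u (A0 `|` [fset i in B])%fset =
     summability.partial_sum u A0 + \sum_(i <- B) u i.
    rewrite !sumE -big_cat; apply: perm_big; apply: uniq_perm.
    - exact: fset_uniq.
    - rewrite cat_uniq fset_uniq uB andbT /=; apply/hasPn => i /dB.
      by [].
    - by move=> i; rewrite mem_cat !inE.
  move: h0 h1; rewrite /= e; set a := summability.partial_sum u A0 => h0 h1.
  have nE (z : R[i]) (r : R) : `|z| < r%:C -> normc z < r by rewrite ltcR.
  have g0 := nE _ 1 h0; have g1 := nE _ 1 h1.
  set t := \sum_(i <- B) u i in g1 *.
  have -> : t = (l - a) - (l - (a + t)) by ring.
  apply: le_trans (normcD _ _) _; rewrite normcN; move: g0 g1; lra.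
have part (v : I -> R) : (forall B, `|\sum_(i <- B) v i| <= normc (\sum_(i <- B) u i)) ->
    forall B : seq I, uniq B -> {in B, forall i, i \notin A0} ->
    \sum_(i <- B) `|v i| <= 4.
  move=> vu B uB dB; rewrite (bigID (fun i => 0 <= v i)) /=.
  have sub (P : pred I) : `|\sum_(i <- B | P i) v i| <= 2.
    rewrite -big_filter; apply: le_trans (vu _) _; apply: tail.
      exact: filter_uniq.
    by move=> i; rewrite mem_filter => /andP[_ /dB].
  have -> : (4 : R) = 2 + 2 by ring.
  apply: lerD.
    rewrite (eq_bigr v) => [|i /ger0_norm //].
    by apply: le_trans (ler_norm _) _; exact: sub.
  rewrite (eq_bigr (fun i => - v i)) => [|i]; last first.
    by rewrite -ltNge => /ltr0_norm.
  by rewrite sumrN; apply: le_trans (ler_norm _) _; rewrite normrN; exact: sub.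
have re_sum B : complex.Re (\sum_(i <- B) (u i : R[i])) = \sum_(i <- B) complex.Re (u i : R[i]).
  by rewrite raddf_sum.
have im_sum B : complex.Im (\sum_(i <- B) (u i : R[i])) = \sum_(i <- B) complex.Im (u i : R[i]).
  by rewrite raddf_sum.
have hre := part (fun i => complex.Re (u i : R[i])).
have him := part (fun i => complex.Im (u i : R[i])).
exists (\sum_(i <- enum_fset A0) normc (u i) + 8) => B uB.
rewrite [leLHS](bigID (fun i => i \in A0)) /=.
rewrite -[X in X + _ <= _]big_filter -[X in _ + X <= _]big_filter; apply: lerD.
  have sub : {subset [seq i <- B | i \in A0] <= enum_fset A0}.
    by move=> i; rewrite mem_filter => /andP[].
  apply: sumr_sub; [exact: filter_uniq|exact: fset_uniq|exact: sub|].
  by move=> i; exact: normc_ge0.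
set B1 := [seq i <- B | _].
apply: le_trans (_ : \sum_(i <- B1) (`|complex.Re (u i : R[i])| +
    `|complex.Im (u i : R[i])|) <= _).
  by apply: ler_sum => i _; exact: normc_le_ReIm.
rewrite big_split /= (_ : 8 = 4 + 4 :> R); last by ring.
have uB1 : uniq B1 by rewrite filter_uniq.
have dB1 : {in B1, forall i, i \notin A0}.
  by move=> i; rewrite mem_filter => /andP[].
apply: lerD; [apply: hre|apply: him] => // B'.
- by rewrite -re_sum; have [+ _] := ReIm_le_normc (\sum_(i <- B') (u i : R[i])).
- by rewrite -im_sum; have [_] := ReIm_le_normc (\sum_(i <- B') (u i : R[i])).
Qed.

Section Region.
Variables (R : realType) (W : groupType) (S : choiceType).
Variables (X : coxeterSystem W S) (q : S -> R).
Hypothesis qX : multi_parameter X q.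

Lemma flip_parameterE s : flip_parameter q s = (root_s q s ^+ 2)%:C.
Proof.
have q0 : 0 < q s by case: qX.
by rewrite /flip_parameter (root_s_sqr qX); case: ifP.
Qed.

(** Take a point of convergence [z] so close to the flipped parameter that
    [|z_s| >= root_s^2 / rho] for all [s]. On the ball of radius [n] this gives
    [root_w^2 <= rho^n |z_w|], and the sums of the [|z_w|] are bounded. *)
Lemma closure_subexponential : finite_set [set: S] ->
  closure (convergence_region X R) (flip_parameter q) -> subexponential X q.
Proof.
move=> finS clq F rho rho1.
have rho0 : 0 < rho by rewrite (lt_trans ltr01).
have r1 : 0 < 1 - rho^-1 by rewrite subr_gt0 invf_lt1.
have [es hes] : exists es : seq S, forall s, s \in es.
  have [es e] := (finite_seqP _).1 finS; exists es => s.
  by suff : [set` es] s by []; rewrite -e.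
pose near_s s : set {ptws S -> R[i]^o} :=
  [set z | normc (flip_parameter q s - z s) < (1 - rho^-1) * root_s q s ^+ 2].
have nb : nbhs (flip_parameter q : {ptws S -> R[i]^o})
    [set z : {ptws S -> R[i]^o} | forall s, s \in es -> near_s s z].
  elim: es {hes} => [|s es IH]; first by apply: filterS filterT.
  have ns : nbhs (flip_parameter q : {ptws S -> R[i]^o}) (near_s s).
    have cs : continuous (fun z : {ptws S -> R[i]^o} => z s).
      exact: (@proj_continuous S (fun=> R[i]^o) s).
    have e0 : (0 : R[i]) < ((1 - rho^-1) * root_s q s ^+ 2)%:C.
      by rewrite ltcR mulr_gt0// lt_neqAle eq_sym sqrf_eq0 (root_s_neq0 qX) sqr_ge0.
    have hb : nbhs (flip_parameter q s : R[i]^o) [set y : R[i]^o |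
        normc (flip_parameter q s - y) < (1 - rho^-1) * root_s q s ^+ 2].
      have := nbhsx_ballx (flip_parameter q s : R[i]^o) _ e0.
      by apply: filterS => y; rewrite -ball_normE /= => h; rewrite -ltcR.
    exact: (cs (flip_parameter q) _ hb).
  apply: filterS2 ns IH => z zs zes t; rewrite inE => /orP[/eqP ->//|].
  exact: zes.
have [z [[_ cz] hz]] := clq _ nb.
have [M hM] := partial_sums_bounded cz.
have zge s : rho^-1 * root_s q s ^+ 2 <= normc (z s).
  have := hz s (hes s); rewrite /near_s /= flip_parameterE => h.
  have := le_lt_trans (normcB _ _) h; rewrite normcR ger0_norm ?sqr_ge0//.
  by rewrite mulrBl mul1r; move: (rho^-1 * _) => y; lra.
exists M => n; rewrite mulrC -ler_pdivrMl ?exprn_gt0// mulr_sumr.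
apply: le_trans (hM _ (wball_uniq X F n)).
rewrite !big_seq; apply: ler_sum => w wB.
have len_n := wball_len_le wB.
rewrite /weight -/(rword X w) root_w_sqr.
apply: le_trans (_ : \prod_(s <- rword X w) (rho^-1 * root_s q s ^+ 2) <= _).
  have -> : \prod_(s <- rword X w) (rho^-1 * root_s q s ^+ 2) =
      rho^-1 ^+ word_length X w * \prod_(s <- rword X w) root_s q s ^+ 2.
    rewrite big_split /=; congr (_ * _).
    by rewrite big_const_seq count_predT size_rword iter_mulr_1.
  apply: ler_wpM2r; first by apply: prodr_ge0 => s _; exact: sqr_ge0.
  by rewrite exprVn lef_pV2 ?posrE ?exprn_gt0// ler_eXn2l.
elim: (rword X w) => [|s l IH]; first by rewrite !big_nil ComplexField.Normc.normc1.
rewrite !big_cons normcM; apply: ler_pM => //.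
  by rewrite mulr_ge0 ?sqr_ge0// invr_ge0 ltW.
by apply: prodr_ge0 => t _; rewrite mulr_ge0 ?sqr_ge0// invr_ge0 ltW.
Qed.

End Region.

(** * A Haagerup inequality *)

Section CountingSums.
Variable R : realType.

Lemma sum_fiber (I J : eqType) (L : seq I) (phi : I -> J) (h : J -> R)
    (F : seq J) n : (forall j, 0 <= h j) -> uniq F ->
  (forall i, i \in L -> phi i \notin F -> h (phi i) = 0) ->
  (forall j, (size [seq i <- L | phi i == j] <= n)%N) ->
  \sum_(i <- L) h (phi i) <= n%:R * \sum_(j <- F) h j.
Proof.
move=> h0 uF hF hn; apply: le_trans (_ : \sum_(i <- L) \sum_(j <- F)
    (if phi i == j then h j else 0) <= _).
  rewrite !big_seq; apply: ler_sum => i iL.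
  have [iF|/hF -> //] := boolP (phi i \in F); last first.
    by apply: sumr_ge0 => j _; case: ifP.
  rewrite (bigD1_seq (phi i))//= eqxx lerDl.
  by apply: sumr_ge0 => j _; case: ifP.
rewrite exchange_big mulr_sumr /=; apply: ler_sum => j _.
rewrite -big_mkcond -big_filter big_const_seq count_predT iter_addr_0 mulr_natl.
exact: ler_wpMn2l.
Qed.

Lemma size_fibers (I J : eqType) (L : seq (I * J)) n m : uniq L ->
  (forall K, uniq K -> {subset K <= map fst L} -> (size K <= n)%N) ->
  (forall i K, uniq K -> (forall j, j \in K -> (i, j) \in L) -> (size K <= m)%N) ->
  (size L <= m * n)%N.
Proof.
move=> uL hn hm; pose F := undup (map fst L).
have := @sum_fiber _ _ L fst (fun=> 1) F m.
rewrite !big_const_seq !count_predT !iter_addr_0 -natrM ler_nat => le.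
apply: leq_trans (le _ _ _ _) _ => //; first exact: undup_uniq.
- by move=> i iL; rewrite mem_undup (map_f fst iL).
- move=> i; rewrite -(size_map snd); apply: (hm i).
    rewrite map_inj_in_uniq ?filter_uniq// => -[a b] [a' b'].
    by rewrite !mem_filter /= => /andP[/eqP -> _] /andP[/eqP -> _] ->.
  by move=> j /mapP[[a b]]; rewrite mem_filter /= => /andP[/eqP <- ab] ->.
- rewrite leq_mul2l hn ?orbT ?undup_uniq// => i; rewrite mem_undup//.
Qed.

Lemma uniq_pairs (I J : eqType) (LI : seq I) (LJ : seq J) : uniq LI -> uniq LJ ->
  uniq [seq (i, j) | i <- LI, j <- LJ].
Proof. by move=> uI uJ; apply: allpairs_uniq => // -[? ?] [? ?] _ _ [-> ->]. Qed.

(** The sum is the trace of [P Q Z^T], a product of Hilbert-Schmidt matrices: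
    apply the Cauchy-Schwarz inequality to the pairs [(i, k)] and then to each
    sum over [j]. *)
Lemma hilbert_schmidt (I J K : Type) (LI : seq I) (LJ : seq J) (LK : seq K)
    (P : I -> J -> R) (Q : J -> K -> R) (Z : I -> K -> R) :
  (\sum_(i <- LI) \sum_(k <- LK) \sum_(j <- LJ) P i j * Q j k * Z i k) ^+ 2 <=
  (\sum_(i <- LI) \sum_(j <- LJ) P i j ^+ 2) *
  (\sum_(j <- LJ) \sum_(k <- LK) Q j k ^+ 2) *
  (\sum_(i <- LI) \sum_(k <- LK) Z i k ^+ 2).
Proof.
pose V i k := \sum_(j <- LJ) P i j * Q j k.
pose L := [seq (i, k) | i <- LI, k <- LK].
have e1 : \sum_(i <- LI) \sum_(k <- LK) \sum_(j <- LJ) P i j * Q j k * Z i k =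
    \sum_(x <- L) V x.1 x.2 * Z x.1 x.2.
  rewrite /L big_allpairs_dep /=; apply: eq_bigr => i _; apply: eq_bigr => k _.
  by rewrite /V mulr_suml.
have e2 : \sum_(i <- LI) \sum_(k <- LK) Z i k ^+ 2 = \sum_(x <- L) Z x.1 x.2 ^+ 2.
  by rewrite /L big_allpairs_dep.
rewrite e1 e2; apply: le_trans (cauchy_schwarz_seq _ _ _) _.
rewrite ler_wpM2r//; first by apply: sumr_ge0 => x _; exact: sqr_ge0.
rewrite /L big_allpairs_dep /= mulr_suml; apply: ler_sum => i _.
rewrite [X in _ <= _ * X]exchange_big mulr_sumr /=; apply: ler_sum => k _.
exact: cauchy_schwarz_seq.
Qed.

End CountingSums.

Section Haagerup.
Variables (R : realType) (W : groupType) (S : choiceType).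
Variables (X : coxeterSystem W S) (q : S -> R) (es : seq S).
Hypothesis raX : right_angled X.
Hypothesis es_full : forall s, s \in es.
Hypothesis p_le1 : forall s, `|hecke_p q s| <= 1.
Local Notation C := R[i].
Local Notation H := (l2 R W).
Local Notation op := (H -> H).
Local Notation delta := (@l2_delta R W).
Local Notation gen := (cox_gen X).
Local Notation len := (word_length X).
Local Notation desc := (left_descent X).
Local Notation T := (hecke_op X q).
Implicit Types (s t : S) (v w y : W) (k : nat).

Definition tword (l : seq S) : op := foldr (fun s a => T s \o a) id l.
Definition tw v : op := tword (rword X v).

Lemma tword_poly l : op_poly (range T) (tword l).
Proof. by elim: l => [|s l IH]; [exact: OpId|apply: OpComp IH; exact: hecke_poly]. Qed.

Lemma tword_delta l : size l = len (word_prod X l) ->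
  tword l (delta 1%g) = delta (word_prod X l).
Proof.
elim: l => [|s l IH] red; first by rewrite word_prod_nil.
have [redl ns] := reduced_cons red.
by rewrite -[LHS]/(T s (tword l (delta 1%g))) IH// hecke_delta_asc// word_prod_cons.
Qed.

Lemma rword_reduced v : size (rword X v) = len (word_prod X (rword X v)).
Proof. by rewrite rwordK size_rword. Qed.

Lemma tw_delta v : tw v (delta 1%g) = delta v.
Proof. by rewrite /tw tword_delta ?rword_reduced// rwordK. Qed.

(** Each letter either moves a term or multiplies it by some [p_s], of modulus at
    most 1. *)
Lemma tword_coef l w y : size l = len (word_prod X l) ->
  normc (tword l (delta w) y) <= \sum_(m <- terms X l w) (term_val m == y)%:R.
Proof.
elim: l y => [|s l IH] y red.
  rewrite big_seq1 [term_val _](_ : _ = w); last by rewrite /term_val /= mulgV mul1g.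
  rewrite -[tword [::] (delta w)]/(delta w).
  have [->|ne] := pselect (w = y).
    by rewrite l2_delta_id eqxx ComplexField.Normc.normc1.
  by rewrite l2_delta_ne// ComplexField.Normc.normc0.
have [redl ns] := reduced_cons red.
rewrite -[X in normc X]/(T s (tword l (delta w)) y) heckeE.
rewrite -[terms X (s :: l) w]/(flatten [seq term_step X s m | m <- terms X l w]).
rewrite big_flatten big_map.
apply: le_trans (normcD _ _) _.
apply: le_trans (_ : normc (tword l (delta w) (gen s * y)%g) +
   (if desc s y then normc (tword l (delta w) y) else 0) <= _).
  rewrite lerD2l normcM normcR; case: ifP => _.
    by rewrite ler_piMl ?normc_ge0.
  by rewrite ComplexField.Normc.normc0 mulr0.
apply: le_trans (_ : \sum_(m <- terms X l w) ((term_val m == gen s * y)%g%:R +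
    (if desc s y then (term_val m == y)%:R else 0)) <= _).
  rewrite big_split; apply: lerD; first exact: IH.
  case: ifP => _; first exact: IH.
  by rewrite big1.
rewrite [leLHS]big_seq [leRHS]big_seq; apply: ler_sum => m /(terms_ok raX redl) ok.
rewrite -(big_map (@term_val W) xpredT (fun z => (z == y)%:R)).
rewrite (term_step_val raX ns ok).
have e : (gen s * term_val m == y)%g = (term_val m == gen s * y)%g by rewrite gen_move.
case: (boolP (desc s (term_val m))) => d.
  rewrite big_cons big_seq1 e lerD2l; case: ifP => // dy.
by rewrite big_seq1 e gerDl; case: ifP => // dy; case: eqP d => // ->; rewrite dy.
Qed.

Section Bound.
Variables (k : nat) (g : W -> C).
Let B := wball X es k.
Let M : R := (prefix_bound es k)%:R.

Definition hecke_sum : op := \sum_(v <- B) g v *: tw v.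

Lemma hecke_sum_poly : op_poly (range T) hecke_sum.
Proof. by apply: poly_sum => v; apply: polyZ; exact: tword_poly. Qed.

Lemma hecke_sum_delta : hecke_sum (delta 1%g) = finvec B g.
Proof.
rewrite /hecke_sum /finvec; elim: (B) => [|v L IH]; first by rewrite !big_nil.
by rewrite !big_cons op_addE IH op_scaleE tw_delta.
Qed.

Lemma hecke_sum_coef (G : seq W) (xi : H) y :
  normc (hecke_sum (trunc G xi) y) <= \sum_(v <- B) \sum_(w <- G)
    normc (g v) * normc (xi w) * \sum_(m <- terms X (rword X v) w) (term_val m == y)%:R.
Proof.
have lin : linear hecke_sum.
  by apply/bounded_lin/(poly_bounded (@hecke_bounded _ _ _ X q)); exact: hecke_sum_poly.
have coefE f z : hecke_sum f z = \sum_(v <- B) g v * tw v f z.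
  rewrite /hecke_sum; elim: (B) => [|v L IH]; first by rewrite !big_nil.
  by rewrite !big_cons op_addE l2D IH op_scaleE l2Z.
rewrite coefE; apply: le_trans (normc_sum _ _) _; apply: ler_sum => v _.
have linv : linear (tw v).
  by apply/bounded_lin/(poly_bounded (@hecke_bounded _ _ _ X q)); exact: tword_poly.
rewrite normcM lin_trunc//; apply: le_trans (_ : normc (g v) *
  \sum_(w <- G) normc (xi w * tw v (delta w) y) <= _).
  by rewrite ler_wpM2l ?normc_ge0// normc_sum.
rewrite mulr_sumr; apply: ler_sum => w _; rewrite normcM -mulrA.
rewrite ler_wpM2l ?normc_ge0// ler_wpM2l ?normc_ge0//.
exact: tword_coef (rword_reduced v).
Qed.

Variables (G Y : seq W) (uG : uniq G) (uY : uniq Y).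
Variables (xi h : W -> R) (xi0 : forall w, 0 <= xi w) (h0 : forall y, 0 <= h y).

Let L := [seq (v, w) | v <- B, w <- G].
Let TT := flatten [seq terms X (rword X x.1) x.2 | x <- L].

Let uTT : uniq TT.
Proof.
apply: uniq_flatten_map.
- by rewrite uniq_pairs ?wball_uniq.
- by move=> x _; apply: terms_uniq => //; exact: rword_reduced.
- move=> [v w] [v' w'] m _ _ /= /(terms_ok raX (rword_reduced _)) ok.
  move=> /(terms_ok raX (rword_reduced _)) ok'.
  move: ok ok'; rewrite !rwordK; case: m => [[a c] [u b]].
  by move=> [[-> _] _ [-> _] _] [[-> _] _ [-> _] _].
Qed.

Let gB v : R := if v \in B then normc (g v) else 0.
Let xiG w : R := if w \in G then xi w else 0.
Let hY y : R := if y \in Y then h y else 0.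

Let gB0 v : 0 <= gB v. Proof. by rewrite /gB; case: ifP => // _; exact: normc_ge0. Qed.
Let xiG0 w : 0 <= xiG w. Proof. by rewrite /xiG; case: ifP. Qed.
Let hY0 y : 0 <= hY y. Proof. by rewrite /hY; case: ifP. Qed.

(** [condP], [condQ] and [condZ] are what remains of [term_ok] when one of the
    entries [b], [(a, c)], [u] is forgotten. *)
Let condP (i : W * W) u := (len (i.1 * u)%g == len i.1 + len u)%N &&
  (len i.1 == len (i.1 * i.2^-1)%g + len i.2)%N && (len (i.1 * u)%g <= k)%N.
Let condQ u b := (len (u^-1 * b)%g == len u + len b)%N && (len u <= k)%N.
Let condZ (i : W * W) b :=
  (len (i.1 * i.2^-1 * b)%g == len i.1 + len (i.2^-1 * b)%g)%N &&
  (len i.1 == len (i.1 * i.2^-1)%g + len i.2)%N && (len i.1 <= k)%N.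

Let P i u := if condP i u then gB (i.1 * u)%g else 0.
Let Q u b := if condQ u b then xiG (u^-1 * b)%g else 0.
Let Z (i : W * W) b := if condZ i b then hY (i.1 * i.2^-1 * b)%g else 0.

(** The pairs [(a, c)] with [a] a prefix of [v] and [c] a suffix of [a]: the first
    entry and then the second can be chosen in [prefix_bound] ways. *)
Let suffix_pairs v (K : seq (W * W)) : uniq K ->
  (forall i, i \in K -> [/\ reduced_prefix X i.1 v, (len i.1 <= k)%N &
     len i.1 = (len (i.1 * i.2^-1)%g + len i.2)%N]) ->
  (size K <= prefix_bound es k * prefix_bound es k)%N.
Proof.
move=> uK hK; apply: size_fibers => // [K' uK' sub|a K' uK' sub].
  apply: (card_prefixes raX es_full (v := v) uK') => a /sub/mapP[i iK ->].
  by have [? ? _] := hK _ iK.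
have [->//|/hasP[c cK _]] : K' = [::] \/ has predT K'.
  by case: (K') => [|? ?]; [left|right].
have [_ /= la _] := hK _ (sub _ cK).
by apply: (card_suffixes raX es_full uK' la) => d /sub/hK[].
Qed.

Let sum_cond (I J : eqType) (LI : seq I) (LJ : seq J) (c : I -> J -> bool)
    (phi : I -> J -> W) (f : W -> R) (F : seq W) n :
  uniq LI -> uniq LJ -> uniq F -> (forall w, 0 <= f w) ->
  (forall w, w \notin F -> f w = 0) ->
  (forall w, (size [seq x <- [seq (i, j) | i <- LI, j <- LJ] |
      c x.1 x.2 && (phi x.1 x.2 == w)] <= n)%N) ->
  \sum_(i <- LI) \sum_(j <- LJ) (if c i j then f (phi i j) else 0) ^+ 2 <=
  n%:R * \sum_(w <- F) f w ^+ 2.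
Proof.
move=> uLI uLJ uF f0 fF hn.
have -> : \sum_(i <- LI) \sum_(j <- LJ) (if c i j then f (phi i j) else 0) ^+ 2 =
    \sum_(x <- [seq x <- [seq (i, j) | i <- LI, j <- LJ] | c x.1 x.2])
       f (phi x.1 x.2) ^+ 2.
  rewrite [RHS]big_filter [RHS]big_mkcond [RHS]big_allpairs_dep /=.
  by apply: eq_bigr => i _; apply: eq_bigr => j _; case: ifP; rewrite ?expr0n.
apply: (@sum_fiber _ _ _ _ (fun x => phi x.1 x.2) (fun w => f w ^+ 2)) => //.
- by move=> w; exact: sqr_ge0.
- by move=> x _ /fF ->; rewrite expr0n.
- move=> w; rewrite -filter_predI.
  apply: leq_trans (hn w); rewrite !size_filter; apply: eq_leq; apply: eq_count => x /=.
  by rewrite andbC.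
Qed.

Let LI := undup [seq m.1 | m <- TT].
Let LU := undup [seq m.2.1 | m <- TT].
Let LB := undup [seq m.2.2 | m <- TT].

Let sumP : \sum_(i <- LI) \sum_(u <- LU) P i u ^+ 2 <=
  M ^+ 2 * \sum_(v <- B) normc (g v) ^+ 2.
Proof.
have -> : \sum_(v <- B) normc (g v) ^+ 2 = \sum_(v <- B) gB v ^+ 2.
  by rewrite !big_seq; apply: eq_bigr => v vB; rewrite /gB vB.
rewrite expr2 -natrM; apply: sum_cond; rewrite ?undup_uniq ?wball_uniq//.
  by move=> w /negPf wB; rewrite /gB wB.
move=> v; rewrite -(size_map fst); apply: (suffix_pairs (v := v)).
  rewrite map_inj_in_uniq ?filter_uniq ?uniq_pairs ?undup_uniq//.
  move=> [i u] [i' u']; rewrite !mem_filter /= => /andP[/andP[_ /eqP <-] _].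
  by move=> /andP[/andP[_ /eqP e] _] ei; move: e; rewrite ei => /mulgI ->.
move=> _ /mapP[[i u] + ->]; rewrite mem_filter /= => /andP[/andP[]].
move=> /andP[/andP[/eqP h1 /eqP h2] h3] /eqP <- _; split=> //.
  by rewrite /reduced_prefix mulKg.
by rewrite (leq_trans _ h3)// h1 leq_addr.
Qed.

Let sumQ : \sum_(u <- LU) \sum_(b <- LB) Q u b ^+ 2 <=
  M * \sum_(w <- G) xi w ^+ 2.
Proof.
have -> : \sum_(w <- G) xi w ^+ 2 = \sum_(w <- G) xiG w ^+ 2.
  by rewrite !big_seq; apply: eq_bigr => v vB; rewrite /xiG vB.
apply: sum_cond; rewrite ?undup_uniq//.
  by move=> w /negPf wB; rewrite /xiG wB.
move=> w; rewrite -(size_map (fun x => x.1^-1%g)).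
apply: (card_prefixes raX es_full (v := w)).
  rewrite map_inj_in_uniq ?filter_uniq ?uniq_pairs ?undup_uniq//.
  move=> [u b] [u' b']; rewrite !mem_filter /= => /andP[/andP[_ /eqP <-] _].
  by move=> /andP[/andP[_ /eqP e] _] /invg_inj eu; move: e; rewrite eu => /mulgI ->.
move=> _ /mapP[[u b] + ->]; rewrite mem_filter /= => /andP[/andP[]].
move=> /andP[/eqP h1 h2] /eqP <- _; split; last by rewrite lenV.
by rewrite /reduced_prefix invgK mulVKg lenV.
Qed.

Let sumZ : \sum_(i <- LI) \sum_(b <- LB) Z i b ^+ 2 <=
  M ^+ 2 * \sum_(y <- Y) h y ^+ 2.
Proof.
have -> : \sum_(y <- Y) h y ^+ 2 = \sum_(y <- Y) hY y ^+ 2.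
  by rewrite !big_seq; apply: eq_bigr => v vB; rewrite /hY vB.
rewrite expr2 -natrM; apply: sum_cond; rewrite ?undup_uniq//.
  by move=> w /negPf wB; rewrite /hY wB.
move=> y; rewrite -(size_map fst); apply: (suffix_pairs (v := y)).
  rewrite map_inj_in_uniq ?filter_uniq ?uniq_pairs ?undup_uniq//.
  move=> [i b] [i' b']; rewrite !mem_filter /= => /andP[/andP[_ /eqP <-] _].
  by move=> /andP[/andP[_ /eqP e] _] ei; move: e; rewrite ei => /mulgI ->.
move=> _ /mapP[[i b] + ->]; rewrite mem_filter /= => /andP[/andP[]].
move=> /andP[/andP[/eqP h1 /eqP h2] h3] /eqP <- _; split=> //.
by rewrite /reduced_prefix h1 -mulgA mulKg.
Qed.

(** The terms are indexed without repetition by quadruples [((a, c), (u, b))], and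
    the three factors depend on [(a, c)] and [u], on [u] and [b], and on [(a, c)]
    and [b]. So the Hilbert-Schmidt bound applies, and each factor is controlled
    by the number of the factorizations of [v = a u], of [w = u^-1 b] and of
    [y = a c^-1 b]. *)
Lemma haagerup_trilinear :
  (\sum_(v <- B) \sum_(w <- G) normc (g v) * xi w *
     \sum_(m <- terms X (rword X v) w) hY (term_val m)) ^+ 2 <=
  M ^+ 5 * (\sum_(v <- B) normc (g v) ^+ 2) * (\sum_(w <- G) xi w ^+ 2) *
    (\sum_(y <- Y) h y ^+ 2).
Proof.
set lhs := \sum_(v <- B) _.
have e1 : lhs = \sum_(m <- TT) P m.1 m.2.1 * Q m.2.1 m.2.2 * Z m.1 m.2.2.
  rewrite /TT big_flatten big_map /L big_allpairs_dep /lhs /=.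
  rewrite !big_seq; apply: eq_bigr => v vB.
  rewrite !big_seq; apply: eq_bigr => w wG; rewrite mulr_sumr.
  rewrite !big_seq; apply: eq_bigr => m mt.
  have := terms_ok raX (rword_reduced v) mt; rewrite rwordK.
  case: m {mt} => [[a c] [u b]] [[ev rv] ra [ew rw] ry] /=.
  have lv : (len v <= k)%N by rewrite -(wball_len X k v es_full).
  rewrite /P /Q /Z /condP /condQ /condZ /= -ev -ew rv rw -ra ry !eqxx /=.
  rewrite -rv lv (leq_trans (leq_addl (len a) _) _) -?rv//.
  rewrite (leq_trans (leq_addr (len u) _) _) -?rv//.
  by rewrite /gB vB /xiG wG.
have PQZ0 m : 0 <= P m.1 m.2.1 * Q m.2.1 m.2.2 * Z m.1 m.2.2.
  by rewrite !mulr_ge0// /P /Q /Z; case: ifP.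
have le1 : lhs <= \sum_(i <- LI) \sum_(b <- LB) \sum_(u <- LU) P i u * Q u b * Z i b.
  rewrite e1; under [leRHS]eq_bigr do rewrite exchange_big.
  have -> : \sum_(i <- LI) \sum_(u <- LU) \sum_(b <- LB) P i u * Q u b * Z i b =
    \sum_(m <- [seq (i, x) | i <- LI, x <- [seq (u, b) | u <- LU, b <- LB]])
      P m.1 m.2.1 * Q m.2.1 m.2.2 * Z m.1 m.2.2.
    by rewrite big_allpairs_dep; apply: eq_bigr => i _; rewrite big_allpairs_dep.
  apply: sumr_sub uTT _ _ PQZ0.
    by rewrite !uniq_pairs ?undup_uniq.
  move=> m mT; apply/allpairsP; exists m; split; last by case: (m).
    by rewrite mem_undup; apply: (map_f (fun m : term W => m.1)).
  apply/allpairsP; exists m.2; split; last by case: (m.2).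
    by rewrite mem_undup; apply: (map_f (fun m : term W => m.2.1)).
  by rewrite mem_undup; apply: (map_f (fun m : term W => m.2.2)).
have lhs0 : 0 <= lhs by rewrite e1; apply: sumr_ge0.
have sq0 (I : Type) (r : seq I) (F : I -> R) : 0 <= \sum_(i <- r) F i ^+ 2.
  by apply: sumr_ge0 => i _; exact: sqr_ge0.
apply: le_trans (_ : (\sum_(i <- LI) \sum_(b <- LB) \sum_(u <- LU)
   P i u * Q u b * Z i b) ^+ 2 <= _).
  by rewrite lerXn2r// nnegrE// (le_trans lhs0).
apply: le_trans (hilbert_schmidt _ _ _ _ _ _) _.
have M0 : 0 <= M by exact: ler0n.
set n1 := \sum_(v <- B) _; set n2 := \sum_(w <- G) _; set n3 := \sum_(y <- Y) _.
have -> : M ^+ 5 * n1 * n2 * n3 = (M ^+ 2 * n1) * (M * n2) * (M ^+ 2 * n3) by ring.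
have ss0 (I J : Type) (r : seq I) (r' : seq J) (F : I -> J -> R) :
    0 <= \sum_(i <- r) \sum_(j <- r') F i j ^+ 2.
  by apply: sumr_ge0 => i _; exact: sq0.
apply: ler_pM; [|exact: ss0| |exact: sumZ].
  by apply: mulr_ge0; exact: ss0.
by apply: ler_pM; [exact: ss0|exact: ss0|exact: sumP|exact: sumQ].
Qed.

End Bound.

(** Pair the image of a finitely supported vector with its own moduli and apply
    [haagerup_trilinear]. As [finvec (wball X es k) g] is the image of [delta_1],
    the operator norm exceeds the norm at [delta_1] by a polynomial factor at
    most. *)
Theorem haagerup k (g : W -> C) (xi : H) :
  nsq (hecke_sum k g xi) <=
  (prefix_bound es k)%:R ^+ 5 * nsq (finvec (wball X es k) g) * nsq xi.
Proof.
set M : R := (prefix_bound es k)%:R; set n1 := nsq (finvec _ g).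
have M0 : 0 <= M by exact: ler0n.
have n10 : 0 <= n1 by exact: nsq_ge0.
have bx : bounded_op (hecke_sum k g).
  exact: (poly_bounded (@hecke_bounded _ _ _ X q) (hecke_sum_poly _ _)).
have K0 : 0 <= M ^+ 5 * n1 by rewrite mulr_ge0 ?exprn_ge0.
have : opbd (hecke_sum k g) (Num.sqrt (M ^+ 5 * n1)).
  apply: (opbd_dense bx (sqrtr_ge0 _)).
  move=> G f uG; apply: l2_norm_sq_le.
    by rewrite mulr_ge0 ?sqrtr_ge0 ?l2_norm_ge0.
  rewrite exprMn sqr_sqrtr// l2_normE; apply: nsq_le => Y uY.
  set t := \sum_(y <- Y) _.
  pose h y := normc (hecke_sum k g (trunc G f) y).
  have h0 y : 0 <= h y by exact: normc_ge0.
  have f0 w : 0 <= normc (f w) by exact: normc_ge0.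
  have t0 : 0 <= t by apply: sumr_ge0 => y _; exact: sqn_ge0.
  have := @haagerup_trilinear k g G Y uG uY (fun w => normc (f w)) h f0 h0.
  set lhs := \sum_(v <- _) _; set n2 := \sum_(w <- G) _.
  rewrite -/t -(finvec_nsq _ (wball_uniq X es k)) -/n1 => hle.
  rewrite trunc_nsq//.
  have tle : t <= lhs.
    apply: le_trans (_ : \sum_(y <- Y) h y * (\sum_(v <- wball X es k) \sum_(w <- G)
      normc (g v) * normc (f w) *
      \sum_(m <- terms X (rword X v) w) (term_val m == y)%:R) <= _).
      apply: ler_sum => y _; rewrite /sqn expr2.
      by apply: ler_wpM2l; [exact: h0|exact: hecke_sum_coef].
    under eq_bigr do rewrite mulr_sumr.
    rewrite exchange_big; apply: ler_sum => v _.
    under eq_bigr do rewrite mulr_sumr.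
    rewrite exchange_big; apply: ler_sum => w _.
    under eq_bigr do rewrite mulrCA mulr_sumr.
    rewrite -mulr_sumr ler_wpM2l ?mulr_ge0 ?normc_ge0// exchange_big /=.
    apply: ler_sum => m _; case: ifP => mY; last first.
      rewrite big_seq big1// => y yY; case: eqP => [e|]; last by rewrite mulr0.
      by rewrite -e mY in yY.
    rewrite (bigD1_seq (term_val m))//= eqxx mulr1 big1 ?addr0// => y /negPf ne.
    by rewrite eq_sym ne mulr0.
  have tt : t * t <= M ^+ 5 * n1 * n2 * t.
    by rewrite -expr2 (le_trans _ hle)// lerXn2r// nnegrE// (le_trans t0).
  have [t00|tn0] := eqVneq t 0.
    by rewrite t00 mulr_ge0//; apply: sumr_ge0 => w _; exact: sqn_ge0.
  have tp : 0 < t by rewrite lt_neqAle eq_sym tn0.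
  by rewrite ler_pM2r in tt.
move=> /(_ xi) hx; rewrite -!l2_normE -(sqr_sqrtr K0) -exprMn.
by rewrite lerXn2r// nnegrE ?mulr_ge0 ?sqrtr_ge0 ?l2_norm_ge0.
Qed.

End Haagerup.

(** * Conjugation in a right-angled group *)

Section Walks.
Variables (W : groupType) (S : choiceType) (X : coxeterSystem W S).
Hypothesis raX : right_angled X.
Local Notation gen := (cox_gen X).
Local Notation desc := (left_descent X).
Local Notation edge := (cox_edge X).
Implicit Types (s t a b c : S) (w : W) (l : seq S).
Local Open Scope group_scope.

Definition conj_word l w : W := foldr (fun s v => gen s * v * gen s) w l.

Lemma conj_word_cat l1 l2 w :
  conj_word (l1 ++ l2) w = conj_word l1 (conj_word l2 w).
Proof. by rewrite /conj_word foldr_cat. Qed.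

Lemma conj_word_rev l w : conj_word l (conj_word (rev l) w) = w.
Proof.
elim: l w => // s l IH w; rewrite rev_cons -cats1 conj_word_cat.
rewrite -[LHS]/(gen s * conj_word l _ * gen s) IH /=.
by rewrite !mulgA gen2 mul1g genKr.
Qed.

Lemma conj_step s w : ~~ desc s w ->
  desc s (gen s * w * gen s) \/
  gen s * w * gen s = w /\ gen s * w = w * gen s.
Proof.
move=> nd; have [e|ne] := eqVneq (gen s * w) (w * gen s).
  by right; rewrite e genKr.
by left; rewrite -mulgA desc_flip (desc_mulr ne).
Qed.

(** Conjugating along a walk of pairwise non-commuting letters produces the
    first letter of the walk as a descent, unless every letter met so far
    commutes with [w]. *)
Lemma conj_walk s l w : path edge s l -> ~~ desc (last s l) w ->
  desc s (conj_word (s :: l) w) \/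
  conj_word (s :: l) w = w /\
    (forall t, t \in s :: l -> ~~ desc t w /\ gen t * w = w * gen t).
Proof.
elim: l s => [|t l IH] s /=.
  move=> _ nd; have [?|[e c]] := conj_step nd; [by left|right; split=> //].
  by move=> t; rewrite inE => /eqP ->.
move=> /andP[st pl] nd; have [dt|[e hl]] := IH t pl nd.
  set u := conj_word (t :: l) w in dt *.
  have ns : ~~ desc s u by apply: (edge_desc raX _ dt); rewrite edge_sym.
  have [?|[_ c]] := conj_step ns; first by left.
  by have := comm_asc_edge raX c ns st; rewrite dt.
move: e; rewrite /= => ->.
have [nt ct] := hl t (mem_head _ _).
have ns : ~~ desc s w by apply: (comm_asc_edge raX ct nt); rewrite edge_sym.
have [?|[e c]] := conj_step ns; [by left|right; split=> //].
by move=> r; rewrite inE => /orP[/eqP -> //|/hl].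
Qed.

Lemma conj_walk_cover b l w : path edge b l -> last b l = b ->
  (forall s, s \in b :: l) -> w != 1 -> ~~ desc b w ->
  desc b (conj_word (b :: l) w).
Proof.
move=> pl lb cover w1 nd; have nd' : ~~ desc (last b l) w by rewrite lb.
have [//|[_ h]] := conj_walk pl nd'.
by have [s ds] := exists_desc X w1; have [] := h s (cover s); rewrite ds.
Qed.

Section Paradox.
Variables (a b c : S).
Hypotheses (ba : edge b a) (bc : edge b c) (ac : a != c).

Definition starts_with2 s t w := desc s w && desc t (gen s * w).

Lemma conj_starts_with2 s w : edge b s -> desc b w ->
  starts_with2 s b (conj_word [:: s] w).
Proof.
move=> bs db; have ns : ~~ desc s w by exact: (edge_desc raX bs db).
have sb : edge s b by rewrite edge_sym.
rewrite /starts_with2 /= -mulgA genK; apply/andP; split.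
  have [|[_ cs]] := conj_step ns; first by rewrite mulgA.
  by have := comm_asc_edge raX cs ns sb; rewrite db.
rewrite desc_mulr//; apply/eqP => /(ra_gen_mul_eq raX) e.
by have := edge_neq bs; rewrite e eqxx.
Qed.

Lemma starts_with2_disjoint w : starts_with2 a b w -> ~~ starts_with2 c b w.
Proof.
move=> /andP[da db]; apply/negP => /andP[dc _].
have cm := desc_comm raX da dc.
have : desc c (gen a * w) by rewrite desc_mul_comm.
by apply/negP; apply: (edge_desc raX bc db).
Qed.

Lemma starts_with2_edge s w : edge b s -> starts_with2 s b w -> ~~ desc b w.
Proof. by move=> bs /andP[ds _]; apply: (edge_desc raX _ ds); rewrite edge_sym. Qed.

End Paradox.

(** Concatenate closed walks from [b] through the given vertices, one by one. *)
Lemma closed_walk b : irreducible X -> forall L : seq S, exists l,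
  [/\ path edge b l, last b l = b & {subset L <= b :: l}].
Proof.
move=> [_ conn]; elim=> [|s L [l [pl lb sub]]]; first by exists [::].
have [p1 pp1 l1] := conn b s; have [p2 pp2 l2] := conn s b.
exists (l ++ p1 ++ p2); split.
- by rewrite cat_path pl lb cat_path pp1 l1.
- by rewrite !last_cat lb l1.
- move=> t; rewrite inE => /orP[/eqP ->|/sub].
    have : s \in b :: p1 by rewrite -l1 mem_last.
    by rewrite !inE !mem_cat => /orP[->|->]; rewrite ?orbT.
  by rewrite !inE !mem_cat => /orP[->|->]; rewrite ?orbT.
Qed.

(** Otherwise every vertex has at most one neighbour, and a connected graph of
    this kind has at most two vertices. *)
Lemma exists_branching : irreducible X ->
  (exists x y z : S, [/\ x != y, x != z & y != z]) ->
  exists a b c, [/\ edge b a, edge b c & a != c].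
Proof.
move=> [_ conn] [x [y [z [xy xz yz]]]]; apply: contrapT => no.
have uniq_nb u v v' : edge u v -> edge u v' -> v = v'.
  by move=> e e'; apply/eqP/negP => /negP ne; apply: no; exists v, u, v'.
have [[|x1 p] /= pp lp] := conn x y; first by move: xy; rewrite lp eqxx.
have xx1 : edge x x1 by case/andP: pp.
have two p' u : path edge u p' -> (u = x \/ u = x1) -> last u p' = x \/ last u p' = x1.
  elim: p' u => //= v p' IH u /andP[uv pv] ux; apply: IH => //.
  case: ux uv => -> uv; first by right; apply: uniq_nb uv xx1.
  by left; apply: uniq_nb uv _; rewrite edge_sym.
have all u : u = x \/ u = x1.
  by have [p' pp' <-] := conn x u; apply: two pp' (or_introl _).
have hy : y = x1 by case: (all y) xy => // ->; rewrite eqxx.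
have hz : z = x1 by case: (all z) xz => // ->; rewrite eqxx.
by move: yz; rewrite hy hz eqxx.
Qed.

End Walks.

Section Masks.
Variables (R : realType) (W : groupType).
Local Notation H := (l2 R W).
Implicit Types (f g : H) (E : W -> bool).

Lemma l2_mask_subproof E f : (fun w => if E w then f w else 0) \in @square_summable R W.
Proof.
apply/square_summableP; apply: le_lt_trans (l2_summable f).
apply: le_esum => w _; rewrite lee_fin; case: ifP => // _.
by rewrite ComplexField.Normc.normc0 expr0n sqr_ge0.
Qed.

Definition l2_mask E f : H := L2 (l2_mask_subproof E f).

Lemma l2_maskE E f w : l2_mask E f w = if E w then f w else 0. Proof. by []. Qed.

Lemma l2_mask_sub E f g : l2_mask E f - l2_mask E g = l2_mask E (f - g).
Proof. by apply: l2_ext => w; rewrite l2B !l2_maskE l2B; case: ifP; rewrite ?subr0. Qed.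

Lemma l2_mask_le E f : l2_norm (l2_mask E f) <= l2_norm f.
Proof.
apply: ler_wsqrtr; apply: nsq_mono => w; rewrite l2_maskE; case: ifP => // _.
by rewrite sqn0 sqn_ge0.
Qed.

Lemma l2_mask_dist E f g : l2_norm (l2_mask E f) <= l2_norm (l2_mask E g) + l2_norm (f - g).
Proof.
rewrite -[l2_mask E f](subrK (l2_mask E g)) addrC; apply: le_trans (l2_normD _ _) _.
by apply: lerD => //; rewrite l2_mask_sub l2_mask_le.
Qed.

Lemma l2_mask_mono E E' f : (forall w, E w -> E' w) ->
  l2_norm (l2_mask E f) <= l2_norm (l2_mask E' f).
Proof.
move=> EE'; apply: ler_wsqrtr; apply: nsq_mono => w; rewrite !l2_maskE.
by case: ifP => [/EE' ->//|_]; rewrite sqn0 sqn_ge0.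
Qed.

End Masks.

(** * The spectral gap *)

Section SpectralGap.
Variables (R : realType) (W : groupType) (S : choiceType).
Variables (X : coxeterSystem W S).
Hypothesis raX : right_angled X.
Local Notation H := (l2 R W).
Local Notation gen := (cox_gen X).
Local Notation desc := (left_descent X).
Local Notation edge := (cox_edge X).
Local Notation lsh := (left_shift X).
Implicit Types (f g : H) (s t : S) (w v : W) (l : seq S).

Definition rsh s f : H := flip (lsh s (flip f)).

Lemma rshE s f v : rsh s f v = f (v * gen s)%g.
Proof. by rewrite flipE left_shiftE flipE invgM invgK genV. Qed.

Lemma rsh_nsq s f : nsq (rsh s f) = nsq f.
Proof. by rewrite flip_nsq left_shift_nsq flip_nsq. Qed.

Definition conj_shift s f : H := lsh s (rsh s f).

Definition conj_shifts l f : H := foldr conj_shift f l.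

Lemma conj_shiftE s f v : conj_shift s f v = f (gen s * v * gen s)%g.
Proof. by rewrite left_shiftE rshE. Qed.

Lemma conj_shift_nsq s f : nsq (conj_shift s f) = nsq f.
Proof. by rewrite left_shift_nsq rsh_nsq. Qed.

Lemma conj_shifts_nsq l f : nsq (conj_shifts l f) = nsq f.
Proof. by elim: l => //= s l IH; rewrite conj_shift_nsq. Qed.

Lemma conj_shiftsE l f v : conj_shifts l f v = f (conj_word X (rev l) v).
Proof.
elim: l v => // s l IH v.
rewrite -[LHS]/(conj_shift s (conj_shifts l f) v) conj_shiftE IH rev_cons -cats1.
by rewrite conj_word_cat.
Qed.

Lemma l2_mask_conj_shifts (E : W -> bool) l f :
  l2_norm (l2_mask E (conj_shifts l f)) =
  l2_norm (l2_mask (fun w => E (conj_word X l w)) f).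
Proof.
rewrite /l2_norm -!/(nsq _) -[in RHS](conj_shifts_nsq l); congr (Num.sqrt (nsq _)).
by apply: l2_ext => v; rewrite l2_maskE !conj_shiftsE l2_maskE conj_word_rev.
Qed.

Section Gap.
Variables (a b c : S) (l : seq S).
Hypotheses (ba : edge b a) (bc : edge b c) (ac : a != c).
Hypotheses (pl : path edge b l) (lb : last b l = b) (cover : forall s, s \in b :: l).

(** With [E] the elements having [b] as a descent, [E] and its conjugate along
    the closed walk cover all elements but 1, while [E] and its conjugates by
    [a] and [c] are disjoint. An almost invariant vector would then carry on [E],
    up to small errors, at least half and at most a third of its mass. *)
Lemma conj_spectral_gap f : f 1%g = 0 -> f != 0 ->
  exists2 k, k \in [:: [:: a]; [:: c]; b :: l] &
    l2_norm f / 20 <= l2_norm (conj_shifts k f - f).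
Proof.
move=> f1 f0; apply: contrapT => no.
set n := l2_norm f; pose e := n / 20.
have small k : k \in [:: [:: a]; [:: c]; b :: l] -> l2_norm (conj_shifts k f - f) <= e.
  by move=> kin; rewrite leNgt; apply/negP => lt; apply: no; exists k => //; exact: ltW.
have n0 : 0 < n.
  by rewrite lt_neqAle l2_norm_ge0 andbT eq_sym; apply: contra f0 => /eqP/l2_norm_eq0 ->.
pose E w := desc b w; pose m := l2_norm (l2_mask E f).
have m0 : 0 <= m := l2_norm_ge0 _.
have cov : n ^+ 2 <= m ^+ 2 + (m + e) ^+ 2.
  pose m' := l2_norm (l2_mask E (conj_shifts (b :: l) f)).
  have m'le : m' <= m + e.
    apply: le_trans (l2_mask_dist _ _ f) _; apply: lerD => //.
    by apply: small; rewrite !inE eqxx !orbT.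
  apply: le_trans (_ : m ^+ 2 + m' ^+ 2 <= _); last first.
    by rewrite lerD2l lerXn2r// nnegrE ?l2_norm_ge0// (le_trans (l2_norm_ge0 _) m'le).
  rewrite /m' l2_mask_conj_shifts !l2_normE -[leLHS]addr0 -(nsq0 R W).
  apply: nsq2_le => w; rewrite l20 sqn0 addr0 !l2_maskE.
  have [->|w1] := eqVneq w 1%g.
    by rewrite f1; do 2 case: ifP => _; rewrite sqn0 addr0.
  case: (boolP (E w)) => [_|nE]; first by rewrite lerDl sqn_ge0.
  by rewrite /E (conj_walk_cover raX pl lb cover w1 nE) sqn0 add0r.
have part s : edge b s -> [:: s] \in [:: [:: a]; [:: c]; b :: l] ->
    m <= l2_norm (l2_mask (starts_with2 X s b) f) + e.
  move=> bs sin; apply: le_trans (_ : l2_norm (l2_mask (starts_with2 X s b)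
    (conj_shifts [:: s] f)) <= _).
    rewrite l2_mask_conj_shifts; apply: l2_mask_mono => w; exact: conj_starts_with2.
  by apply: le_trans (l2_mask_dist _ _ f) _; apply: lerD => //; exact: small.
have [ma mc] : m <= l2_norm (l2_mask (starts_with2 X a b) f) + e /\
    m <= l2_norm (l2_mask (starts_with2 X c b) f) + e.
  by split; apply: part => //; rewrite !inE eqxx ?orbT.
have disj : nsq (l2_mask E f) + nsq (l2_mask (starts_with2 X a b) f) +
    nsq (l2_mask (starts_with2 X c b) f) <= nsq f.
  pose E2 w := starts_with2 X a b w || starts_with2 X c b w.
  have e2 : nsq (l2_mask (starts_with2 X a b) f) + nsq (l2_mask (starts_with2 X c b) f) <=
      nsq (l2_mask E2 f) + nsq (0 : H).
    apply: nsq2_le => w; rewrite !l2_maskE l20 sqn0 addr0 /E2.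
    case: (boolP (starts_with2 X a b w)) => [/(starts_with2_disjoint raX bc ac)/negPf ->|_] /=.
      by rewrite sqn0 addr0.
    by rewrite sqn0 add0r.
  have e3 : nsq (l2_mask E f) + nsq (l2_mask E2 f) <= nsq f + nsq (0 : H).
    apply: nsq2_le => w; rewrite !l2_maskE l20 sqn0 addr0 /E2.
    case: (boolP (starts_with2 X a b w)) => [/(starts_with2_edge raX ba)/negPf|_] /=.
      by rewrite /E => ->; rewrite sqn0 add0r.
    case: (boolP (starts_with2 X c b w)) => [/(starts_with2_edge raX bc)/negPf|_] /=.
      by rewrite /E => ->; rewrite sqn0 add0r.
    by case: ifP => _; rewrite ?sqn0 addr0// sqn_ge0.
  by move: e2 e3; rewrite nsq0; lra.
move: disj; rewrite -!l2_normE -/n -/m.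
set xa := l2_norm _ in ma *; set xc := l2_norm _ in mc *.
have xa0 : 0 <= xa := l2_norm_ge0 _; have xc0 : 0 <= xc := l2_norm_ge0 _.
have ne : n = 20 * e by rewrite /e; field.
have e0 : 0 < e by rewrite divr_gt0.
rewrite ne in cov *; clear -cov ma mc xa0 xc0 e0 m0.
have [me|em] := leP m e.
  by have := ler_pM m0 m0 me me; rewrite -expr2; nra.
have ya : (m - e) ^+ 2 <= xa ^+ 2 by rewrite lerXn2r ?nnegrE//; lra.
have yc : (m - e) ^+ 2 <= xc ^+ 2 by rewrite lerXn2r ?nnegrE//; lra.
move=> hd.
have m6 : m <= 6 * e.
  have : m * m <= 6 * e * m by nra.
  by rewrite ler_pM2r// (lt_trans e0).
have := ler_pM m0 m0 m6 m6; nra.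
Qed.

End Gap.

End SpectralGap.

(** * Averaging by unitaries of the Hecke algebra *)

Section RealScalars.
Variable R : realType.
Implicit Types x y : R.

Lemma rcM x y : (x * y)%:C = x%:C * y%:C :> R[i]. Proof. exact: rmorphM. Qed.
Lemma rcD x y : (x + y)%:C = x%:C + y%:C :> R[i]. Proof. exact: rmorphD. Qed.
Lemma rcN x : (- x)%:C = - x%:C :> R[i]. Proof. exact: rmorphN. Qed.
Lemma rc1 : (1 : R)%:C = 1 :> R[i]. Proof. by []. Qed.
Lemma rc_nat n : (n%:R : R)%:C = n%:R :> R[i]. Proof. exact: rmorph_nat. Qed.

Lemma quarter4 : (4^-1 : R)%:C * 4 = 1 :> R[i].
Proof. by rewrite -(rc_nat 4) -rcM mulVf. Qed.

End RealScalars.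

Section Unitaries.
Variables (R : realType) (W : groupType) (S : choiceType).
Variables (X : coxeterSystem W S) (q : S -> R).
Local Notation C := R[i].
Local Notation H := (l2 R W).
Local Notation op := (H -> H).
Local Notation delta := (@l2_delta R W).
Local Notation gen := (cox_gen X).
Local Notation len := (word_length X).
Local Notation desc := (left_descent X).
Local Notation T := (hecke_op X q).
Local Notation p := (hecke_p q).
Local Notation A := (hecke_cstar_algebra X q).
Implicit Types (f g : H) (s t : S) (v w : W) (l : seq S).

(** The difference [q_s^(1/2) + q_s^(-1/2)] of the two eigenvalues of [T_s]. *)
Definition kap s : R := Num.sqrt (4 + p s ^+ 2).

Lemma kap_sqr s : kap s ^+ 2 = 4 + p s ^+ 2.
Proof. by rewrite sqr_sqrtr// addr_ge0 ?sqr_ge0. Qed.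

Lemma kap_ge2 s : 2 <= kap s.
Proof.
rewrite -(ler_pXn2r (n := 2))// ?nnegrE ?sqrtr_ge0// kap_sqr.
by have := sqr_ge0 (p s); rewrite !expr2; lra.
Qed.

Lemma kap_gt0 s : 0 < kap s.
Proof. exact: lt_le_trans (kap_ge2 s). Qed.

Lemma kap_inv_sqr s :
  (kap s)^-1%:C * (kap s)^-1%:C * (4 + (p s)%:C ^+ 2) = 1 :> C.
Proof.
rewrite -(rc_nat _ 4) expr2 -!rcM -rcD -expr2 -kap_sqr -rcM.
by rewrite (_ : _ * _ = 1) ?rc1//; field; rewrite gt_eqF// kap_gt0.
Qed.

Lemma kap_le s : kap s <= 2 + `|p s|.
Proof.
rewrite -(ler_pXn2r (n := 2))// ?nnegrE ?sqrtr_ge0 ?addr_ge0// kap_sqr.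
rewrite -(real_normK (num_real (p s))).
by have := normr_ge0 (p s); move: (`|p s|) => x; nra.
Qed.

(** [T_s] has the two eigenvalues [q_s^(1/2)] and [-q_s^(-1/2)]; [unit_op s] is
    the symmetry with the same eigenspaces and eigenvalues 1 and -1. *)
Definition unit_op s : op :=
  (2 / kap s)%:C *: T s + (- (p s / kap s))%:C *: id.

Lemma unit_opE s f v : unit_op s f v =
  (kap s)^-1%:C * ((2 : R)%:C * f (gen s * v)%g +
    (if desc s v then p s else - p s)%:C * f v).
Proof.
rewrite /unit_op op_addE !op_scaleE -[id f]/f l2D !l2Z heckeE.
move: (kap s) (p s) => x y; rewrite rcN !rcM.
by case: ifP => _; rewrite ?rcN; ring.
Qed.

Lemma unit_op_poly s : op_poly (range T) (unit_op s).
Proof. by apply: polyD; apply: polyZ; [exact: hecke_poly|exact: OpId]. Qed.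

Lemma unit_op_A s : A (unit_op s).
Proof. by apply: poly_A; exact: unit_op_poly. Qed.

Lemma unit_op_lin s : linear (unit_op s).
Proof. exact: (A_lin (unit_op_A s)). Qed.

(** On each pair [{v, s v}] the operator is an orthogonal two by two matrix. *)
Lemma unit_op_nsq s f : nsq (unit_op s f) = nsq f.
Proof.
have : nsq (unit_op s f) + nsq (left_shift X s (unit_op s f)) =
    nsq f + nsq (left_shift X s f).
  apply: nsq2_eq => v; rewrite !left_shiftE !unit_opE genK desc_flip !sqnM.
  have k0 : kap s != 0 by rewrite gt_eqF// kap_gt0.
  have -> : sqn (kap s)^-1%:C = (4 + p s ^+ 2)^-1.
    by rewrite /sqn normcR real_normK ?num_real// exprVn kap_sqr.
  have k2 : 4 + p s ^+ 2 != 0 by rewrite -kap_sqr sqrf_eq0.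
  move: (f v) (f (gen s * v)%g) k2 => [x1 x2] [y1 y2] k2.
  by rewrite !sqnE /=; case: ifP => _ /=; field.
by rewrite !left_shift_nsq; lra.
Qed.

Lemma unit_op_norm s f : l2_norm (unit_op s f) = l2_norm f.
Proof. by rewrite /l2_norm -!/(nsq _) unit_op_nsq. Qed.

Lemma unit_op_invol s f : unit_op s (unit_op s f) = f.
Proof.
apply: l2_ext => v; rewrite unit_opE !unit_opE genK desc_flip.
have e := kap_inv_sqr s.
rewrite rc_nat -[RHS]mul1r -[in RHS]e.
by case: (desc s v) => /=; rewrite rcN; ring.
Qed.

Lemma unit_op_near s f :
  l2_norm (unit_op s f - left_shift X s f) <= `|p s| * l2_norm f.
Proof.
pose sg : H := 2 *: l2_mask (desc s) f - f.
have sgle : l2_norm sg <= l2_norm f.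
  apply: ler_wsqrtr; apply: nsq_mono => v; rewrite l2B l2Z l2_maskE.
  case: ifP => _; last by rewrite mulr0 sub0r /sqn normcN.
  by rewrite mulr_natl mulr2n addrK.
have -> : unit_op s f - left_shift X s f =
    (2 / kap s - 1)%:C *: left_shift X s f + (p s / kap s)%:C *: sg.
  apply: l2_ext => v; rewrite l2B unit_opE l2D !l2Z l2B l2Z l2_maskE left_shiftE.
    rewrite (rcD (2 / kap s)) rcN rc1; move: (kap s) (p s) => x y; rewrite !rcM rc_nat.
  by case: ifP => _; rewrite ?rcN; ring.
apply: le_trans (l2_normD _ _) _; rewrite !l2_normZ !normcR.
rewrite left_shift_norm.
have k0 := kap_gt0 s; have k2 := kap_ge2 s; have kp := kap_le s.
have h1 : `|2 / kap s - 1| <= `|p s| / 2.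
  rewrite ler0_norm; last by rewrite subr_le0 ler_pdivrMr// mul1r.
  rewrite opprB lerBlDr -lerBlDl ler_pdivlMr//.
  have := normr_ge0 (p s); move: (`|p s|) kp => x kp x0.
  have [x2|x2] := leP 2 x; last by nra.
  by apply: le_trans (_ : 0 <= _) => //; nra.
have h2 : `|p s / kap s| <= `|p s| / 2.
  rewrite normrM normrV ?unitfE ?gt_eqF// (gtr0_norm k0); apply: ler_wpM2l => //.
  by rewrite lef_pV2 ?posrE.
have -> : `|p s| * l2_norm f = `|p s| / 2 * l2_norm f + `|p s| / 2 * l2_norm f.
  by field.
apply: lerD.
  by rewrite ler_wpM2r ?l2_norm_ge0.
by apply: ler_pM => //; exact: l2_norm_ge0.
Qed.

Definition right_unit s f : H := flip (unit_op s (flip f)).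

(** On vectors, conjugating an operator by [unit_op s] is [conj_vec s]. *)
Definition conj_vec s f : H := unit_op s (right_unit s f).

Lemma right_unit_norm s f : l2_norm (right_unit s f) = l2_norm f.
Proof. by rewrite flip_norm unit_op_norm flip_norm. Qed.

Lemma conj_vec_norm s f : l2_norm (conj_vec s f) = l2_norm f.
Proof. by rewrite unit_op_norm right_unit_norm. Qed.

Lemma right_unit_lin s : linear (right_unit s).
Proof.
move=> k f g; rewrite /right_unit (lin_comb (@flip_lin R W) k f g).
rewrite (lin_comb (unit_op_lin s) k (flip f) (flip g)).
exact: (lin_comb (@flip_lin R W)).
Qed.

Lemma conj_vec_lin s : linear (conj_vec s).
Proof.
move=> k f g; rewrite /conj_vec (lin_comb (right_unit_lin s) k f g).
exact: (lin_comb (unit_op_lin s)).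
Qed.

Lemma conj_vec_near s f :
  l2_norm (conj_vec s f - conj_shift X s f) <= 2 * `|p s| * l2_norm f.
Proof.
apply: le_trans (l2_norm_tri _ (left_shift X s (right_unit s f)) _) _.
rewrite -mulrA mulr_natl mulr2n; apply: lerD.
  by apply: le_trans (unit_op_near _ _) _; rewrite right_unit_norm.
have -> : left_shift X s (right_unit s f) - conj_shift X s f =
    left_shift X s (flip (unit_op s (flip f) - left_shift X s (flip f))).
  apply: l2_ext => v; rewrite l2B conj_shiftE !left_shiftE !flipE l2B !left_shiftE flipE.
  have -> : ((gen s * (gen s * v)^-1)^-1 = gen s * v * gen s)%g.
    by rewrite invgM invgK genV.
  by [].
rewrite left_shift_norm flip_norm; apply: le_trans (unit_op_near _ _) _.
by rewrite flip_norm.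
Qed.

Lemma conj_vec_at1 s f : conj_vec s f 1%g = f 1%g.
Proof.
rewrite /conj_vec unit_opE !flipE !unit_opE !flipE !mulg1 invg1 !mulg1 genV.
rewrite !invg1 gen2 desc1 invg1.
have ds : desc s (gen s) by rewrite -[gen s]mulg1 desc_flip desc1.
rewrite ds.
have e := kap_inv_sqr s.
by rewrite rc_nat rcN genV -[RHS]mul1r -[in RHS]e; ring.
Qed.

Definition supp_le k f := forall w, (k < len w)%N -> f w = 0.

Lemma supp_le_unit k s f : supp_le k f -> supp_le k.+1 (unit_op s f).
Proof.
move=> fk w kw; rewrite unit_opE !fk ?mulr0 ?addr0 ?mulr0//; first exact: ltnW.
have := len_gen_le X s (gen s * w)%g; rewrite genK => h.
by rewrite -ltnS; exact: leq_trans kw h.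
Qed.

Lemma supp_le_flip k f : supp_le k f -> supp_le k (flip f).
Proof. by move=> fk w kw; rewrite flipE fk// lenV. Qed.

Lemma supp_le_conj k s f : supp_le k f -> supp_le k.+2 (conj_vec s f).
Proof.
by move=> fk; apply/supp_le_unit/supp_le_flip/supp_le_unit/supp_le_flip.
Qed.

Definition conj_vecs l f : H := foldr conj_vec f l.

Lemma conj_vecs_norm l f : l2_norm (conj_vecs l f) = l2_norm f.
Proof. by elim: l => //= s l IH; rewrite conj_vec_norm. Qed.

Lemma conj_vecs_at1 l f : conj_vecs l f 1%g = f 1%g.
Proof.
elim: l => // s l IH.
by rewrite -[conj_vecs _ _]/(conj_vec s (conj_vecs l f)) conj_vec_at1.
Qed.

Lemma supp_le_conjs l k f : supp_le k f -> supp_le (k + (size l).*2) (conj_vecs l f).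
Proof.
elim: l => [|s l IH] fk; first by rewrite addn0.
by rewrite [size _]/= doubleS !addnS; apply/supp_le_conj/IH.
Qed.

Lemma conj_vecs_near l (e : R) f : (forall s, `|p s| <= e) ->
  l2_norm (conj_vecs l f - conj_shifts X l f) <= (2 * (size l)%:R * e) * l2_norm f.
Proof.
move=> pe; have e0 (s : S) : 0 <= e by apply: le_trans (pe s).
elim: l => [|s l IH]; first by rewrite subrr l2_norm0 mulr0 !mul0r.
rewrite -[conj_vecs _ _]/(conj_vec s (conj_vecs l f)).
rewrite -[conj_shifts _ _ _]/(conj_shift X s (conj_shifts X l f)).
apply: le_trans (l2_norm_tri _ (conj_vec s (conj_shifts X l f)) _) _.
rewrite -(linB (conj_vec_lin s)) conj_vec_norm.
have -> : 2 * (size (s :: l))%:R * e * l2_norm f =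
    2 * (size l)%:R * e * l2_norm f + 2 * e * l2_norm f.
  by rewrite /= -natr1; ring.
apply: lerD => //; apply: le_trans (conj_vec_near _ _) _.
have -> : l2_norm (conj_shifts X l f) = l2_norm f.
  by rewrite /l2_norm -!/(nsq _) conj_shifts_nsq.
by rewrite ler_wpM2r ?l2_norm_ge0// ler_wpM2l.
Qed.

(** * Conjugation of operators *)

Definition conj_op s (x : op) : op := unit_op s \o x \o unit_op s.

Definition conj_ops l (x : op) : op := foldr conj_op x l.

Lemma conj_ops_A l x : A x -> A (conj_ops l x).
Proof.
move=> Ax; elim: l => //= s l IH.
by apply: A_comp (unit_op_A s); apply: A_comp (unit_op_A s) IH.
Qed.

Lemma conj_ops_bd l x M : opbd x M -> opbd (conj_ops l x) M.
Proof.
move=> hx; elim: l => //= s l IH f.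
by rewrite /conj_op /= unit_op_norm -(unit_op_norm s f); exact: IH.
Qed.

Lemma conj_ops_sub l x y : conj_ops l (x - y) = conj_ops l x - conj_ops l y.
Proof.
elim: l => //= s l ->; apply/funext => f.
by rewrite op_subE /conj_op /= op_subE (linB (unit_op_lin s)).
Qed.

Lemma conj_ops_scalar (k : C) l : conj_ops l (k *: id) = k *: id.
Proof.
elim: l => //= s l ->; apply/funext => f.
rewrite -[LHS]/(unit_op s (k *: unit_op s f)).
by rewrite (linZ (unit_op_lin s)) unit_op_invol.
Qed.

Lemma conj_ops_ideal I l x : closed_ideal A I -> I x -> I (conj_ops l x).
Proof.
move=> [_ _ _ IA _] Ix; elim: l => //= s l IH; rewrite /conj_op.
have [I1 _] := IA _ _ (unit_op_A s) IH.
by have [_] := IA _ _ (unit_op_A s) I1.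
Qed.

Hypothesis qconj : conj_invariant X q.

Lemma right_unitE s f : right_unit s f =
  (2 / kap s)%:C *: right_op X q s f + (- (p s / kap s))%:C *: f.
Proof.
rewrite /right_unit /unit_op op_addE !op_scaleE (linD (@flip_lin R W)).
by rewrite !(linZ (@flip_lin R W)) flipK.
Qed.

Lemma unit_op_delta s : unit_op s (delta 1%g) = right_unit s (delta 1%g).
Proof.
rewrite right_unitE right_delta_asc ?invg1 ?desc1// mul1g.
by rewrite /unit_op op_addE !op_scaleE hecke_delta_asc ?desc1// mulg1.
Qed.

(** [unit_op s] and [right_unit s] agree at [delta_1], and the latter commutes with
    the algebra. *)
Lemma conj_op_delta s x : A x -> conj_op s x (delta 1%g) = conj_vec s (x (delta 1%g)).
Proof.
move=> Ax; rewrite /conj_vec -[LHS]/(unit_op s (x (unit_op s (delta 1%g)))).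
congr (unit_op s _); rewrite unit_op_delta !right_unitE.
by rewrite (linD (A_lin Ax)) !(linZ (A_lin Ax)) (A_right_comm qconj).
Qed.

Lemma conj_ops_delta l x : A x -> conj_ops l x (delta 1%g) = conj_vecs l (x (delta 1%g)).
Proof.
move=> Ax; elim: l => // s l IH.
by rewrite -[conj_ops _ _]/(conj_op s (conj_ops l x)) conj_op_delta ?IH//; exact: conj_ops_A.
Qed.

Section Averaging.
Variables (a c : S) (l : seq S).

(** The term [x] itself is the partner of whichever conjugate moves the vector in
    [avg_vec_contract]. *)
Definition avg_op (x : op) : op := (4^-1 : R)%:C *:
  (x + conj_ops [:: a] x + (conj_ops [:: c] x + conj_ops l x)).

Definition avg_vec f : H := (4^-1 : R)%:C *:
  (f + conj_vecs [:: a] f + (conj_vecs [:: c] f + conj_vecs l f)).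

Lemma avg_op_A x : A x -> A (avg_op x).
Proof.
move=> Ax; have cA k := conj_ops_A k Ax.
by apply: A_scale; apply: A_add; apply: A_add => //; exact: cA.
Qed.

Lemma avg_op_delta x : A x -> avg_op x (delta 1%g) = avg_vec (x (delta 1%g)).
Proof.
move=> Ax; rewrite /avg_op op_scaleE !op_addE.
by rewrite (conj_ops_delta [:: a] Ax) (conj_ops_delta [:: c] Ax) (conj_ops_delta l Ax).
Qed.

Lemma normc_quarter : normc (4^-1 : R)%:C = 4^-1.
Proof. by rewrite normcR ger0_norm ?invr_ge0. Qed.

Lemma avg_op_bd x M : opbd x M -> opbd (avg_op x) M.
Proof.
move=> hx f; rewrite /avg_op op_scaleE !op_addE l2_normZ normc_quarter.
have h k := conj_ops_bd k hx f.
have -> : M * l2_norm f = 4^-1 * ((M * l2_norm f + M * l2_norm f) +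
  (M * l2_norm f + M * l2_norm f)) by field.
apply: ler_wpM2l; first by rewrite invr_ge0.
apply: le_trans (l2_normD _ _) _; apply: lerD.
  by apply: le_trans (l2_normD _ _) _; apply: lerD; [exact: hx|exact: h [:: a]].
by apply: le_trans (l2_normD _ _) _; apply: lerD; [exact: h [:: c]|exact: h l].
Qed.

Lemma avg_op_sub x y : avg_op (x - y) = avg_op x - avg_op y.
Proof.
rewrite /avg_op (conj_ops_sub [:: a]) (conj_ops_sub [:: c]) (conj_ops_sub l).
have subD (u v w z : op) : (u - v) + (w - z) = (u + w) - (v + z).
  by rewrite opprD addrACA.
by rewrite -scalerBr !subD.
Qed.

Lemma avg_op_scalar (k : C) : avg_op (k *: id) = k *: id.
Proof.
rewrite /avg_op !(conj_ops_scalar k); apply/funext => f; apply: l2_ext => v.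
rewrite op_scaleE !op_addE l2Z !l2D !op_scaleE !l2Z -[id f]/f.
have -> : k * f v + k * f v + (k * f v + k * f v) = 4 * (k * f v) by ring.
by rewrite mulrA quarter4 mul1r.
Qed.

Lemma avg_op_ideal I x : closed_ideal A I -> I x -> I (avg_op x).
Proof.
move=> idI Ix; have [_ I0 Ic _ _] := idI.
have Iadd y z : I y -> I z -> I (y + z).
  by move=> Iy Iz; rewrite -[y]scale1r; apply: Ic.
have Isc k y : I y -> I (k *: y) by move=> Iy; rewrite -[k *: y]addr0; apply: Ic.
have Icj k := conj_ops_ideal k idI Ix.
exact: Isc (Iadd _ _ (Iadd _ _ Ix (Icj _)) (Iadd _ _ (Icj _) (Icj _))).
Qed.

Lemma avg_vecE f v : avg_vec f v = (4^-1 : R)%:C *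
  (f v + conj_vecs [:: a] f v + (conj_vecs [:: c] f v + conj_vecs l f v)).
Proof. by []. Qed.

Lemma avg_vec_at1 f : avg_vec f 1%g = f 1%g.
Proof.
rewrite avg_vecE (conj_vecs_at1 [:: a]) (conj_vecs_at1 [:: c]) (conj_vecs_at1 l).
rewrite (_ : f 1%g + f 1%g + (f 1%g + f 1%g) = 4 * f 1%g); last by ring.
by rewrite mulrA quarter4 mul1r.
Qed.

Lemma avg_vec_supp k f : supp_le k f -> supp_le (k + (size l).+1.*2) (avg_vec f).
Proof.
move=> fk w kw.
have cj j : (size j <= (size l).+1)%N -> conj_vecs j f w = 0.
  move=> jl; have := @supp_le_conjs j k f fk; apply; apply: leq_ltn_trans kw.
  by rewrite leq_add2l leq_double.
rewrite avg_vecE (cj [:: a])// (cj [:: c])// (cj l) ?leqnSn//.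
by rewrite fk ?addr0 ?mulr0//; apply: leq_ltn_trans kw; exact: leq_addr.
Qed.

(** By the parallelogram identity, moving a vector by a definite proportion of
    its norm makes the average of its images shorter. *)
Lemma avg_vec_contract (d : R) f : 0 <= d -> d <= 1 ->
  (exists2 k, k \in [:: [:: a]; [:: c]; l] &
     d * l2_norm f <= l2_norm (conj_vecs k f - f)) ->
  l2_norm (avg_vec f) <= (1 - d ^+ 2 / 16) * l2_norm f.
Proof.
move=> d0 d1 [k kin far]; set n := l2_norm f.
have n0 : 0 <= n := l2_norm_ge0 f.
have pair : l2_norm (f + conj_vecs k f) <= (2 - d ^+ 2 / 4) * n.
  have dd : 0 <= d * (1 - d) by rewrite mulr_ge0// subr_ge0.
  have c0 : 0 <= 2 - d ^+ 2 / 4 by move: dd; rewrite !expr2; nra.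
  apply: l2_norm_sq_le; first by rewrite mulr_ge0.
  have := parallelogram f (conj_vecs k f).
  rewrite -[nsq (conj_vecs k f)]l2_normE conj_vecs_norm -[nsq f]l2_normE -/n.
  have : (d * n) ^+ 2 <= nsq (f - conj_vecs k f).
    by rewrite -l2_normE l2_normBC lerXn2r// nnegrE ?mulr_ge0 ?l2_norm_ge0.
  move: (nsq _) (nsq _) => x y hy hx.
  apply: le_trans (_ : (4 - d ^+ 2) * n ^+ 2 <= _).
    by move: hy hx; rewrite exprMn; nra.
  rewrite exprMn ler_wpM2r ?sqr_ge0//.
  by have := sqr_ge0 (d ^+ 2 / 4); rewrite sqrrB; lra.
have nk j : l2_norm (conj_vecs j f) = n by exact: conj_vecs_norm.
rewrite /avg_vec l2_normZ normc_quarter.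
have -> : (1 - d ^+ 2 / 16) * n = 4^-1 * ((2 - d ^+ 2 / 4) * n + (n + n)) by field.
rewrite ler_wpM2l ?invr_ge0//.
have two j j' : l2_norm (conj_vecs j f + conj_vecs j' f) <= n + n.
  by apply: le_trans (l2_normD _ _) _; rewrite !nk.
have regroup i j j' : k = i ->
    l2_norm (f + conj_vecs i f + (conj_vecs j f + conj_vecs j' f)) <=
    (2 - d ^+ 2 / 4) * n + (n + n).
  move=> <-; apply: le_trans (l2_normD _ _) _; apply: lerD; [exact: pair|exact: two].
move: kin; rewrite !inE => /or3P[] /eqP e.
- exact: regroup.
- rewrite [X in l2_norm X](_ : _ = f + conj_vecs [:: c] f +
    (conj_vecs [:: a] f + conj_vecs l f)); last exact: addrACA.
  exact: regroup.
- rewrite [X in l2_norm X](_ : _ = f + conj_vecs l f +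
    (conj_vecs [:: a] f + conj_vecs [:: c] f)); last first.
    by rewrite [X in _ + X = _]addrC; exact: addrACA.
  exact: regroup.
Qed.

End Averaging.

End Unitaries.

(** * Simplicity near the parameter 1 *)

Section Simplicity.
Variables (R : realType) (W : groupType) (S : choiceType).
Variables (X : coxeterSystem W S) (q : S -> R) (es : seq S).
Hypothesis raX : right_angled X.
Hypothesis es_full : forall s, s \in es.
Local Notation C := R[i].
Local Notation H := (l2 R W).
Local Notation op := (H -> H).
Local Notation delta := (@l2_delta R W).
Local Notation gen := (cox_gen X).
Local Notation len := (word_length X).
Local Notation edge := (cox_edge X).
Local Notation T := (hecke_op X q).
Local Notation p := (hecke_p q).
Local Notation A := (hecke_cstar_algebra X q).
Implicit Types (f g : H) (s t : S) (v w : W).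

Let qconj : conj_invariant X q := ra_conj_invariant raX q.

Lemma poly_supp x : op_poly (range T) x ->
  exists d, forall k f, supp_le X k f -> supp_le X (k + d) (x f).
Proof.
elim=> [_ [s _ <-]||z a b _ [d hd] _ [d' hd']|a b _ [d hd] _ [d' hd']].
- exists 1%N => k f fk w; rewrite addn1 => kw; rewrite heckeE.
  have k1 : (k < len (gen s * w)%g)%N.
    have := len_gen_le X s (gen s * w)%g; rewrite genK => h.
    by rewrite -ltnS; exact: leq_trans kw h.
  by rewrite (fk _ k1) (fk w (ltnW kw)); case: ifP => _; rewrite mulr0 addr0.
- by exists 0%N => k f; rewrite addn0.
- exists (maxn d d') => k f fk w kw; rewrite op_addE op_scaleE l2D l2Z.
  rewrite (hd k f fk) ?(hd' k f fk) ?mulr0 ?addr0//;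
    apply: leq_ltn_trans kw; rewrite leq_add2l; [exact: leq_maxr|exact: leq_maxl].
- exists (d' + d)%N => k f fk; rewrite addnA; exact/hd/hd'.
Qed.

(** The adjoint of [T_w] has this property, as [delta_w] is [T_w delta_1]. *)
Lemma coefficient_op w : exists2 a, A a & forall f, a f 1%g = f w.
Proof.
have [a pa ab] := poly_adj (@hecke_bounded _ _ _ X q)
  (@hecke_selfadj _ _ _ X q) (tword_poly X q (rword X w)).
have Aa : A a by exact: poly_A.
exists a => // f; have ba := A_bounded Aa; have [M M0 hM] := bounded_bd ba.
apply/eqP; rewrite -subr_eq0; apply/eqP/normc_eq0/le_anti.
rewrite normc_ge0 andbT.
have M1 : 0 <= M + 1 by rewrite addr_ge0// ltW.
apply: (small_le0 M1) => e e0; have [F uF hF] := trunc_dense f e0.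
have ew : a (trunc F f) 1%g = trunc F f w.
  rewrite (lin_trunc (bounded_lin ba)) /trunc /finvec l2_sum.
  apply: eq_bigr => v _; rewrite (adj_mx_sym ab).
  have := @tw_delta R W S X q w; rewrite /tw => ->.
  rewrite l2Z l2_delta_sym; congr (_ * _); exact: conjc_nat.
have -> : a f 1%g - f w = (a f - a (trunc F f)) 1%g - (f - trunc F f) w.
  by rewrite !l2B ew; ring.
apply: le_trans (normcD _ _) _; rewrite normcN mulrDl; apply: lerD.
  apply: le_trans (l2_normc _ _) _; rewrite -(linB (bounded_lin ba)).
  by apply: le_trans (hM _) _; apply: ler_wpM2l => //; exact: ltW.
by rewrite mul1r; exact: le_trans (l2_normc _ _) hF.
Qed.

(** The ideal contains [1 - (1 - b)^n], which tends to 1. *)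
Lemma ideal_near_id I b : closed_ideal A I -> I b -> opbd (id - b) 2^-1 -> I = A.
Proof.
move=> idI Ib hb; have [IsubA I0 Ic IA cI] := idI.
have Ab : A b by exact: IsubA.
have Aid : A id by exact: A_id.
pose y : op := id - b; have Ay : A y by exact: A_sub.
pose yn n : op := iter n (fun z => y \o z) id.
have Ayn n : A (yn n) by elim: n => //= n IH; exact: A_comp.
have ynbd n : opbd (yn n) (2^-1 ^+ n).
  elim: n => [|n IH]; first by move=> f; rewrite mul1r.
  by rewrite exprS; apply: opbd_comp IH; rewrite ?invr_ge0.
have Iyn n : I (id - yn n).
  elim: n => [|n IH]; first by rewrite subrr.
  rewrite [id - _](_ : _ = 1 *: (id - yn n) + (b \o yn n)).
    by apply: Ic; [exact: IH|exact: (IA _ _ (Ayn n) Ib).2].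
  apply/funext => f; rewrite [RHS]op_addE op_scaleE !op_subE scale1r.
  rewrite -[yn n.+1 f]/(y (yn n f)) /y op_subE -[(b \o _) f]/(b (yn n f)).
  by rewrite -[id (yn n f)]/(yn n f) opprB addrA addrAC.
have Iid : I id.
  apply: (norm_closed_bd cI (@bounded_id _ _)) => e e0.
  have half1 : 2^-1 < 1 :> R by rewrite invf_lt1// ltr1n.
  have [n hn] := @geometric_small R 2^-1 1 e ltac:(by rewrite invr_gt0) half1 ler01 e0.
  exists (id - yn n) => // f; rewrite op_subE op_subE opprB addrC subrK.
  by apply: le_trans (ynbd n f) _; rewrite ler_wpM2r ?l2_norm_ge0// -[leLHS]mul1r.
apply/seteqP; split=> // a Aa.
by have [+ _] := IA _ _ Aa Iid.
Qed.

Section Averages.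
Variables (a b c : S) (l : seq S).
Hypotheses (ba : edge b a) (bc : edge b c) (ac : a != c).
Hypotheses (pl : path edge b l) (lb : last b l = b) (cover : forall s, s \in b :: l).
Hypothesis p_small : forall s, `|p s| <= (80 * (size l).+1%:R)^-1.

Lemma p_le1 s : `|p s| <= 1.
Proof.
apply: le_trans (p_small s) _; rewrite invf_le1 ?mulr_gt0//.
by apply: le_trans (_ : 80 * 1 <= _); [rewrite mulr1 ler1n|rewrite ler_wpM2l// ler1n].
Qed.

(** The gap 1/20 of [conj_spectral_gap] loses at most 1/40 when the translations
    are replaced by the unitaries; [rho] is the contraction factor that
    [avg_vec_contract] gives for the remaining 1/40. *)
Let rho : R := 1 - (40^-1) ^+ 2 / 16.

Let rho_gt0 : 0 < rho. Proof. by rewrite /rho; lra. Qed.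
Let rho_lt1 : rho < 1. Proof. by rewrite /rho; lra. Qed.

Local Notation avg := (avg_op X q a c (b :: l)).
Local Notation avgv := (avg_vec X q a c (b :: l)).

Lemma avg_vec_gap f : f 1%g = 0 -> l2_norm (avgv f) <= rho * l2_norm f.
Proof.
move=> f1; apply: avg_vec_contract; [by rewrite invr_ge0|by rewrite invf_le1// ler1n|].
have [->|f0] := eqVneq f 0.
  by exists [:: a]; rewrite ?inE ?eqxx// l2_norm0 mulr0 l2_norm_ge0.
have [k kin hk] := conj_spectral_gap raX ba bc ac pl lb cover f1 f0.
exists k; first exact: kin.
have near := conj_vecs_near X k f p_small.
have sk : (size k <= (size l).+1)%N.
  by move: kin; rewrite !inE => /or3P[] /eqP ->.
have ke : 2 * (size k)%:R * (80 * (size l).+1%:R)^-1 <= 40^-1 :> R.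
  rewrite ler_pdivrMr ?mulr_gt0// mulrA (_ : 40^-1 * 80 = 2); last by field.
  by rewrite ler_wpM2l// ler_nat.
have nb := le_trans near (ler_wpM2r (l2_norm_ge0 f) ke).
have := l2_norm_tri (conj_shifts X k f) (conj_vecs X q k f) f.
rewrite [X in _ <= X + _]l2_normBC => tri.
by move: hk nb tri; lra.
Qed.

(** At [delta_1] the [n]-th average of [x - trace] is at most a multiple of
    [rho^n], while its support lies in a ball of radius linear in [n]; the factor
    of [haagerup] is polynomial in this radius. *)
Lemma avg_iter_small x (eta : R) : op_poly (range T) x -> 0 < eta ->
  exists n, opbd (iter n avg (x - htrace x *: id)) eta.
Proof.
move=> px eta0; pose y : op := x - htrace x *: id.
have py : op_poly (range T) y.
  rewrite /y op_subN1; apply: OpComb => //; apply: polyZ; exact: OpId.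
have Ay : A y by exact: poly_A.
pose f0 := y (delta 1%g); have [d0 hd0] := poly_supp py.
have supp0 : supp_le X d0 f0.
  apply: (hd0 0%N) => w w0; apply: l2_delta_ne => e.
  by move: w0; rewrite -e len1.
pose L := (size (b :: l)).+1.*2.
pose fn n := iter n avgv f0; pose yn n := iter n avg y.
have Ayn n : A (yn n) by elim: n => //= n IH; exact: avg_op_A.
have ynfn n : yn n (delta 1%g) = fn n.
  by elim: n => //= n IH; rewrite (avg_op_delta qconj)// IH.
have f01 : f0 1%g = 0.
  by rewrite /f0 /y op_subE op_scaleE l2B l2Z l2_delta_id mulr1 subrr.
have fn1 n : fn n 1%g = 0.
  by elim: n => [|n IH] //; rewrite -[fn _]/(avgv (fn n)) avg_vec_at1.
have fnn n : l2_norm (fn n) <= rho ^+ n * l2_norm f0.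
  elim: n => [|n IH]; first by rewrite mul1r.
  apply: le_trans (avg_vec_gap (fn1 n)) _.
  by rewrite exprS -mulrA ler_wpM2l// ltW.
have fns n : supp_le X (d0 + n * L) (fn n).
  elim: n => [|n IH]; first by rewrite addn0.
  by have := @avg_vec_supp _ _ _ X q a c (b :: l) _ _ IH; rewrite mulSn [(L + _)%N]addnC addnA.
have fn_fin n : finvec (wball X es (d0 + n * L)) (fn n) = fn n.
  apply: l2_ext => w; rewrite finvecE ?wball_uniq//.
  by rewrite (wball_len X _ _ es_full); case: leqP => // /fns ->.
have yn_sum n : yn n = hecke_sum X q es (d0 + n * L) (fn n).
  apply: (A_eq qconj) => //; first by apply: poly_A; exact: hecke_sum_poly.
  by rewrite ynfn hecke_sum_delta fn_fin.
pose N := (size es * 5)%N.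
have [K K0 hK] : exists2 K : R, 0 <= K & forall n,
    (prefix_bound es (d0 + n * L))%:R ^+ 5 * rho ^+ n <= K.
  have [|M M0 hM] := @poly_subexp R N rho^-1; first by rewrite invf_gt1.
  exists ((d0 + L).+1%:R ^+ N * M); first by rewrite mulr_ge0// exprn_ge0.
  move=> n; rewrite -ler_pdivlMr ?exprn_gt0// -exprVn -mulrA.
  apply: le_trans (_ : (d0 + L).+1%:R ^+ N * n.+2%:R ^+ N <= _); last first.
    by rewrite ler_wpM2l ?exprn_ge0.
  rewrite -exprMn /prefix_bound natrX -exprM lerXn2r ?nnegrE ?mulr_ge0//.
  by rewrite -natrM ler_nat; nia.
have [n hn] := @geometric_small R rho (K * nsq f0) (eta ^+ 2) rho_gt0 rho_lt1
  (mulr_ge0 K0 (nsq_ge0 f0)) (exprn_gt0 2 eta0).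
exists n => xi; rewrite -/(yn n) yn_sum.
apply: l2_norm_sq_le; first by rewrite mulr_ge0 ?l2_norm_ge0// ltW.
apply: le_trans (haagerup raX es_full p_le1 _ _ _) _.
rewrite exprMn l2_normE ler_wpM2r ?nsq_ge0//.
rewrite fn_fin; apply: le_trans hn.
have P0 : 0 <= (prefix_bound es (d0 + n * L))%:R ^+ 5 :> R.
  by rewrite exprn_ge0.
apply: le_trans (_ : (prefix_bound es (d0 + n * L))%:R ^+ 5 *
   ((rho ^+ n) ^+ 2 * nsq f0) <= _).
  rewrite ler_wpM2l// -!l2_normE -exprMn lerXn2r// nnegrE ?l2_norm_ge0//.
  by rewrite mulr_ge0 ?l2_norm_ge0// exprn_ge0// ltW.
have rn0 : 0 <= rho ^+ n by rewrite exprn_ge0// ltW.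
have := hK n; move: (_ ^+ 5) P0 (rho ^+ n) rn0 => P P0 r r0 Pr.
have -> : P * (r ^+ 2 * nsq f0) = (P * r) * (nsq f0 * r) by ring.
by rewrite -[K * _ * _]mulrA ler_wpM2r// mulr_ge0 ?nsq_ge0.
Qed.

(** Cut down and rescaled, a nonzero element of the ideal gives one of trace 1. Its
    averages remain in the ideal. They are close to the averages of a polynomial
    of trace almost 1, and these become close to 1. *)
Theorem averaging_simple : cstar_simple A.
Proof.
move=> I idI; have [IsubA I0 Ic IA cI] := idI.
have [[y [Iy y0]]|no] := pselect (exists y, I y /\ y <> 0); last first.
  left; apply/seteqP; split=> [y Iy|_ -> //].
  by apply: contrapT => y0; apply: no; exists y.
right; have Ay : A y by exact: IsubA.
have [w yw] : exists w, y (delta 1%g) w <> 0.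
  apply: contrapT => no; apply: y0; apply: (A_separating qconj Ay).
  by apply: l2_ext => w; apply: contrapT => yw; apply: no; exists w.
have [a0 Aa0 ha0] := coefficient_op w.
pose z : op := (y (delta 1%g) w)^-1 *: (a0 \o y).
have Iz : I z.
  have [Iay _] := IA _ _ Aa0 Iy.
  by rewrite /z -[_ *: _]addr0; apply: Ic.
have Az : A z by exact: IsubA.
have tz : htrace z = 1.
  rewrite /htrace /z op_scaleE l2Z -[(a0 \o y) _]/(a0 (y (delta 1%g))) ha0.
  by rewrite mulVf//; apply/eqP.
have e8 : 0 < 8^-1 :> R by rewrite invr_gt0.
have [x px hx] := A_dense Az e8.
have [n hn] := avg_iter_small px e8.
have iter_sub (u v : op) : iter n avg (u - v) = iter n avg u - iter n avg v.
  by elim: (n) => //= m ->; exact: avg_op_sub.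
have iter_bd (u : op) M : opbd u M -> opbd (iter n avg u) M.
  by move=> hu; elim: (n) => //= m IH; exact: avg_op_bd.
have iter_scalar (k : C) : iter n avg (k *: id) = k *: id.
  by elim: (n) => //= m ->; exact: avg_op_scalar.
have Ib : I (iter n avg z).
  by elim: (n) => //= m IH; exact: avg_op_ideal.
apply: (ideal_near_id idI Ib).
have tx : normc (htrace x - 1) <= 8^-1.
  have -> : htrace x - 1 = htrace (x - z) by rewrite -tz /htrace op_subE l2B.
  exact/htrace_bd/opbd_subC.
have -> : id - iter n avg z = (iter n avg (x - z) - iter n avg (x - htrace x *: id)) +
    (1 - htrace x) *: id.
  rewrite !iter_sub iter_scalar; apply/funext => f; apply: l2_ext => v.
  rewrite op_subE op_addE !op_subE !op_scaleE -[id f]/f !(l2B, l2D, l2Z).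
  by move: (f v) (iter n avg z f v) (iter n avg x f v) => u1 u2 u3; ring.
apply: (@opbd_le _ _ _ ((8^-1 + 8^-1) + 8^-1)); first by lra.
apply: opbd_add; first by apply: opbd_sub hn; apply: iter_bd; exact: opbd_subC.
by move=> f; rewrite op_scaleE l2_normZ ler_wpM2r ?l2_norm_ge0// normc_dist.
Qed.

End Averages.

End Simplicity.

Lemma hecke_p_small (R : realType) (S : choiceType) (q : S -> R) (d : R) s : d <= 2^-1 ->
  `|q s - 1| < d -> `|hecke_p q s| <= 2 * d.
Proof.
move=> d2 qd; have : `|q s - 1| < 2^-1 by exact: lt_le_trans d2.
rewrite ltr_distl => /andP[q2 _].
have sq : 2^-1 <= Num.sqrt (q s).
  have h0 : 0 <= 2^-1 :> R by rewrite invr_ge0.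
  by rewrite -[leLHS](ger0_norm h0) -sqrtr_sqr ler_wsqrtr// expr2; lra.
rewrite /hecke_p normrM; apply: ler_pM => //; last exact: ltW.
rewrite normfV ger0_norm ?sqrtr_ge0// -[leRHS]invrK.
rewrite lef_pV2 ?posrE ?invr_gt0//; apply: lt_le_trans sq.
by rewrite invr_gt0.
Qed.

Lemma open_box (R : realType) (S : choiceType) (es : seq S) (d : R) :
  open [set q : {ptws S -> R} | forall s, s \in es -> `|q s - 1| < d].
Proof.
elim: es => [|s es IH].
  rewrite [X in open X](_ : _ = setT); first exact: openT.
  by apply/seteqP; split.
rewrite [X in open X](_ : _ = [set q : {ptws S -> R} | `|q s - 1| < d] `&`
    [set q : {ptws S -> R} | forall s, s \in es -> `|q s - 1| < d]).
  apply: openI => //.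
  have cs : continuous (fun q : {ptws S -> R} => q s).
    exact: (@proj_continuous S (fun=> R) s).
  have -> : [set q : {ptws S -> R} | `|q s - 1| < d] =
      (fun q : {ptws S -> R} => q s) @^-1` ball (1 : R) d.
    by apply/seteqP; split=> q; rewrite /ball /= distrC.
  by apply: open_comp => [q _|]; [exact: cs|exact: ball_open].
apply/seteqP; split=> q.
  by move=> h; split=> [|t tes]; apply: h; rewrite inE ?eqxx ?tes ?orbT.
by move=> [h1 h2] t; rewrite inE => /orP[/eqP->|]; [exact: h1|exact: h2].
Qed.

Theorem theorem0p4 (R : realType) (W : groupType) (S : choiceType)
    (X : coxeterSystem W S) (irrX : irreducible X) :
  [/\
    forall q : S -> R, multi_parameter X q ->
      spherical_type W \/ affine_type W ->
      ~ cstar_simple (hecke_cstar_algebra X q) /\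
      ~ unique_tracial_state (hecke_cstar_algebra X q),
    finite_set [set: S] ->
      forall q : S -> R, multi_parameter X q ->
      nonaffine_type W ->
      closure (convergence_region X R) (flip_parameter q) ->
      ~ cstar_simple (hecke_cstar_algebra X q) /\
      ~ unique_tracial_state (hecke_cstar_algebra X q)
  & right_angled X ->
      finite_set [set: S] -> (3 <= #|` fset_set [set: S]|)%N ->
      exists U : set {ptws S -> R},
        [/\ open U, U (fun=> 1), U `<=` [set q | forall s, 0 < q s]
          & forall q : S -> R, U q ->
              cstar_simple (hecke_cstar_algebra X q)]
  ].
Proof.
have [s0 _] := irrX.1.
split=> [q qX type|finS q qX _ clq|raX finS card3].
- apply: (subexponential_not_simple qX) => //.
  by case: type; [exact: spherical_subexponential|exact: affine_subexponential].
- exact: (subexponential_not_simple qX (closure_subexponential qX finS clq)).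
pose es := enum_fset (fset_set [set: S]).
have es_full s : s \in es by rewrite /es -[_ \in _]/(s \in fset_set _) in_fset_set// inE.
have [x [y [z xyz]]] : exists x y z : S, [/\ x != y, x != z & y != z].
  have : uniq es by exact: fset_uniq.
  move: card3; rewrite -[#|` _|]/(size es); case: (es) => [|x [|y [|z l]]]//= _.
  rewrite !inE !negb_or => /andP[/and3P[xy xz _] /andP[/andP[yz _] _]].
  by exists x, y, z.
have [a [b [c [ba bc ac]]]] : exists a b c, [/\ cox_edge X b a, cox_edge X b c & a != c].
  by apply: exists_branching => //; exists x, y, z.
have [l [pl lb cover]] := closed_walk b irrX es.
(* [|q_s - 1| < d <= 1/2] gives [|p_s| <= 2 d], and [averaging_simple] asks for
   [|p_s| <= 1 / (80 * (size l + 1))]. *)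
pose d : R := (160 * (size l).+1%:R)^-1.
have d0 : 0 < d by rewrite invr_gt0 mulr_gt0.
have d2 : d <= 2^-1.
  rewrite lef_pV2 ?posrE ?mulr_gt0//.
  have n1 : 1 <= (size l).+1%:R :> R by rewrite ler1n.
  by move: (_%:R) n1 => n; lra.
exists [set q : {ptws S -> R} | forall s, s \in es -> `|q s - 1| < d]; split.
- exact: open_box.
- by move=> s _; rewrite subrr normr0.
- move=> q Uq s; have := Uq s (es_full s); rewrite ltr_distl => /andP[lt _].
  by apply: le_lt_trans lt; rewrite subr_ge0 (le_trans d2)// invf_le1// ler1n.
move=> q Uq.
apply: (averaging_simple raX es_full ba bc ac pl lb) => [s|s]; first exact/cover.
apply: le_trans (hecke_p_small d2 (Uq s (es_full s))) _.
have n0 : (size l).+1%:R != 0 :> R by rewrite pnatr_eq0.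
suff -> : 2 * d = (80 * (size l).+1%:R)^-1 by [].
by rewrite /d; move: (_%:R) n0 => n n0; field.
Qed.
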